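(* Let $n$ be a positive even integer, $\lambda,m$ positive integers, and $\mathcal{T}=[T_1^{\langle\beta_1\rangle},\ldots,T_s^{\langle\beta_s\rangle}]$ an admissible bipartite 2-factorization type for $\lambda mK_n$, with each $T_i$ an admissible bipartite 2-factor type for $K_n$. Suppose there exists a refinement $[\alpha_1,\ldots,\alpha_k]$ of $[\beta_1,\ldots,\beta_s]$ such that one of the following holds: (i) $n\equiv2\pmod4$ and $|\{i:\alpha_i\text{ is odd}\}|\le\lfloor\lambda m/2\rfloor$; (ii) $n\equiv0\pmod4$, $|\{i:\alpha_i\text{ is odd}\}|\le\lambda m+\lfloor\lambda m/2\rfloor$, and $|\{i:\alpha_i\text{ is odd},\ \alpha_i\ge3\}|\ge\lambda m$. Then $\lambda K_{n\times m}$ admits a 2-factorization of type $[(mT_1)^{\langle\beta_1\rangle},\ldots,(mT_s)^{\langle\beta_s\rangle}]$.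
   Context: $\mu K_n$: complete multigraph on $n$ vertices with $\mu$ parallel edges per pair; $\lambda K_{n\times m}$: complete $\lambda$-fold $n$-partite multigraph with parts of size $m$. A 2-factor has type $[c_1,\ldots,c_t]$ if it is a disjoint union of cycles of these lengths; $mT=[mx:x\in T]$; a type is bipartite if all entries are even; admissible for $K_n$ iff entries are integers $\ge3$ summing to $n$, and for $\mu K_n$ with $\mu\ge2$ iff entries are $\ge2$ summing to $n$. A 2-factorization of an $r$-regular graph is a decomposition into $\lfloor r/2\rfloor$ 2-factors plus a single 1-factor if $r$ is odd; its type is the multiset of types of its 2-factors. A 2-factorization type for an $r$-regular graph is admissible if it consists of $\lfloor r/2\rfloor$ admissible 2-factor types, bipartite if all are bipartite. $[T^{\langle a\rangle}]$ denotes $a$ copies of $T$. A multiset $[y_1,\ldots,y_t]$ of positive integers is a refinement of $[x_1,\ldots,x_s]$ if $\{1,\ldots,t\}$ can be partitioned into $P_1,\ldots,P_s$ with $\sum_{j\in P_i}y_j=x_i$. *)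

(* Defs.v *)
From mathcomp Require Import all_boot.

Set Implicit Arguments.
Unset Strict Implicit.
Unset Printing Implicit Defensive.

(* Loopless multigraphs on V: [mult G u v] is the number of parallel edges
   joining u and v. *)
Record mgraph (V : finType) := MGraph {
  mult :> V -> V -> nat;
  mult_sym : commutative mult;
  mult_loopless : forall v, mult v v = 0
}.

Definition regular (V : finType) (G : mgraph V) (r : nat) : Prop :=
  forall v, \sum_u G v u = r.

Lemma complete_multipartite_sym lam n m :
  commutative (fun u v : 'I_n * 'I_m => if u.1 == v.1 then 0 else lam).
Proof. by move=> u v; rewrite eq_sym. Qed.

Lemma complete_multipartite_loopless lam n m (v : 'I_n * 'I_m) :
  (if v.1 == v.1 then 0 else lam) = 0.
Proof. by rewrite eqxx. Qed.

(* lam K_{n x m}: the part of a vertex is its first component. *)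
Definition complete_multipartite lam n m : mgraph ('I_n * 'I_m)%type :=
  MGraph (@complete_multipartite_sym lam n m)
         (@complete_multipartite_loopless lam n m).

Lemma complete_mgraph_sym mu n :
  commutative (fun u v : 'I_n => if u == v then 0 else mu).
Proof. by move=> u v; rewrite eq_sym. Qed.

Lemma complete_mgraph_loopless mu n (v : 'I_n) : (if v == v then 0 else mu) = 0.
Proof. by rewrite eqxx. Qed.

(* mu K_n: mu parallel edges between any two vertices. *)
Definition complete_mgraph mu n : mgraph 'I_n :=
  MGraph (@complete_mgraph_sym mu n) (@complete_mgraph_loopless mu n).

Lemma complete_mgraph_regular mu n :
  regular (complete_mgraph mu n) (mu * n.-1).
Proof.
move=> v; rewrite (bigD1 v) //= eqxx add0n.
rewrite (eq_bigr (fun=> mu)) => [|u uv]; last by rewrite eq_sym (negbTE uv).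
rewrite sum_nat_const mulnC; congr (_ * _).
by rewrite (cardC1 v) card_ord.
Qed.

Lemma complete_multipartite_regular lam n m :
  regular (complete_multipartite lam n m) (lam * m * n.-1).
Proof.
move=> v; rewrite -(pair_big predT predT (fun i j => complete_multipartite lam n m v (i, j))) /=.
under eq_bigr => i _ do rewrite sum_nat_const card_ord.
rewrite -big_distrr /= (complete_mgraph_regular lam v.1).
by rewrite mulnA [m * _]mulnC.
Qed.

(* The 2-cycle consists of two parallel edges: for c = [:: a; b] this counts
   the edge ab twice. *)
Definition cycle_mult (V : finType) (c : seq V) (u v : V) : nat :=
  count (fun e => (e == (u, v)) || (e == (v, u))) (zip c (rot 1 c)).

(* Multisets are represented by sequences, considered up to [perm_eq]. *)
Definition factor_type := seq nat.
Definition factorization_type := seq factor_type.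

(* F is a 2-factor (on the whole vertex set V) of type T: the cycles cs are
   vertex-disjoint, cover V, and have the lengths listed in T. *)
Definition two_factor_of_type (V : finType) (F : mgraph V) (T : factor_type) :
    Prop :=
  exists cs : seq (seq V),
    [/\ perm_eq (flatten cs) (enum V),
        all (fun c => 2 <= size c) cs,
        perm_eq (map size cs) T
      & forall u v, F u v = \sum_(c <- cs) cycle_mult c u v].

(* [regular I (odd r)]: I is a 1-factor when r is odd, and has no edge when r
   is even. *)
Definition has_two_factorization (V : finType) (G : mgraph V)
    (Ts : factorization_type) : Prop :=
  exists r, [/\ regular G r, size Ts = r./2 &
    exists (F : 'I_(size Ts) -> mgraph V) (I : mgraph V),
      [/\ forall i, two_factor_of_type (F i) (nth [::] Ts i),
          regular I (odd r)
        & forall u v, G u v = \sum_i F i u v + I u v]].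

Definition admissible_factor (mu n : nat) (T : factor_type) : bool :=
  all (leq (if mu == 1 then 3 else 2)) T && (sumn T == n).

Definition bipartite_factor (T : factor_type) : bool :=
  all (fun c => ~~ odd c) T.

(* mu K_n is regular of degree mu (n - 1), see [complete_mgraph_regular]. *)
Definition admissible_factorization (mu n : nat) (Ts : factorization_type) :
    bool :=
  (size Ts == (mu * n.-1)./2) && all (admissible_factor mu n) Ts.

Definition bipartite_factorization (Ts : factorization_type) : bool :=
  all bipartite_factor Ts.

Definition scale_type (m : nat) (T : factor_type) : factor_type :=
  [seq m * x | x <- T].

(* [T_1^<beta_1>, ..., T_s^<beta_s>] *)
Definition type_with_mult (s : nat) (T : 'I_s -> factor_type)
    (beta : 'I_s -> nat) : factorization_type :=
  flatten [seq nseq (beta i) (T i) | i <- enum 'I_s].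

(* [y_1, ..., y_t] is a refinement of [x_1, ..., x_s]. *)
Definition refinement (t s : nat) (y : 'I_t -> nat) (x : 'I_s -> nat) : Prop :=
  [/\ forall j, 0 < y j,
      forall i, 0 < x i
    & exists P : 'I_s -> {set 'I_t},
        [/\ injective P,
            partition [set P i | i : 'I_s] [set: 'I_t]
          & forall i, \sum_(j in P i) y j = x i]].

(* Main.v *)
(* Blow-up.  A packing of [mu K_n], with [mu = lam * m], by 2-factors of types
   [T_i] gives one of [lam K_{n x m}] by 2-factors of types [m T_i]: traverse every
   cycle [m] times, regard its vertices as amalgamations of [m] vertices, and split
   these off one by one.  When a vertex of weight [p] loses one unit, Hall's theorem
   selects the two ends that move in every closed walk so that each neighbour
   receives its fair share of the edges.  Since a cycle stays a single closed walk,
   its length is only multiplied by [m].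

   Packing [mu K_n].  Decompose each of the [mu] copies of [K_n] (two vertices per
   column, [q = n/2] columns) along zigzag Hamilton cycles on the columns: the
   blow-up of such a cycle splits into two 2-factors of any prescribed bipartite
   type (Haggkvist).  If [4 | n], three column matchings remain; together with the
   edges inside the columns their blow-up is a ladder of blocks of four vertices
   containing three 2-factors of any prescribed type, which is shown by composing
   explicit tiles.  Each copy leaves a perfect matching; relabelling two copies so
   that their matchings are the two halves of an even 2-factor [F] yields one
   further single 2-factor per pair of copies.  The refinement provides exactly the
   required numbers of triples, pairs and singles. *)
Require Import Defs.
From mathcomp Require Import all_boot zify.

Set Implicit Arguments.
Unset Strict Implicit.
Unset Printing Implicit Defensive.

(** * Hall's theorem and balanced choices *)

(** Only packings are built. The number of 2-factors is half the degree, rounded down, so a degree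
    count shows that what remains is a perfect matching or empty, and no construction has to control
    it.

    The multiplicity bound [lam * g a * g b] is linear in each weight, hence a fair share of the
    edges preserves it when one unit of weight moves. At the start all weights are [m], and [m]
    traversals of at most [lam * m] edges respect [lam * m * m].

    For [n] divisible by 4 the number of columns is even and the column graph has odd degree, so
    Hamilton cycles cannot exhaust it. One column matching would be too little room: with two more
    and the column edges the ladder has degree 7, enough for three 2-factors and a matching. These
    three have to be built together, which is the origin of the triples in condition (ii).

    A tile records which positions are joined and not how long the paths are, so that finitely many
    computed checks cover all cycle lengths.

    A pair of equal 2-factors can be used as two singles, but an odd part forces a single or a
    triple. This is why only odd parts are counted in the conditions. *)

Lemma card_fibers_sum (E Z : finType) (r : E -> Z) (A : {set Z}) :
  #|[set e | r e \in A]| = \sum_(y in A) #|[set e | r e == y]|.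
Proof.
rewrite -sum1_card (partition_big r (mem A)) /=; last by move=> e; rewrite inE.
apply: eq_bigr => y yA; rewrite -sum1_card; apply: eq_bigl => e.
by rewrite !inE; case: eqP => [->|]; rewrite ?yA ?andbF.
Qed.

(** Induction on the size of [D]. A tight non-empty proper subset is matched first, and the rest
    outside its neighbourhood. Without tight subset one element is matched arbitrarily, which costs
    every neighbourhood at most one vertex. *)
Lemma hall_on (L R : finType) (r0 : R) (N : L -> {set R}) (D : {set L}) :
  (forall A : {set L}, A \subset D -> #|A| <= #|\bigcup_(i in A) N i|) ->
  exists f : L -> R, {in D &, injective f} /\ {in D, forall i, f i \in N i}.
Proof.
move: {2}#|D| (leqnn #|D|) N => d; elim: d D => [|d IHd] D leD N hallN.
  exists (fun=> r0); move: leD; rewrite leqn0 cards_eq0 => /eqP ->.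
  by split=> [i j|i]; rewrite inE.
have [->|[i0 i0D]] := set_0Vmem D.
  by exists (fun=> r0); split=> [i j|i]; rewrite inE.
have [/existsP[A /and4P[A0 AD nAD /eqP tight]]|] :=
    boolP [exists A : {set L}, [&& A != set0, A \subset D, A != D
                                 & #|\bigcup_(i in A) N i| == #|A|]].
  have ltAD : #|A| < #|D| by apply: proper_card; rewrite properEneq nAD.
  have [f [finj fN]] : exists f : L -> R,
      {in A &, injective f} /\ {in A, forall i, f i \in N i}.
    apply: IHd => [|B BA]; first by rewrite -ltnS (leq_trans ltAD).
    by apply: hallN; apply: subset_trans AD.
  pose M := \bigcup_(i in A) N i.
  have [h [hinj hN]] : exists h : L -> R, {in D :\: A &, injective h} /\
      {in D :\: A, forall i, h i \in N i :\: M}.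
    apply: IHd => [|B BDA].
      have := cardsID A D; rewrite (setIidPr AD).
      have : 0 < #|A| by rewrite card_gt0.
      lia.
    have /hallN : A :|: B \subset D.
      by rewrite subUset AD (subset_trans BDA) // subsetDl.
    have AB0 : A :&: B = set0.
      apply/setP=> i; rewrite !inE; apply/negP=> /andP[iA /(subsetP BDA)].
      by rewrite inE iA.
    rewrite bigcup_setU cardsU AB0 cards0 subn0 -/M.
    have -> : \bigcup_(i in B) (N i :\: M) = (\bigcup_(i in B) N i) :\: M.
      apply/setP=> y; rewrite inE; apply/bigcupP/andP=> [[i iB]|[yM /bigcupP[i iB yN]]].
        by rewrite inE => /andP[yM yN]; split=> //; apply/bigcupP; exists i.
      by exists i => //; rewrite inE yM.
    have := cardsID M (\bigcup_(i in B) N i).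
    rewrite cardsU setIC; move: tight; rewrite -/M.
    have := subset_leq_card (subsetIl M (\bigcup_(i in B) N i)).
    lia.
  exists (fun i => if i \in A then f i else h i); split=> [i j iD jD|i iD].
    have hM k : k \in D -> k \notin A -> h k \notin M.
      by move=> kD kA; have := hN k; rewrite !inE kD kA => /(_ isT) /andP[].
    have fM k : k \in A -> f k \in M.
      by move=> kA; apply/bigcupP; exists k => //; apply: fN.
    case: ifP => iA; case: ifP => jA e.
    - exact: finj.
    - by have := hM j jD (negbT jA); rewrite -e fM.
    - by have := hM i iD (negbT iA); rewrite e fM.
    - by apply: hinj => //; rewrite inE ?iA ?jA.
  case: ifP => iA; first exact: fN.
  by have := hN i; rewrite !inE iA iD => /(_ isT) /andP[].
rewrite negb_exists => /forallP notight.
have /card_gt0P[y yN] : 0 < #|N i0|.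
  have := hallN [set i0]; rewrite sub1set i0D big_set1 cards1; exact.
have [f [finj fN]] : exists f : L -> R, {in D :\ i0 &, injective f} /\
    {in D :\ i0, forall i, f i \in N i :\ y}.
  apply: IHd => [|B BD]; first by move: leD; rewrite (cardsD1 i0) i0D.
  have [->|B0] := eqVneq B set0; first by rewrite cards0.
  have BsD : B \subset D by apply: subset_trans BD (subsetDl _ _).
  have BnD : B != D.
    apply: contraTneq i0D => <-; apply/negP=> /(subsetP BD).
    by rewrite !inE eqxx.
  have := notight B; rewrite B0 BsD BnD /= => ne.
  have -> : \bigcup_(i in B) (N i :\ y) = (\bigcup_(i in B) N i) :\ y.
    apply/setP=> z; rewrite !inE; apply/bigcupP/andP=> [[i iB]|[zy /bigcupP[i iB zN]]].
      by rewrite !inE => /andP[zy zN]; split=> //; apply/bigcupP; exists i.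
    by exists i => //; rewrite !inE zy.
  move: ne (hallN B BsD); rewrite (cardsD1 y (\bigcup_(i in B) N i)).
  case: (_ \in _) => /=; lia.
exists (fun i => if i == i0 then y else f i); split=> [i j iD jD|i iD].
  case: eqP => [->|ii]; case: eqP => [->|jj] // e.
  - by have := fN j; rewrite !inE -e eqxx jD andbT => /(_ (introN eqP jj)).
  - by have := fN i; rewrite !inE e eqxx iD andbT => /(_ (introN eqP ii)).
  - by apply: finj => //; rewrite !inE; apply/andP; split=> //; apply/eqP.
case: eqP => [->|/eqP ii] //.
by have := fN i; rewrite !inE ii iD => /(_ isT) /andP[].
Qed.

(** [E] is the edge set of a [p]-regular bipartite multigraph, and the edges [f x] form a perfect
    matching. Hall's condition holds since the [p * #|A|] edges at [A] all end in its neighbourhood,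
    which carries [p] edges per vertex. *)
Lemma regular_choice (E L R : finType) (l : E -> L) (r : E -> R) p : 0 < p ->
  (forall x, #|[set e | l e == x]| = p) -> (forall y, #|[set e | r e == y]| = p) ->
  exists f : L -> E, (forall x, l (f x) = x) /\ bijective (r \o f).
Proof.
move=> p0 lp rp.
have cardL (A : {set L}) : #|[set e | l e \in A]| = #|A| * p.
  by rewrite card_fibers_sum (eq_bigr (fun=> p)) ?sum_nat_const.
have cardR (A : {set R}) : #|[set e | r e \in A]| = #|A| * p.
  by rewrite card_fibers_sum (eq_bigr (fun=> p)) ?sum_nat_const.
have eqLR : #|L| = #|R|.
  apply/eqP; rewrite -(eqn_pmul2r p0) -!cardsT -cardL -cardR.
  by apply/eqP; congr #|pred_of_set _|; apply/setP=> e; rewrite !inE.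
have [L0|/card_gt0P[x0 _]] := posnP #|L|.
  have F (x : L) : False by have := fintype0 x; rewrite L0.
  have G (y : R) : False by have := fintype0 y; rewrite -eqLR L0.
  exists (fun x => False_rect _ (F x)); split=> [x|]; first by case: (F x).
  by exists (fun y => False_rect _ (G y)) => [x|y]; [case: (F x)|case: (G y)].
have /card_gt0P[y0 _] : 0 < #|R| by rewrite -eqLR; apply/card_gt0P; exists x0.
have hc (A : {set L}) : A \subset setT ->
    #|A| <= #|\bigcup_(i in A) r @: [set e | l e == i]|.
  move=> _; rewrite -(leq_pmul2r p0) -cardL -cardR; apply/subset_leq_card/subsetP=> e.
  rewrite !inE => eA; apply/bigcupP; exists (l e) => //.
  by apply/imsetP; exists e; rewrite ?inE.
have [f [finj fN]] := hall_on y0 hc.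
have pick x : exists e, (l e == x) && (r e == f x).
  have /imsetP[e] := fN x (in_setT x).
  by rewrite inE => lex ->; exists e; rewrite lex eqxx.
exists (fun x => xchoose (pick x)); split=> [x|].
  by have /andP[/eqP] := xchooseP (pick x).
apply: inj_card_bij; last by rewrite eqLR.
move=> x x' /= e; apply: finj; rewrite ?inE //.
have /andP[_ /eqP <-] := xchooseP (pick x).
by have /andP[_ /eqP <-] := xchooseP (pick x').
Qed.

Lemma card_chunk N p j : 0 < p ->
  #|[set i : 'I_N | i %/ p == j]| = minn p (N - j * p).
Proof.
move=> p0; elim: N => [|N IHN].
  by rewrite sub0n minn0; apply/eqP; rewrite cards_eq0 -subset0; apply/subsetP=> -[].
have -> : [set i : 'I_N.+1 | i %/ p == j] =
    [set widen_ord (leqnSn N) i | i in [set i : 'I_N | i %/ p == j]]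
    :|: (if N %/ p == j then [set ord_max] else set0).
  apply/setP=> i; rewrite !inE; apply/idP/orP.
    have [iN ij|] := ltnP i N.
      left; apply/imsetP; exists (Ordinal iN); rewrite ?inE //.
      exact: val_inj.
    move=> Ni ij; right; have -> : i = ord_max.
      by apply: ord_inj => /=; have := ltn_ord i; lia.
    have iN : i = N :> nat by have := ltn_ord i; lia.
    have -> : N %/ p == j by rewrite -iN.
    by rewrite inE.
  case=> [/imsetP[k kj ->]|]; first by rewrite inE in kj.
  by case: ifP => Nj; rewrite !inE // => /eqP ->.
rewrite cardsU disjoint_setI0 ?cards0 ?subn0; last first.
  rewrite disjoints_subset; apply/subsetP=> i /imsetP[k _ ->]; rewrite !inE.
  case: ifP => _; rewrite ?inE //; apply/negP=> /eqP/(congr1 (@nat_of_ord _)) /=.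
  by have := ltn_ord k; lia.
rewrite card_imset; last by move=> i k /(congr1 val) /= /val_inj.
rewrite IHN; have := divn_eq N p; have := ltn_pmod N p0.
case: eqP => [<-|]; rewrite ?cards1 ?cards0.
  move=> h1 h2; rewrite /minn; case: ltnP; case: ltnP; lia.
move=> nj h1 h2.
have [lt|] := ltnP j (N %/ p).
  have : j.+1 * p <= N %/ p * p by rewrite leq_mul2r lt orbT.
  rewrite mulSn; lia.
rewrite leq_eqVlt => /orP[/eqP e|lt]; first by case: nj.
have : (N %/ p).+1 * p <= j * p by rewrite leq_mul2r lt orbT.
rewrite mulSn; lia.
Qed.

Lemma card_ord_lt N c : #|[set i : 'I_N | i < c]| = minn c N.
Proof.
case: c => [|c]; last first.
  rewrite -[in RHS](subn0 N) -[X in N - X](mul0n c.+1) -card_chunk //.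
  apply: eq_card => i; rewrite !inE; apply/idP/eqP => [/divn_small //|i0].
  by rewrite (divn_eq i c.+1) i0 ltn_pmod.
by rewrite min0n; apply/eqP; rewrite cards_eq0; apply/eqP/setP=> i; rewrite !inE.
Qed.

Lemma card_index_chunk (T : finType) (A : {set T}) p j : 0 < p ->
  #|[set e in A | index e (enum A) %/ p == j]| = minn p (#|A| - j * p).
Proof.
move=> p0; rewrite -card_chunk //.
have [->|[e0 e0A]] := set_0Vmem A.
  rewrite (_ : [set e in _ | _] = set0) ?cards0; last first.
    by apply/setP=> e; rewrite !inE.
  by rewrite card_chunk // cards0 sub0n minn0.
rewrite -(card_imset _ (enum_val_inj (A := mem A))).
congr #|pred_of_set _|; apply/setP=> e; rewrite !inE.
have idx (i : 'I_#|A|) : index (enum_val i) (enum A) = i.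
  by rewrite /enum_val index_uniq ?enum_uniq // -cardE.
apply/andP/imsetP=> [[eA ej]|[i]].
  by exists (enum_rank_in eA e); rewrite ?enum_rankK_in // inE -idx enum_rankK_in.
by rewrite inE => ij ->; rewrite enum_valP idx.
Qed.

(* Filling the fibres of [r] up to size [p] with extra edges makes the graph
   regular; a fibre that already had size [p] receives none of them. *)
Lemma full_choice (E L R : finType) (l : E -> L) (r : E -> R) p : 0 < p ->
  (forall x, #|[set e | l e == x]| = p) -> (forall y, #|[set e | r e == y]| <= p) ->
  exists f : L -> E, [/\ forall x, l (f x) = x, injective (r \o f)
    & forall y, #|[set e | r e == y]| = p -> exists x, r (f x) = y].
Proof.
move=> p0 lp rp; pose d y := p - #|[set e | r e == y]|.
pose F : finType := {y : R & 'I_(d y)}.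
have cardE : #|E| = #|L| * p.
  rewrite -[LHS]cardsT -[#|L|]cardsT -sum_nat_const.
  rewrite -(eq_bigr _ (fun x _ => lp x)) -card_fibers_sum.
  by apply: eq_card => e; rewrite !inE.
have sumd : #|F| + #|L| * p = #|R| * p.
  rewrite -cardE card_tagged sumnE big_map big_enum /= -[#|E|]cardsT.
  have -> : #|[set: E]| = \sum_y #|[set e | r e == y]|.
    rewrite -(eq_bigl _ _ (in_setT (T := R))) -card_fibers_sum.
    by apply: eq_card => e; rewrite !inE.
  rewrite -big_split -sum_nat_const; apply: eq_bigr => y _ /=.
  by rewrite card_ord subnK.
have cardF : #|F| = (#|R| - #|L|) * p by rewrite mulnBl; lia.
have rk_lt (z : F) : enum_rank z %/ p < #|R| - #|L|.
  by rewrite ltn_divLR // -cardF ltn_ord.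
(* The extra edges are dealt out, in chunks of [p], to [#|R| - #|L|] extra left vertices; both sides
   are then [p]-regular. *)
pose l' (z : E + F) : L + 'I_(#|R| - #|L|) :=
  match z with inl e => inl (l e) | inr z => inr (Ordinal (rk_lt z)) end.
pose r' (z : E + F) := match z with inl e => r e | inr z => tag z end.
have splitE (P : pred (E + F)) :
    #|[set z | P z]| = #|[set e | P (inl e)]| + #|[set z | P (inr z)]|.
  rewrite -!sum1dep_card big_sumType /=; congr (_ + _); exact: eq_bigl.
have l'p x : #|[set z | l' z == x]| = p.
  rewrite splitE; case: x => x /=.
    rewrite -[RHS](lp x) -[RHS]addn0; congr (_ + _).
    by apply/eqP; rewrite cards_eq0; apply/eqP/setP=> z; rewrite !inE.
  rewrite (_ : [set e | _] = set0) ?cards0 ?add0n; last by apply/setP=> z; rewrite !inE.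
  transitivity (minn p (#|F| - x * p)); last first.
    have : x.+1 * p <= (#|R| - #|L|) * p by rewrite leq_mul2r ltn_ord orbT.
    by move: cardF; rewrite mulSn => <-; lia.
  rewrite -card_chunk // -[LHS](card_imset _ (@enum_rank_inj F)).
  apply: eq_card => i; rewrite inE; apply/imsetP/idP => [[z]|ix].
    by rewrite inE => /eqP[<-] ->.
  by exists (enum_val i); rewrite ?enum_valK // inE; apply/eqP; congr inr;
    apply: val_inj; rewrite /= enum_valK; apply/eqP.
have r'p y : #|[set z | r' z == y]| = p.
  rewrite splitE /= -[RHS](subnKC (rp y)); congr (_ + _).
  rewrite -/(d y) -[RHS]card_ord -[RHS]cardsT.
  have tinj : injective (fun i : 'I_(d y) => Tagged (fun y => 'I_(d y)) i).
    by move=> i j /eqP; rewrite eq_Tagged /= => /eqP.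
  rewrite -(card_imset _ tinj); apply: eq_card => -[y' i]; rewrite inE /=.
  apply/eqP/imsetP => [yy|[i' _ /(congr1 (@tag _ _))]] //.
  by move: i; rewrite yy => i; exists i.
have [f [lf [g fg gf]]] := regular_choice p0 l'p r'p.
have inlf x : {e | f (inl x) = inl e}.
  by case ef: (f (inl x)) => [e|z]; [exists e|have := lf (inl x); rewrite ef].
exists (fun x => sval (inlf x)); split=> [x|x x'|y ye] /=.
- by case: (inlf x) => e ee /=; have := lf (inl x); rewrite ee => -[].
- case: (inlf x) (inlf x') => [e ee] [e' ee'] /= rr.
  have h1 := fg (inl x); have h2 := fg (inl x').
  by move: h1; rewrite /= ee /= rr -[r e']/(r' (inl e')) -ee' h2 => -[].
- have := gf y; rewrite /=; case: (g y) => [x|j].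
    by move=> yy; exists x; move: yy; case: (inlf x) => e /= ->.
  case ej: (f (inr j)) => [e|[y' i]] /= yy.
    by have := lf (inr j); rewrite ej.
  have d0 : d y' = 0 by rewrite /d yy ye subnn.
  by move: (ltn_ord i); rewrite [X in _ < X]d0.
Qed.

(** The occurrences of each label are cut into chunks of [p], which become the right vertices of
    [full_choice]: no chunk is hit twice and every full chunk is hit. So a label with [N]
    occurrences is chosen between floor and ceiling of [N / p] times. The conclusion bounds both the
    chosen and the remaining occurrences. *)
Lemma balanced_choice (L Z : finType) p (nu : L -> 'I_p -> Z) : 0 < p ->
  exists f : L -> 'I_p, forall z c,
    #|[set e : L * 'I_p | nu e.1 e.2 == z]| <= c * p ->
    #|[set x | nu x (f x) == z]| <= c /\
    #|[set e : L * 'I_p | nu e.1 e.2 == z]| <=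
      #|[set x | nu x (f x) == z]| + c * p.-1.
Proof.
move=> p0; pose E : finType := (L * 'I_p)%type.
pose fib (z : Z) := [set e : E | nu e.1 e.2 == z].
pose rk (e : E) := index e (enum (fib (nu e.1 e.2))) %/ p.
have rk_lt e : rk e < #|E|.+1.
  rewrite ltnS (leq_trans (leq_div _ _)) // (leq_trans (index_size _ _)) //.
  by rewrite -cardE max_card.
pose r e : Z * 'I_#|E|.+1 := (nu e.1 e.2, Ordinal (rk_lt e)).
have fibr z j : #|[set e | r e == (z, j)]| = minn p (#|fib z| - j * p).
  rewrite -card_index_chunk //; apply: eq_card => e; rewrite !inE /r xpair_eqE.
  by rewrite -val_eqE /= /rk; case: eqP => [->|].
have fibl (x : L) : #|[set e : E | e.1 == x]| = p.
  have pinj : injective (pair x : 'I_p -> E) by move=> i j [].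
  rewrite -[RHS]card_ord -[RHS]cardsT -[RHS](card_imset _ pinj).
  apply: eq_card => -[x' i]; rewrite !inE /=; apply/eqP/imsetP => [->|[i' _ [->]]] //.
  by exists i.
have [|f [fl finj ffull]] := @full_choice E L _ fst r p p0 fibl _.
  by case=> z j; rewrite fibr geq_minl.
have fE x : f x = (x, (f x).2) by case: (f x) (fl x) => a b /= ->.
exists (fun x => (f x).2) => z c; rewrite -/(fib z); set N := #|fib z|.
set s := #|_| => Nc.
have hs : s = #|[set j : 'I_#|E|.+1 | [exists x, r (f x) == (z, j)]]|.
  rewrite /s -(card_in_imset (f := fun x => (r (f x)).2)) => [|x x'].
    apply: eq_card => j; rewrite inE; apply/imsetP/existsP => [[x]|[x]].
      rewrite inE => /eqP nx ->; exists x; rewrite /r {1}[f x]fE /= nx //.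
    by rewrite /r xpair_eqE {1}(fE x) /= => /andP[nx /eqP <-]; exists x; rewrite ?inE.
  rewrite !inE => /eqP nx /eqP nx' e; apply: finj => /=.
  move: e; rewrite [r (f x)]surjective_pairing [r (f x')]surjective_pairing => /= e.
  by rewrite e; congr pair; rewrite (fE x) (fE x') /= nx nx'.
have NE : N <= #|E| by rewrite max_card.
have up : s <= c.
  rewrite hs (leq_trans _ (geq_minl c #|E|.+1)) // -card_ord_lt.
  apply/subset_leq_card/subsetP=> j; rewrite !inE => /existsP[x rx].
  have : 0 < #|[set e | r e == (z, j)]|.
    by apply/card_gt0P; exists (f x); rewrite inE.
  rewrite fibr leq_min => /andP[_]; rewrite subn_gt0 => jN.
  by rewrite -(ltn_pmul2r p0); apply: leq_trans jN Nc.
have lo : N %/ p <= s.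
  rewrite hs -[X in X <= _](@minn_idPl _ #|E|.+1 _); last first.
    by rewrite leqW // (leq_trans (leq_div _ _)).
  rewrite -card_ord_lt; apply/subset_leq_card/subsetP=> j; rewrite !inE => jN.
  have [|x rx] := ffull (z, j); last by apply/existsP; exists x; rewrite -rx.
  rewrite fibr; apply/minn_idPl; rewrite -/N.
  have : j.+1 * p <= N by rewrite -leq_divRL.
  rewrite mulSn; lia.
split=> //; have := divn_eq N p; have := ltn_pmod N p0.
move: (N %/ p) (N %% p) lo => t k lo kp Nt.
have p1 : p = p.-1.+1 by rewrite prednK.
(* With [N = t * p + k], at most [t * (p - 1) + k] occurrences remain, where [k <= p - 1]. If
   [c <= t], the bound [N <= c * p] forces [t = c] and [k = 0]. *)
have [tc|tc] := ltnP t c.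
  have : t.+1 * p.-1 <= c * p.-1 by rewrite leq_mul2r tc orbT.
  move: Nt; rewrite [in t * p]p1 mulnS mulSn; lia.
have : c * p <= t * p by rewrite leq_mul2r tc orbT.
have : c <= s by apply: leq_trans lo.
by move: Nc; rewrite [in c * p]p1 mulnS; lia.
Qed.

(** * Closed walks and the splitting of vertices *)

Section Words.
Variable V : eqType.
Implicit Types (w s : seq V) (a b x y z : V).

Definition edge_mult a b x y : nat := ((a, b) == (x, y)) || ((a, b) == (y, x)).

Definition path_mult w x y := \sum_(e <- zip w (behead w)) edge_mult e.1 e.2 x y.

Definition closed_mult w x y := \sum_(e <- zip w (rot 1 w)) edge_mult e.1 e.2 x y.

Lemma edge_multC a b x y : edge_mult b a x y = edge_mult a b x y.
Proof. by rewrite /edge_mult !xpair_eqE orbC !(andbC (b == _)). Qed.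

Lemma edge_mult_sym a b x y : edge_mult a b y x = edge_mult a b x y.
Proof. by rewrite /edge_mult orbC. Qed.

Lemma closed_mult_sym w x y : closed_mult w y x = closed_mult w x y.
Proof. by apply: eq_bigr => e _; apply: edge_mult_sym. Qed.

Lemma path_mult1 a x y : path_mult [:: a] x y = 0.
Proof. by rewrite /path_mult big_nil. Qed.

Lemma path_mult_cons a b w x y :
  path_mult [:: a, b & w] x y = edge_mult a b x y + path_mult (b :: w) x y.
Proof. by rewrite /path_mult /= big_cons. Qed.

Lemma path_mult_cat a w b w' x y : path_mult ((a :: w) ++ b :: w') x y =
  path_mult (a :: w) x y + edge_mult (last a w) b x y + path_mult (b :: w') x y.
Proof.
elim: w a => [|c w IHw] a /=; first by rewrite path_mult_cons path_mult1.
by rewrite !path_mult_cons IHw /= !addnA.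
Qed.

Lemma path_mult_rcons a w b x y :
  path_mult (rcons (a :: w) b) x y = path_mult (a :: w) x y + edge_mult (last a w) b x y.
Proof. by rewrite -cats1 path_mult_cat path_mult1 addn0. Qed.

Lemma path_mult_rev w x y : path_mult (rev w) x y = path_mult w x y.
Proof.
have rcons2 s a b : path_mult (rcons (rcons s a) b) x y =
    path_mult (rcons s a) x y + edge_mult a b x y.
  case: s => [|c s]; first by rewrite /= path_mult_cons !path_mult1 addnC.
  by rewrite [rcons (c :: s) a]/= path_mult_rcons last_rcons.
elim: w => // a [|b w] IHw; first by rewrite /rev /= !path_mult1.
by rewrite path_mult_cons -IHw !rev_cons rcons2 addnC edge_multC.
Qed.

Lemma closed_multE a w x y :
  closed_mult (a :: w) x y = path_mult (a :: w) x y + edge_mult (last a w) a x y.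
Proof.
rewrite /closed_mult rot1_cons.
suff: forall c, \sum_(e <- zip (a :: w) (rcons w c)) edge_mult e.1 e.2 x y =
  path_mult (a :: w) x y + edge_mult (last a w) c x y by apply.
elim: w a => [|b w IHw] a c; first by rewrite /= big_cons big_nil path_mult1 addn0.
by rewrite path_mult_cons /= big_cons -addnA; congr (_ + _); apply: IHw.
Qed.

Lemma closed_mult_rot n w x y : closed_mult (rot n w) x y = closed_mult w x y.
Proof.
have rot1 s : closed_mult (rot 1 s) x y = closed_mult s x y.
  case: s => // a [|b s] //; rewrite rot1_cons -cats1 /= !closed_multE -cat_cons.
  by rewrite path_mult_cat cats1 last_rcons path_mult1 path_mult_cons /=; lia.
elim: n => [|n IHn]; first by rewrite rot0.
have [lt|le] := ltnP n (size w); last by rewrite rot_oversize // ltnW.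
by rewrite -add1n rotD // rot1.
Qed.

Lemma last_rev d w : last d (rev w) = head d w.
Proof. by case: w => // a w; rewrite rev_cons last_rcons. Qed.

Lemma head_rev d w : head d (rev w) = last d w.
Proof. by case/lastP: w => // w a; rewrite rev_rcons last_rcons. Qed.

Lemma closed_mult_rev w x y : closed_mult (rev w) x y = closed_mult w x y.
Proof.
have E d s : s != [::] ->
    closed_mult s x y = path_mult s x y + edge_mult (last d s) (head d s) x y.
  by case: s => // a s _; rewrite closed_multE.
case: w => // a w; rewrite !(E a) //; last by rewrite -size_eq0 size_rev.
by rewrite path_mult_rev last_rev head_rev edge_multC.
Qed.

Lemma path_mult_notin w x y : x \notin w -> path_mult w x y = 0.
Proof.
elim: w => [|a [|b w] IHw] xw; rewrite ?path_mult1 //; first by rewrite /path_mult big_nil.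
rewrite path_mult_cons IHw; last by move: xw; rewrite inE negb_or => /andP[].
move: xw; rewrite !inE !negb_or /edge_mult !xpair_eqE => /and3P[/negPf xa /negPf xb _].
by rewrite ![_ == x]eq_sym xa xb andbF.
Qed.

(** A closed walk through [x], cut at its visits to [x]. *)
Definition loops x (ss : seq (seq V)) := flatten [seq x :: s | s <- ss].

Lemma loops_cons x s ss : loops x (s :: ss) = x :: s ++ loops x ss.
Proof. by []. Qed.

Lemma closed_mult_loops_cat x w ss a b :
  closed_mult (x :: w ++ loops x ss) a b =
  closed_mult (x :: w) a b + \sum_(s <- ss) closed_mult (x :: s) a b.
Proof.
elim: ss w => [|s ss IHs] w; first by rewrite cats0 big_nil addn0.
rewrite loops_cons big_cons; have := IHs (w ++ x :: s).
rewrite -catA /= => ->; rewrite addnA; congr (_ + _).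
by rewrite !closed_multE -cat_cons path_mult_cat last_cat /=; lia.
Qed.

Lemma closed_mult_loops x ss a b :
  closed_mult (loops x ss) a b = \sum_(s <- ss) closed_mult (x :: s) a b.
Proof.
case: ss => [|s ss]; first by rewrite big_nil /closed_mult big_nil.
by rewrite loops_cons closed_mult_loops_cat big_cons.
Qed.

Lemma loops_split x w :
  exists ss, [/\ loops x ss = x :: w & all (fun s => x \notin s) ss].
Proof.
elim: w => [|b w [ss [e xs]]]; first by exists [:: [::]].
have [->|bx] := eqVneq b x; first by exists ([::] :: ss); rewrite loops_cons e.
case: ss e xs => // s ss; rewrite loops_cons => -[e] /andP[xs xss].
exists ((b :: s) :: ss); rewrite loops_cons /= e; split=> //=.
by rewrite inE negb_or eq_sym bx xs.
Qed.

Lemma count_loops x ss : all (fun s => x \notin s) ss ->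
  count_mem x (loops x ss) = size ss.
Proof.
elim: ss => // s ss IHs /= /andP[xs xss].
by rewrite eqxx count_cat IHs // (count_memPn xs).
Qed.

(** As the walk never steps from [x] to [x], no segment between two visits is empty, and each has
    two ends adjacent to [x]. *)
Lemma segments x w : closed_mult w x x = 0 ->
  exists ss, [/\ size ss = count_mem x w, all (fun s => (s != [::]) && (x \notin s)) ss,
    x \in w -> perm_eq (loops x ss) w
    & x \in w -> forall a b, closed_mult (loops x ss) a b = closed_mult w a b].
Proof.
move=> wx; have [xw|xw] := boolP (x \in w); last first.
  by exists [::]; rewrite (count_memPn xw).
have [i w' ew] := rot_to xw; have [ss [e xs]] := loops_split x w'.
have pw : perm_eq (loops x ss) w by rewrite e -ew perm_rot.
have mw a b : closed_mult (loops x ss) a b = closed_mult w a b.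
  by rewrite e -ew closed_mult_rot.
exists ss; split=> //.
  by rewrite -(permP pw) count_loops.
apply/allP=> s sss; rewrite (allP xs) // andbT; apply/eqP=> s0.
have := mw x x; rewrite wx closed_mult_loops (big_rem _ sss) /= s0.
by rewrite closed_multE /edge_mult /= eqxx !addnS.
Qed.

Definition segment_end (d : V) (c : bool) s := if c then last d s else head d s.

Lemma closed_mult_segment x s z : s != [::] -> x \notin s -> z != x ->
  closed_mult (x :: s) x z = (segment_end x false s == z) + (segment_end x true s == z).
Proof.
case: s => // a s _ xs zx; rewrite closed_multE path_mult_cons path_mult_notin //.
rewrite addn0 /= /edge_mult !xpair_eqE eqxx (eq_sym x z) (negPf zx) /= orbF.
by rewrite andbF andbT.
Qed.

(* Splitting [x]: the ends [c1] of [s1] and [c2] of [s2] are moved to [y]. *)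
Lemma split_loops x y ss s1 s2 c1 c2 (ss' := [:: s1, s2 & ss]) :
  s1 != [::] -> s2 != [::] ->
  exists w, perm_eq (x :: w) (y :: loops x ss') /\ forall a b,
    closed_mult w a b + edge_mult x (segment_end x c1 s1) a b
      + edge_mult x (segment_end x c2 s2) a b =
    closed_mult (loops x ss') a b + edge_mult y (segment_end x c1 s1) a b
      + edge_mult y (segment_end x c2 s2) a b.
Proof.
(* The two segments are turned so that the moved ends face each other. The visit to [x] between them
   is renamed [y], and the walk remains a single closed walk. *)
move=> s10 s20; pose t1 := if c1 then s1 else rev s1; pose t2 := if c2 then rev s2 else s2.
have p1 : perm_eq t1 s1 by rewrite /t1; case: (c1); rewrite // perm_rev.
have p2 : perm_eq t2 s2 by rewrite /t2; case: (c2); rewrite // perm_rev.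
have m1 a b : closed_mult (x :: t1) a b = closed_mult (x :: s1) a b.
  rewrite /t1; case: (c1) => //; rewrite -closed_mult_rev rev_cons revK.
  by rewrite -(closed_mult_rot 1 (x :: s1)) rot1_cons.
have m2 a b : closed_mult (x :: t2) a b = closed_mult (x :: s2) a b.
  rewrite /t2; case: (c2) => //; rewrite -closed_mult_rev rev_cons revK.
  by rewrite -(closed_mult_rot 1 (x :: s2)) rot1_cons.
have e1 : segment_end x c1 s1 = last x t1.
  by rewrite /t1 /segment_end; case: (c1); rewrite // last_rev; case: (s1) s10.
have e2 : segment_end x c2 s2 = head x t2.
  by rewrite /t2 /segment_end; case: (c2); rewrite // head_rev.
exists (x :: (t1 ++ y :: t2) ++ loops x ss); split.
  rewrite /ss' !loops_cons -cat_cons; apply/permP=> q /=.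
  rewrite !count_cat /= !count_cat /= (permP p1) (permP p2); lia.
move=> a b; rewrite closed_mult_loops_cat closed_mult_loops !big_cons -m1 -m2 e1 e2.
have : t1 != [::] by rewrite -size_eq0 (perm_size p1) size_eq0.
have : t2 != [::] by rewrite -size_eq0 (perm_size p2) size_eq0.
case: t1 t2 {p1 p2 m1 m2 e1 e2} => // u1 t1 [//|u2 t2] _ _.
rewrite !closed_multE -cat_cons path_mult_cat !path_mult_cons last_cat /=.
rewrite (edge_multC x (last u1 t1)) (edge_multC y (last u1 t1)); lia.
Qed.

End Words.

(** * Amalgamations and the separation of vertices *)

(* Amalgamated words: [g v] copies of the vertex [v] of the blow-up are still
   identified, so that [v] occurs [g v] times in each word through its part. *)
Definition amalgam (K V U : finType) (part : V -> U) (P : K -> pred U) lam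
    (W : K -> seq V) (g : V -> nat) :=
  (forall k v, count_mem v (W k) = P k (part v) * g v) /\
  (forall a b, \sum_k closed_mult (W k) a b <= (part a != part b) * lam * g a * g b).

Lemma closed_mult_notin (V : eqType) (w : seq V) x y :
  x \notin w -> closed_mult w x y = 0.
Proof.
case: w => [|a w] xw; first by rewrite /closed_mult big_nil.
rewrite closed_multE path_mult_notin // /edge_mult !xpair_eqE.
have /negPf -> : a != x by apply: contraNneq xw => ->; rewrite mem_head.
have /negPf -> : last a w != x by apply: contraNneq xw => <-; rewrite mem_last.
by rewrite andbF.
Qed.

Lemma card_pairs (A B : finType) (P : pred (A * B)) :
  #|[set p | P p]| = \sum_a \sum_b P (a, b).
Proof.
rewrite pair_bigA -sum1dep_card big_mkcond; apply: eq_bigr => -[a b] _ /=.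
by case: (P _).
Qed.

(** One unit of weight moves from [x] to [y]: in each word through their part, one of the [g x]
    visits to [x] becomes a visit to [y]. The visits are selected for all words at once by
    [balanced_choice], so that each neighbour of [x] hands over its share of edges. *)
Lemma amalgam_split (K V U : finType) (part : V -> U) (P : K -> pred U) lam W g x y :
  amalgam part P lam W g -> 1 < g x -> g y = 0 -> part x = part y ->
  exists W', amalgam part P lam W'
    (fun v => if v == x then (g x).-1 else if v == y then 1 else g v).
Proof.
move=> [Wc Wm] gx gy xy; pose g' v := if v == x then (g x).-1 else if v == y then 1 else g v.
change (exists W', amalgam part P lam W' g').
have xney : x != y by apply: contraTneq gx => ->; rewrite gy.
have m0 a b : part a = part b -> \sum_k closed_mult (W k) a b = 0.
  by move=> ab; apply/eqP; rewrite -leqn0 (leq_trans (Wm a b)) // ab eqxx.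
have mk0 k a b : part a = part b -> closed_mult (W k) a b = 0.
  by move/m0/eqP; rewrite sum_nat_eq0 => /forallP/(_ k)/eqP.
have my k b : closed_mult (W k) y b = 0.
  have := Wm y b; rewrite gy muln0 mul0n leqn0 sum_nat_eq0.
  by move=> /forallP/(_ k)/eqP.
pose on k := P k (part x).
have seg_ex k : exists ss, [/\ size ss = on k * g x,
     all (fun s => (s != [::]) && (x \notin s)) ss,
     on k -> perm_eq (loops x ss) (W k)
   & on k -> forall a b, closed_mult (loops x ss) a b = closed_mult (W k) a b].
  have [ss [sz all_ss h1 h2]] := segments (mk0 k x x erefl).
  have inW : on k -> x \in W k by rewrite /on -has_pred1 has_count Wc => ->; lia.
  by exists ss; split; rewrite ?sz ?Wc // => /inW.
have [SS SSP] := fin_all_exists seg_ex.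
set p := g x in gx SSP Wc; have p0 : 0 < p by lia.
pose s k (j : 'I_p) := nth [::] (SS k) j.
have sne k j : on k -> (s k j != [::]) /\ (x \notin s k j).
  move=> ok; have [sz /allP all_ss _ _] := SSP k; apply/andP/all_ss.
  by rewrite mem_nth // sz ok mul1n.
(* Segment [j] of word [k] has to choose an index [e]. The indices 0 and 1 are its two ends,
   labelled by the vertex found there; every other index is a dummy label shared by the segments of
   word [k] only. *)
pose nu (kj : K * 'I_p) (e : 'I_p) : V + K * 'I_p :=
  if on kj.1 && (e < 2) then inl (segment_end x (e == 1 :> nat) (s kj.1 kj.2))
  else inr (kj.1, e).
have [f fP] := balanced_choice nu p0.
have sE k : on k -> SS k = [seq s k j | j <- enum 'I_p].
  move=> ok; have [sz _ _ _] := SSP k; rewrite ok mul1n in sz.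
  apply: (@eq_from_nth _ [::]); first by rewrite size_map size_enum_ord.
  move=> i; rewrite sz => ip.
  by rewrite (nth_map (Ordinal ip)) ?size_enum_ord // /s nth_enum_ord.
pose ch k (j : 'I_p) := segment_end x (f (k, j) == 1 :> nat) (s k j).
pose sel k := [set j | on k && (f (k, j) < 2)].
have chs k j c : on k -> segment_end x c (s k j) \in s k j.
  case/(sne k j); rewrite /segment_end; case: (s k j) => // d t _ _.
  by case: c => /=; rewrite ?mem_last ?mem_head.
have chx k j : j \in sel k -> ch k j != x.
  rewrite inE => /andP[ok _]; have [_] := sne k j ok.
  by apply: contraNneq => <-; apply: chs.
have chy k j : j \in sel k -> ch k j != y.
  rewrite inE => /andP[ok _]; have [sz _ /(_ ok) pe _] := SSP k.
  have : y \notin W k by apply/count_memPn; rewrite Wc gy muln0.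
  rewrite -(perm_mem pe); apply: contraNneq => <-.
  apply/flattenP; exists (x :: s k j); last by rewrite inE chs ?orbT.
  by rewrite map_f // (sE k ok) map_f // mem_enum.
have nuf k j z : (nu (k, j) (f (k, j)) == inl z) = (j \in sel k) && (ch k j == z).
  by rewrite /nu inE /=; case: ifP.
pose sz z := #|[set kj | nu kj (f kj) == inl z]|.
have szE z : sz z = \sum_k \sum_(j in sel k) (ch k j == z).
  rewrite /sz card_pairs; apply: eq_bigr => k _; rewrite [RHS]big_mkcond.
  by apply: eq_bigr => j _; rewrite nuf; case: (_ \in _).
have NE z : z != x ->
    #|[set e | nu e.1 e.2 == inl z]| = \sum_k closed_mult (W k) x z.
  move=> zx; rewrite card_pairs.
  rewrite -(pair_bigA _ (fun k j => \sum_e (nu (k, j) e == inl z))) /=.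
  apply: eq_bigr => k _; have [ok|nok] := boolP (on k); last first.
    rewrite closed_mult_notin; last by apply/count_memPn; rewrite Wc -/(on k) (negPf nok).
    by rewrite big1 // => j _; rewrite big1 // => e _; rewrite /nu /= (negPf nok).
  have [_ _ _ /(_ ok) <-] := SSP k.
  rewrite closed_mult_loops sE // big_map big_enum; apply: eq_bigr => j _.
  have [s0 xs] := sne k j ok; rewrite closed_mult_segment //.
  pose o0 : 'I_p := Ordinal p0; pose o1 : 'I_p := Ordinal gx.
  rewrite (bigD1 o0) // (bigD1 o1) //= big1 ?addn0.
    by rewrite /nu ok.
  move=> e /andP[e0 e1]; rewrite /nu ok /=.
  by rewrite ifN // -leqNgt; move: e0 e1; rewrite -!val_eqE /=; lia.
(* Each of the [p - 2] dummies of word [k] is offered by all [p] segments, hence chosen exactly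
   once. Two segments are left; they move one end each, and they are distinct because a segment
   makes a single choice. *)
have sel2 k : on k -> #|sel k| = 2.
  move=> ok.
  have f1 (e : 'I_p) : 1 < e -> #|[set j | f (k, j) == e]| = 1.
    move=> e1; pose q : pred (K * 'I_p * 'I_p) := fun w => nu w.1 w.2 == inr (k, e).
    have nuE k' j e' : (nu (k', j) e' == inr (k, e)) = (k' == k) && (e' == e).
      rewrite /nu /=; case: ifP => [/andP[_ e'2]|]; last by rewrite -xpair_eqE.
      by symmetry; apply/negP=> /andP[_ /eqP ee]; move: e'2; rewrite ee; lia.
    have Np : #|[set w | nu w.1 w.2 == inr (k, e)]| = p.
      rewrite -[RHS]card_ord -(card_codom (f := fun j => ((k, j), e))) => [|i j []] //.
      apply: eq_card => -[[k' j] e']; rewrite inE /= nuE.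
      apply/andP/codomP=> [[/eqP-> /eqP->]|[j' [-> _ ->]]]; first by exists j.
      by rewrite !eqxx.
    have := fP (inr (k, e)) 1; rewrite Np mul1n => /(_ (leqnn p)).
    have -> : #|[set w | nu w (f w) == inr (k, e)]| = #|[set j | f (k, j) == e]|.
      have kinj : injective (pair k : 'I_p -> _) by move=> i j [].
      rewrite -[RHS](card_imset _ kinj); apply: eq_card => -[k' j]; rewrite inE nuE.
      apply/andP/imsetP=> [[/eqP-> fe]|[j' ]]; first by exists j; rewrite ?inE.
      by rewrite inE => fe [-> ->].
    lia.
  have := card_fibers_sum (fun j => f (k, j)) [set: 'I_p].
  rewrite (_ : [set e | _] = setT); last by apply/setP=> j; rewrite !inE.
  rewrite cardsT card_ord (bigID (fun e : 'I_p => e < 2)) /=.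
  rewrite [X in _ + X](eq_bigr (fun=> 1)); last by move=> e; rewrite inE -leqNgt => /f1.
  have -> : \sum_(i in [set: 'I_p] | i < 2) #|[set e | f (k, e) == i]| = #|sel k|.
    rewrite (_ : sel k = [set j | f (k, j) \in [set i : 'I_p | i < 2]]).
      by rewrite card_fibers_sum; apply: eq_bigl => i; rewrite !inE.
    by apply/setP=> j; rewrite !inE ok.
  have -> : \sum_(i in [set: 'I_p] | ~~ (i < 2)) 1 = #|[predC [pred i : 'I_p | i < 2]]|.
    by rewrite -sum1_card; apply: eq_bigl => i; rewrite !inE.
  have := cardC [pred i : 'I_p | i < 2].
  have -> : #|[pred i : 'I_p | i < 2]| = 2.
    by rewrite -[RHS](minn_idPl gx) -card_ord_lt; apply: eq_card => i; rewrite !inE.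
  rewrite card_ord => c2.
  by move=> c1; apply/eqP; rewrite -(eqn_add2r #|[predC [pred i : 'I_p | i < 2]]|) c2 -c1.
(* Summed over all words, [D x] counts the edges removed and [D y] the edges added. *)
pose D u a b := \sum_k \sum_(j in sel k) edge_mult u (ch k j) a b.
have newW k : exists w, (forall v, count_mem v w = P k (part v) * g' v) /\
    forall a b, closed_mult w a b + \sum_(j in sel k) edge_mult x (ch k j) a b =
      closed_mult (W k) a b + \sum_(j in sel k) edge_mult y (ch k j) a b.
  have [ok|nok] := boolP (on k); last first.
    exists (W k); split=> [v|a b].
      rewrite Wc /g'; case: eqP => [->|_]; first by rewrite -/(on k) (negPf nok).
      by case: eqP => [->|//]; rewrite -xy -/(on k) (negPf nok).
    by rewrite !big1 // => j; rewrite inE (negPf nok).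
  have /eqP/cards2P[j1 [j2 [j12 sk]]] := sel2 k ok.
  have [ssz _ /(_ ok) pW /(_ ok) mW] := SSP k.
  pose rest := [seq s k j | j <- enum 'I_p & j \notin sel k].
  have pe : perm_eq (SS k) [:: s k j1, s k j2 & rest].
    rewrite sE // /rest -[X in perm_eq _ X]/(map (s k) (j1 :: j2 :: _)).
    apply/perm_map/uniq_perm; first exact: enum_uniq.
      by rewrite /= !inE !mem_filter sk !inE !eqxx (negPf j12) orbT filter_uniq ?enum_uniq.
    by move=> j; rewrite mem_enum 2!in_cons mem_filter mem_enum sk !inE; do 2!case: (_ == _).
  have [w [wp wm]] := @split_loops _ x y rest (s k j1) (s k j2)
    (f (k, j1) == 1 :> nat) (f (k, j2) == 1 :> nat) (sne k j1 ok).1 (sne k j2 ok).1.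
  have pl : perm_eq (loops x [:: s k j1, s k j2 & rest]) (W k).
    apply: perm_trans pW; rewrite perm_sym; apply: perm_flatten; exact: perm_map.
  exists w; split=> [v|a b].
    have cc q (a : V) l : count q (a :: l) = q a + count q l by [].
    have /permP/(_ (pred1 v)) := wp; rewrite 2!cc (permP pl) Wc /= /g'.
    rewrite (eq_sym v x) (eq_sym v y); case: eqP => [<-|_].
      by rewrite (eq_sym y) (negPf xney) -/(on k) ok; lia.
    by case: eqP => [<-|_]; rewrite ?gy -?xy -/(on k) ?ok; lia.
  have := wm a b; rewrite -mW.
  have -> : closed_mult (loops x [:: s k j1, s k j2 & rest]) a b =
            closed_mult (loops x (SS k)) a b.
    by rewrite !closed_mult_loops (perm_big _ pe).
  by rewrite sk !big_setU1 ?inE // !big_set1 !addnA => ->.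
have [W' W'P] := fin_all_exists newW.
exists W'; split=> [k v|]; first by have [] := W'P k.
have Dsym u a b : D u b a = D u a b.
  by do 2!apply: eq_bigr => ? _; rewrite edge_mult_sym.
have Dx z : D x x z = sz z.
  rewrite szE; do 2!apply: eq_bigr => ? ?; rewrite /edge_mult !xpair_eqE eqxx.
  by rewrite (negPf (chx _ _ _)) // andbF orbF.
have Dy z : D y y z = sz z.
  rewrite szE; do 2!apply: eq_bigr => ? ?; rewrite /edge_mult !xpair_eqE eqxx.
  by rewrite (negPf (chy _ _ _)) // andbF orbF.
have D0 u a b : a != u -> b != u -> D u a b = 0.
  move=> au bu; rewrite /D big1 // => k _; rewrite big1 // => j _.
  by rewrite /edge_mult !xpair_eqE !(eq_sym u) (negPf au) (negPf bu).
have szx : sz x = 0.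
  by rewrite szE big1 // => k _; rewrite big1 // => j /chx/negPf->.
have szy : sz y = 0.
  by rewrite szE big1 // => k _; rewrite big1 // => j /chy/negPf->.
have tot a b : \sum_k closed_mult (W' k) a b + D x a b =
    \sum_k closed_mult (W k) a b + D y a b.
  by rewrite -!big_split; apply: eq_bigr => k _; have [_ h] := W'P k; exact: h.
(* Apart from the degenerate cases, [goalx] and [goaly] are the two halves of [balanced_choice] with
   [c = lam * g z], which is 0 inside a part: at most [c * (p - 1)] edges stay at [x] and at most
   [c] go to [y]. *)
have goalx z : \sum_k closed_mult (W' k) x z <= (part x != part z) * lam * g' x * g' z.
  have := tot x z; rewrite Dx; have [->|zx] := eqVneq z x.
    by rewrite m0 // D0 //; lia.
  have [->|zy] := eqVneq z y.
    by rewrite m0 // Dsym Dy szx szy; lia.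
  rewrite D0 // addn0 -NE // /g' eqxx (negPf zx) (negPf zy) => e.
  have := fP (inl z) ((part x != part z) * lam * g z).
  rewrite NE // => /(_ _)[|_]; first by rewrite mulnAC; apply: Wm.
  by rewrite -/(sz z) -NE // -e (mulnAC _ _ (g z)); lia.
have goaly z : \sum_k closed_mult (W' k) y z <= (part y != part z) * lam * g' y * g' z.
  have := tot y z; rewrite Dy [X in _ = X + _]big1 // add0n.
  have [->|zy] := eqVneq z y; first by rewrite szy; lia.
  have [->|zx] := eqVneq z x; first by rewrite szx; lia.
  have -> : D x y z = 0 by apply: D0; rewrite // eq_sym.
  rewrite addn0 => ->.
  have := fP (inl z) ((part x != part z) * lam * g z).
  rewrite NE // => /(_ _)[|h _]; first by rewrite mulnAC; apply: Wm.
  by rewrite /g' eqxx (eq_sym y) (negPf xney) (negPf zx) (negPf zy) muln1 -xy.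
move=> a b.
have swap c d : \sum_k closed_mult (W' k) c d <= (part c != part d) * lam * g' c * g' d ->
    \sum_k closed_mult (W' k) d c <= (part d != part c) * lam * g' d * g' c.
  rewrite (eq_bigr (fun k => closed_mult (W' k) d c)) => [|k _]; last exact: closed_mult_sym.
  by rewrite (eq_sym (part d)) mulnAC.
have [->//|ax] := eqVneq a x; have [->//|ay] := eqVneq a y.
have [->|bx] := eqVneq b x; first exact/swap.
have [->|yb] := eqVneq b y; first exact/swap.
have := tot a b; rewrite !D0 // !addn0 => ->.
by rewrite /g' (negPf ax) (negPf ay) (negPf bx) (negPf yb).
Qed.

(** By pigeonhole, the part of a vertex of weight 0 contains a vertex of weight at least 2. Each
    splitting lowers the number of vertices of weight 0. *)
Lemma amalgam_separate (K V U : finType) (part : V -> U) (P : K -> pred U) lam W g :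
  amalgam part P lam W g -> (forall u, \sum_(v | part v == u) g v = #|[set v | part v == u]|) ->
  exists W', amalgam part P lam W' (fun=> 1).
Proof.
move: {2}#|[set v | g v == 0]| (leqnn #|[set v | g v == 0]|) => d.
elim: d W g => [|d IHd] W g.
  rewrite leqn0 cards_eq0 => /eqP/setP g0 [Wc Wm] sumg.
  have g1 v : g v = 1.
    have pos w : 1 <= g w by have := g0 w; rewrite !inE; lia.
    have := sumg (part v); rewrite -sum1dep_card (bigD1 v) //= [in RHS](bigD1 v) //= => e.
    have : \sum_(w | (part w == part v) && (w != v)) 1 <=
           \sum_(w | (part w == part v) && (w != v)) g w by apply: leq_sum.
    have := pos v; lia.
  exists W; split=> [k v|a b]; first by rewrite Wc g1.
  by rewrite (leq_trans (Wm a b)) // !g1.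
move=> led am sumg; have [/eqP|/card_gt0P[y]] := posnP #|[set v | g v == 0]|.
  by rewrite -leqn0 => le0; apply: (IHd W g) => //; apply: leq_trans le0 _.
rewrite inE => /eqP gy.
have [x /andP[/eqP xy gx]] : exists x, (part x == part y) && (1 < g x).
  apply/existsP; apply: contraT; rewrite negb_exists => /forallP small.
  have := sumg (part y); rewrite -sum1dep_card (bigD1 y) //= gy [in RHS](bigD1 y) //=.
  have : \sum_(w | (part w == part y) && (w != y)) g w <=
         \sum_(w | (part w == part y) && (w != y)) 1.
    by apply: leq_sum => w /andP[wy _]; have := small w; rewrite wy; lia.
  lia.
have [W' am'] := amalgam_split am gx gy xy.
have xney : x != y by apply: contraTneq gx => ->; rewrite gy.
apply: IHd am' _ => [|u].
  rewrite -ltnS (leq_trans _ led) //; apply: proper_card; apply/properP; split.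
    apply/subsetP=> v; rewrite !inE; have [->|_] := eqVneq v x; first lia.
    by case: (v == y).
  by exists y; rewrite !inE ?gy // (eq_sym y x) (negPf xney) eqxx.
rewrite -sumg; have [xu|xu] := boolP (part x == u).
  have yu : part y == u by rewrite -xy.
  rewrite (bigD1 x) // (bigD1 y) /= ?yu 1?eq_sym // [in RHS](bigD1 x) // [in RHS](bigD1 y) /=.
    rewrite !eqxx (eq_sym y) (negPf xney) gy.
    rewrite (eq_bigr g); first by move: (\sum_(i | _) _) => r; lia.
    by move=> v /andP[/andP[_ /negPf->] /negPf->].
  by rewrite yu eq_sym.
apply: eq_bigr => v /eqP vu; case: eqP => [vx|_]; first by rewrite -vu vx eqxx in xu.
by case: eqP => [vy|//]; rewrite -vu vy xy eqxx in xu.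
Qed.

Lemma closed_mult_map (V V' : eqType) (f : V -> V') w a b : injective f ->
  closed_mult (map f w) (f a) (f b) = closed_mult w a b.
Proof.
move=> finj; rewrite /closed_mult -map_rot; elim: w (rot 1 w) => [|c w IHw] [|d t] //=;
  rewrite ?big_nil // !big_cons IHw /edge_mult !xpair_eqE !(inj_eq finj) //.
Qed.

(** * Packings of 2-factors and their blow-up *)

Definition factor_cycles (V : finType) (T : factor_type) (cs : seq (seq V)) :=
  [&& perm_eq (flatten cs) (enum V), all (fun c => 2 <= size c) cs
    & perm_eq (map size cs) T].

(** Only an upper bound on the edges used; the leftover is recovered from degrees when it is
    needed. *)
Definition packs (V : finType) (G : V -> V -> nat) (Ts : factorization_type) :=
  exists Fs : seq (seq (seq V)), all2 (@factor_cycles V) Ts Fs /\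
    forall u v, \sum_(c <- flatten Fs) closed_mult c u v <= G u v.

Lemma blow_up_words n m lam (Bs : seq (seq 'I_n)) : 0 < m ->
  all (fun c => uniq c) Bs ->
  (forall u v, \sum_(c <- Bs) closed_mult c u v <= (u != v) * (lam * m)) ->
  exists W : 'I_(size Bs) -> seq ('I_n * 'I_m),
    (forall k v, count_mem v (W k) = (v.1 \in nth [::] Bs k)) /\
    (forall a b, \sum_k closed_mult (W k) a b <= (a.1 != b.1) * lam).
Proof.
case: m => // m _ uB sumB; pose z : 'I_m.+1 := ord0.
pose V : finType := ('I_n * 'I_m.+1)%type.
pose emb (u : 'I_n) : V := (u, z).
have emb_inj : injective emb by move=> u v [].
(* The whole weight [m] of a part starts on its copy [z], matching the [m] visits of each cycle that
   passes through it. *)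
pose W (k : 'I_(size Bs)) := flatten (nseq m.+1 (map emb (nth [::] Bs k))).
pose g (v : V) := (v.2 == z) * m.+1.
have uBk (k : 'I_(size Bs)) : uniq (nth [::] Bs k) by apply: (allP uB); rewrite mem_nth.
have Wmult k a b : closed_mult (W k) a b = m.+1 * closed_mult (map emb (nth [::] Bs k)) a b.
  rewrite /W; case: (nth _ _ _) => [|c w].
    rewrite (_ : flatten _ = [::]) ?/closed_mult ?big_nil ?muln0 //.
    by elim: m.+1 => //= j ->.
  have -> : flatten (nseq m.+1 (map emb (c :: w))) = loops (emb c) (nseq m.+1 (map emb w)).
    by rewrite /loops map_nseq.
  by rewrite closed_mult_loops big_nseq iter_addn_0 mulnC.
have am : amalgam (@fst _ _) (fun (k : 'I_(size Bs)) (u : 'I_n) => u \in nth [::] Bs k) lam W g.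
  split=> [k v|a b].
    rewrite /W count_flatten map_nseq sumn_nseq mulnA mulnb; congr (_ * _).
    rewrite count_uniq_mem ?map_inj_uniq //; case: v => u j /=; congr nat_of_bool.
    apply/mapP/andP=> [[u' uB' [-> ->]]|[uB' /eqP->]]; first by rewrite eqxx.
    by exists u.
  rewrite (eq_bigr _ (fun k _ => Wmult k a b)) -big_distrr /= /g.
  case: a b => a i [b j] /=.
  have [->|iz] := eqVneq i z; last first.
    rewrite big1 ?muln0 // => k _; apply: closed_mult_notin.
    by apply/mapP=> -[u _ [_ e]]; rewrite e eqxx in iz.
  have [->|jz] := eqVneq j z; last first.
    rewrite big1 ?muln0 // => k _; rewrite -closed_mult_sym; apply: closed_mult_notin.
    by apply/mapP=> -[u _ [_ e]]; rewrite e eqxx in jz.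
  rewrite !mul1n mulnC leq_mul2r; apply/orP; right.
  rewrite (eq_bigr (fun k : 'I__ => closed_mult (nth [::] Bs k) a b)); last first.
    by move=> k _; apply: closed_mult_map.
  by have := sumB a b; rewrite (big_nth [::]) big_mkord mulnA.
have [|W' [W'c W'm]] := amalgam_separate am.
  move=> u; rewrite -sum1dep_card.
  rewrite (eq_bigl (fun v : V => (v.1 == u) && true)); last by move=> v; rewrite andbT.
  rewrite -(pair_big (fun i => i == u) predT (fun i j => g (i, j))) /= big_pred1_eq.
  rewrite [RHS](eq_bigl (fun v : V => (v.1 == u) && true)); last by move=> v; rewrite andbT.
  rewrite -(pair_big (fun i => i == u) predT (fun i j => 1)) /= big_pred1_eq.
  rewrite sum1_card card_ord (bigD1 z) //= big1 => [|j jz].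
    by rewrite /g eqxx mul1n addn0.
  by rewrite /g /= (negPf jz).
exists W'; split=> [k v|a b]; first by rewrite W'c muln1.
by rewrite (leq_trans (W'm a b)) // !muln1.
Qed.

Section BlowUp.
Variables n m : nat.

Definition blow (c : seq 'I_n) (w : seq ('I_n * 'I_m)) :=
  [forall v, count_mem v w == (v.1 \in c)].

Lemma size_sum_count (V : finType) (w : seq V) : size w = \sum_v count_mem v w.
Proof.
elim: w => [|a w IHw]; first by rewrite big1.
rewrite /= IHw big_split /= -add1n; congr (_ + _).
rewrite (bigD1 a) //= eqxx big1 ?addn0 // => v.
by rewrite eq_sym => /negPf->.
Qed.

Lemma size_blow c w : uniq c -> blow c w -> size w = m * size c.
Proof.
move=> uc /forallP bw; rewrite size_sum_count.
rewrite (eq_bigr (fun v => (v.1 \in c) : nat)) => [|v _]; last exact/eqP/bw.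
rewrite -(pair_bigA _ (fun u (_ : 'I_m) => (u \in c) : nat)) /= exchange_big /=.
rewrite sum_nat_const card_ord; congr (_ * _); rewrite -(card_uniqP uc) -sum1_card.
by rewrite [RHS]big_mkcond; apply: eq_bigr => u _; case: (_ \in _).
Qed.

Lemma blow_factor T cs ws : 0 < m -> factor_cycles T cs -> all2 blow cs ws ->
  factor_cycles (scale_type m T) ws.
Proof.
move=> m0 /and3P[pcs s2 pT] bl.
have ucs : uniq (flatten cs) by rewrite (perm_uniq pcs) enum_uniq.
have szw : map size ws = [seq m * size c | c <- cs].
  elim: cs ws ucs bl {pcs s2 pT} => [|c cs IHcs] [|w ws] //=.
  rewrite cat_uniq => /and3P[uc _ ucs] /andP[bw bl].
  by rewrite (size_blow uc bw) IHcs.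
apply/and3P; split.
- have cnt v : count_mem v (flatten ws) = count_mem v.1 (flatten cs).
    elim: cs ws ucs bl {pcs s2 pT szw} => [|c cs IHcs] [|w ws] //=.
    rewrite cat_uniq => /and3P[uc _ ucs] /andP[/forallP/(_ v)/eqP bw bl].
    by rewrite !count_cat (IHcs ws) // bw (count_uniq_mem _ uc).
  apply/allP => v _ /=; apply/eqP; rewrite cnt (permP pcs).
  by rewrite !count_uniq_mem ?enum_uniq // !mem_enum.
- rewrite -(all_map size (leq 2)) szw; apply/allP=> _ /mapP[c cin ->].
  by rewrite (leq_trans ((allP s2) c cin)) // leq_pmull.
- by rewrite szw /scale_type (map_comp (muln m)) perm_map.
Qed.

Lemma blow_factors Ts Fs ws : 0 < m -> all2 (@factor_cycles 'I_n) Ts Fs ->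
  all2 blow (flatten Fs) ws -> exists Fs',
    flatten Fs' = ws /\ all2 (@factor_cycles _) [seq scale_type m T | T <- Ts] Fs'.
Proof.
move=> m0; elim: Ts Fs ws => [|T Ts IHT] [|cs Fs] ws //=.
  by case: ws => // _ _; exists [::].
move=> /andP[fc fcs] bl.
have [w1 [w2 [-> bl1 bl2]]] : exists w1 w2,
    [/\ ws = w1 ++ w2, all2 blow cs w1 & all2 blow (flatten Fs) w2].
  elim: cs ws bl {fc} => [|c cs IHcs] ws /= bl; first by exists [::], ws.
  case: ws bl => // w ws /andP[bw /IHcs[w1 [w2 [-> b1 b2]]]].
  by exists (w :: w1), w2; split=> //=; rewrite bw.
have [Fs' [<- fcs']] := IHT Fs w2 fcs bl2.
by exists (w1 :: Fs'); rewrite /= fcs' (blow_factor m0 fc bl1).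
Qed.

Lemma blow_up lam Ts : 0 < m ->
  packs (fun u v : 'I_n => (u != v) * (lam * m)) Ts ->
  packs (fun u v : 'I_n * 'I_m => (u.1 != v.1) * lam) [seq scale_type m T | T <- Ts].
Proof.
move=> m0 [Fs [fcs Fm]].
have uB : all (fun c => uniq c) (flatten Fs).
  elim: Ts Fs fcs {Fm} => [|T Ts IHT] [|cs Fs] //= /andP[/and3P[pcs _ _] fcs].
  rewrite all_cat IHT // andbT.
  have : uniq (flatten cs) by rewrite (perm_uniq pcs) enum_uniq.
  by elim: (cs) => //= c cs' IH; rewrite cat_uniq => /and3P[-> _ /IH].
have [W [Wc Wm]] := blow_up_words m0 uB Fm.
have [|Fs' [eW fcs']] := @blow_factors Ts Fs (codom W) m0 fcs.
  rewrite codomE; move: (flatten Fs) W Wc {Fm Wm uB} => Bs W Wc.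
  rewrite all2E size_map size_enum_ord eqxx /=; apply/(all_nthP ([::], [::])) => i.
  rewrite size_zip size_map size_enum_ord minnn => iB.
  rewrite nth_zip /=; last by rewrite size_map size_enum_ord.
  rewrite (nth_map (Ordinal iB)) ?size_enum_ord //.
  by apply/forallP=> v; rewrite Wc nth_enum_ord.
exists Fs'; split=> // u v; rewrite eW codomE big_map big_enum /=; exact: Wm.
Qed.

End BlowUp.

(** * Degrees, and 2-factorizations from packings *)

Lemma cycle_multE (V : finType) (c : seq V) u v : cycle_mult c u v = closed_mult c u v.
Proof.
rewrite /cycle_mult -sum1_count big_mkcond; apply: eq_bigr => -[a b] _ /=.
by rewrite /edge_mult; case: (_ || _).
Qed.

Lemma degree_closed (V : finType) (c : seq V) v : uniq c -> 2 <= size c ->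
  \sum_u closed_mult c v u = 2 * (v \in c).
Proof.
have deg_edge (a b : V) : a != b -> \sum_u edge_mult a b v u = (a == v) + (b == v).
  move=> ab; rewrite /edge_mult.
  rewrite (eq_bigr (fun u => (if u == b then (a == v) : nat else 0) +
                            (if u == a then (b == v) : nat else 0))); last first.
    move=> u _; rewrite !xpair_eqE (eq_sym a u) (eq_sym b u).
    have [->|_] := eqVneq u b; first by rewrite (eq_sym b a) (negPf ab); do 2!case: (_ == v).
    by do 3!case: (_ == _).
  by rewrite big_split /= -!big_mkcond !big_pred1_eq.
have deg_path (a : V) w : uniq (a :: w) ->
    \sum_u path_mult (a :: w) v u + (a == v) + (last a w == v) = 2 * (v \in a :: w).
  move=> uw; rewrite -(count_uniq_mem v uw).
  elim: w a uw => [|b w IHw] a; first by rewrite big1 /=; [lia|move=> u _; rewrite path_mult1].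
  rewrite cons_uniq => /andP[nab /IHw IH].
  rewrite (eq_bigr _ (fun u _ => path_mult_cons a b w v u)) big_split /= deg_edge.
    move: IH => /=; lia.
  by apply: contraNneq nab => ->; rewrite mem_head.
case: c => [//|a [//|b w]] uc _.
rewrite (eq_bigr _ (fun u _ => closed_multE a (b :: w) v u)) big_split /= deg_edge.
  by rewrite -deg_path //=; lia.
by apply: contraTneq uc => /= <-; rewrite mem_last.
Qed.

Lemma degree_factor (V : finType) T (cs : seq (seq V)) v : factor_cycles T cs ->
  \sum_u \sum_(c <- cs) closed_mult c v u = 2.
Proof.
case/and3P=> pcs s2 _; rewrite exchange_big /=.
have ucs : uniq (flatten cs) by rewrite (perm_uniq pcs) enum_uniq.
have : \sum_(c <- cs) (v \in c) = 1.
  transitivity (count_mem v (flatten cs)).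
    elim: cs ucs {pcs s2} => [|c cs IHcs] /=; first by rewrite big_nil.
    rewrite cat_uniq => /and3P[uc _ /IHcs IH].
    by rewrite big_cons IH count_cat (count_uniq_mem _ uc).
  by rewrite (permP pcs) count_uniq_mem ?enum_uniq // mem_enum.
move=> e1; transitivity (2 * \sum_(c <- cs) (v \in c)); last by rewrite e1.
rewrite big_distrr /= {e1}.
elim: cs ucs s2 {pcs} => [|c cs IHcs] /=; first by rewrite !big_nil.
rewrite cat_uniq => /and3P[uc _ ucs] /andP[c2 cs2].
by rewrite !big_cons IHcs // degree_closed.
Qed.

Lemma degree_factors (V : finType) Ts (Fs : seq (seq (seq V))) v :
  all2 (@factor_cycles V) Ts Fs ->
  \sum_u \sum_(c <- flatten Fs) closed_mult c v u = 2 * size Ts.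
Proof.
elim: Ts Fs => [|T Ts IHT] [|cs Fs] //=; first by rewrite big1 // => u; rewrite big_nil.
case/andP=> fc fcs; under eq_bigr do rewrite big_cat.
by rewrite big_split /= (degree_factor _ fc) IHT // mulnS.
Qed.

(** The leftover graph has degree [r - 2 * r./2], that is [odd r], at every vertex. *)
Lemma packs_two_factorization (V : finType) (G : mgraph V) r Ts :
  regular G r -> size Ts = r./2 -> packs G Ts -> has_two_factorization G Ts.
Proof.
move=> regG sz [Fs [fcs Fm]]; exists r; split=> //.
have szF : size Fs = size Ts by move: fcs; rewrite all2E => /andP[/eqP].
pose f i u v := \sum_(c <- nth [::] Fs i) closed_mult c u v.
have fsum u v : \sum_(c <- flatten Fs) closed_mult c u v = \sum_(i < size Ts) f i u v.
  by rewrite big_flatten (big_nth [::]) big_mkord szF.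
have fle (i : 'I_(size Ts)) u v : f i u v <= G u v.
  by apply: leq_trans (Fm u v); rewrite fsum (bigD1 i) //= leq_addr.
have fC i : commutative (f i) by move=> u v; apply: eq_bigr => c _; apply: closed_mult_sym.
have f0 (i : 'I_(size Ts)) v : f i v v = 0.
  by apply/eqP; rewrite -leqn0 -[X in _ <= X](mult_loopless G v) fle.
pose I u v := G u v - \sum_(i < size Ts) f i u v.
have IC : commutative I.
  move=> u v; rewrite /I mult_sym; congr (_ - _); apply: eq_bigr => i _; exact: fC.
have I0 v : I v v = 0 by rewrite /I mult_loopless.
exists (fun i : 'I_(size Ts) => MGraph (fC i) (f0 i)), (MGraph IC I0); split=> [i|v|u v] /=.
- have /and3P[p1 p2 p3] : factor_cycles (nth [::] Ts i) (nth [::] Fs i).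
    move: fcs; rewrite all2E => /andP[_] /(all_nthP ([::], [::]))/(_ i).
    by rewrite size_zip szF minnn nth_zip //= => /(_ (ltn_ord i)).
  exists (nth [::] Fs i); split=> // u v; apply: eq_bigr => c _.
  by rewrite cycle_multE.
- have : \sum_u (I v u + \sum_(i < size Ts) f i v u) = r.
    by rewrite -(regG v); apply: eq_bigr => u _; rewrite subnK // -fsum.
  have := degree_factors v fcs; rewrite (eq_bigr _ (fun u _ => fsum v u)) big_split /=.
  by move=> ->; rewrite sz; have := odd_double_half r; lia.
- by rewrite addnC subnK // -fsum.
Qed.

(** * Extending open paths by tiles *)

(* A tile extends every factor by one layer: it joins fresh vertices [Fresh v]
   and the open paths [Strand k r] built so far ([r]: traversed backwards) into
   closed cycles and new open paths. *)
Variant item := Fresh of nat | Strand of nat & bool.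

Definition word := seq item.
Definition ftile := (seq word * seq word)%type.
Definition tile := seq ftile.

(* The ends of an open path, as positions in the last layer, and its number of
   vertices. *)
Definition strand := (nat * nat * nat)%type.
Definition layout := seq (seq strand).

(** [true] stands for the new layer, [false] for the last one. *)
Definition node := (bool * nat)%type.

Section Abstract.
Variable f : seq strand.

Definition item_end (c : bool) (i : item) : node :=
  match i with
  | Fresh v => (true, v)
  | Strand k r => let s := nth (0, 0, 0) f k in
      (false, if c (+) r then s.1.2 else s.1.1)
  end.

Definition item_len (i : item) : nat :=
  match i with Fresh _ => 1 | Strand k _ => (nth (0, 0, 0) f k).2 end.

Definition word_len (w : word) : nat := sumn (map item_len w).

Definition path_nodes (w : word) : seq (node * node) :=
  zip (map (item_end true) w) (behead (map (item_end false) w)).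

Definition cycle_nodes (w : word) : seq (node * node) :=
  zip (map (item_end true) w) (rot 1 (map (item_end false) w)).

Definition word_strand (w : word) : strand :=
  ((item_end false (head (Fresh 0) w)).2, (item_end true (last (Fresh 0) w)).2, word_len w).

Definition ftile_edges (t : ftile) : seq (node * node) :=
  flatten (map cycle_nodes t.1) ++ flatten (map path_nodes t.2).

Definition items (t : ftile) : seq item := flatten (t.1 ++ t.2).

Definition is_fresh i := if i is Fresh _ then true else false.

Definition fresh_of (s : seq item) : seq nat :=
  pmap (fun i => if i is Fresh v then Some v else None) s.

Definition strands_of (s : seq item) : seq nat :=
  pmap (fun i => if i is Strand k _ then Some k else None) s.

(** Every old path and every fresh vertex is consumed once. Open words begin and end at fresh
    vertices, so that the next tile finds all ends in its old layer. *)
Definition ftile_ok (news : seq nat) (t : ftile) : bool :=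
  [&& all (fun w => ~~ nilp w) t.1,
      all (fun w => if w is i :: w' then is_fresh i && is_fresh (last i w') else false) t.2,
      perm_eq (strands_of (items t)) (iota 0 (size f))
    & perm_eq (fresh_of (items t)) news].

End Abstract.

Section Concrete.
Variables (V : eqType) (old new : nat -> V).

Definition node_pt (e : node) : V := if e.1 then new e.2 else old e.2.

Definition strand_ok (pos : nat -> V) (s : strand) (w : seq V) : bool :=
  match w with
  | [::] => false
  | a :: w' => [&& a == pos s.1.1, last a w' == pos s.1.2 & size w == s.2]
  end.

Definition item_word (op : seq (seq V)) (i : item) : seq V :=
  match i with
  | Fresh v => [:: new v]
  | Strand k r => let w := nth [::] op k in if r then rev w else w
  end.

Definition word_pts op (w : word) : seq V := flatten (map (item_word op) w).

Variables (f : seq strand) (op : seq (seq V)).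
Hypothesis match_op : all2 (strand_ok old) f op.

Lemma strand_ok_nth k : k < size f ->
  exists a w, [/\ nth [::] op k = a :: w, a = old (nth (0, 0, 0) f k).1.1,
    last a w = old (nth (0, 0, 0) f k).1.2 & size (a :: w) = (nth (0, 0, 0) f k).2].
Proof.
move=> kf; move: match_op; rewrite all2E => /andP[/eqP sz] /(all_nthP ((0, 0, 0), [::]))/(_ k).
rewrite size_zip -sz minnn nth_zip //= => /(_ kf).
case: (nth [::] op k) => // a w /and3P[/eqP h1 /eqP h2 /eqP h3].
by exists a, w; rewrite -h1 -h2 -h3.
Qed.

Definition item_in (i : item) := if i is Strand k _ then k < size f else true.

Lemma item_word_ends i : item_in i -> exists a w,
  [/\ item_word op i = a :: w, a = node_pt (item_end f false i),
      last a w = node_pt (item_end f true i) & size (a :: w) = item_len f i].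
Proof.
case: i => [v _|k r /= /strand_ok_nth[a [w [-> ha hl hs]]]]; first by exists (new v), [::].
case: r => /=; last by exists a, w.
case/lastP: w hl hs => [|w b] hl hs; first by exists a, [::].
exists b, (rev (a :: w)); rewrite -rcons_cons rev_rcons; split=> //.
- by rewrite /node_pt /= -hl last_rcons.
- by rewrite last_rev.
- by rewrite -hs /= size_rev size_rcons.
Qed.

Lemma word_pts_ends i w : all item_in (i :: w) -> exists a s,
  [/\ word_pts op (i :: w) = a :: s, a = node_pt (item_end f false i),
      last a s = node_pt (item_end f true (last i w)),
      size (a :: s) = word_len f (i :: w)
    & forall x y, path_mult (a :: s) x y =
        \sum_(j <- i :: w) path_mult (item_word op j) x y +
        \sum_(e <- path_nodes f (i :: w)) edge_mult (node_pt e.1) (node_pt e.2) x y].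
Proof.
elim: w i => [|j w IHw] i /= /andP[iin].
  move=> _; have [a [s [e h1 h2 h3]]] := item_word_ends iin.
  exists a, s; rewrite /word_pts /= e cats0; split=> //; first by rewrite /word_len /= addn0.
  by move=> x y; rewrite big_seq1 /path_nodes /= big_nil addn0 e.
move=> /IHw[b [t [e' h1' h2' h3' h4']]].
have [a [s [e h1 h2 h3]]] := item_word_ends iin.
exists a, (s ++ b :: t); split=> //.
- by rewrite -[word_pts op _]/(item_word op i ++ word_pts op (j :: w)) e' e.
- by rewrite last_cat.
- by rewrite -[LHS]/(size ((a :: s) ++ b :: t)) size_cat h3' h3.
move=> x y; rewrite -cat_cons path_mult_cat h4' big_cons -e.
rewrite -[path_nodes f [:: i, j & w]]/((item_end f true i, item_end f false j) :: path_nodes f (j :: w)).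
by rewrite !big_cons h2 h1' /=; lia.
Qed.

Lemma word_pts_closed w x y : ~~ nilp w -> all item_in w ->
  closed_mult (word_pts op w) x y = \sum_(j <- w) path_mult (item_word op j) x y +
    \sum_(e <- cycle_nodes f w) edge_mult (node_pt e.1) (node_pt e.2) x y.
Proof.
case: w => // i w _ /word_pts_ends[a [s [-> ha hl _ hm]]].
rewrite closed_multE hm -addnA; congr (_ + _); rewrite hl ha /cycle_nodes map_cons rot1_cons.
suff H c : \sum_(e <- path_nodes f (i :: w)) edge_mult (node_pt e.1) (node_pt e.2) x y +
  edge_mult (node_pt (item_end f true (last i w))) (node_pt c) x y =
  \sum_(e <- zip (map (item_end f true) (i :: w)) (rcons (map (item_end f false) w) c))
     edge_mult (node_pt e.1) (node_pt e.2) x y by apply: H.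
rewrite /path_nodes /=; elim: w i {ha hl hm} => [|j w IHw] i /=.
  by rewrite big_nil big_seq1.
by rewrite !big_cons -addnA IHw.
Qed.

Variable t : ftile.
Variable news : seq nat.
Hypothesis t_ok : ftile_ok f news t.

Lemma items_in : all item_in (items t).
Proof.
have /and4P[_ _ /perm_mem ps _] := t_ok.
have : all (fun k => k < size f) (strands_of (items t)).
  by apply/allP=> k; rewrite ps mem_iota.
by elim: (items t) => //= -[v|k r] s IHs //= /andP[-> /IHs].
Qed.

Lemma big_items (F : item -> nat) :
  (forall k r, F (Strand k r) = F (Strand k false)) ->
  \sum_(i <- items t) F i =
    \sum_(k < size f) F (Strand k false) + \sum_(v <- news) F (Fresh v).
Proof.
move=> Fr; have /and4P[_ _ ps pn] := t_ok.
rewrite -(perm_big _ pn) /= -[X in X + _](big_mkord predT (fun k => F (Strand k false))).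
rewrite /index_iota subn0 -(perm_big _ ps) /=.
elim: (items t) => [|[v|k r] s IHs]; first by rewrite !big_nil.
  by rewrite /= !big_cons IHs; lia.
by rewrite /= !big_cons IHs Fr; lia.
Qed.

Definition closed_words := map (word_pts op) t.1.
Definition open_words := map (word_pts op) t.2.

Lemma step_open : all2 (strand_ok new) (map (word_strand f) t.2) open_words.
Proof.
have /and4P[_ a2 _ _] := t_ok; have := items_in; rewrite /items flatten_cat all_cat.
case/andP=> _; rewrite /open_words; elim: (t.2) a2 => //= w ws IHws /andP[fw a2].
rewrite all_cat => /andP[wi wsi]; rewrite IHws // andbT.
case: w fw wi => // i w /andP[fi fl] /word_pts_ends[a [s [-> ha hl hs _]]].
have fr c j : is_fresh j -> node_pt (item_end f c j) = new (item_end f c j).2 by case: j.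
by rewrite /= hl ha !fr // /word_strand -hs /= !eqxx.
Qed.

Lemma step_sizes : map size closed_words = map (word_len f) t.1.
Proof.
have /and4P[a1 _ _ _] := t_ok; have := items_in; rewrite /items flatten_cat all_cat.
case/andP=> + _; rewrite /closed_words; elim: (t.1) a1 => //= w ws IHws /andP[fw a1].
rewrite all_cat => /andP[wi wsi]; rewrite IHws //.
by case: w fw wi => // i w _ /word_pts_ends[a [s [-> _ _ <- _]]].
Qed.

Lemma all2_size2 : size op = size f.
Proof. by move: match_op; rewrite all2E => /andP[/eqP]. Qed.

Lemma step_cover :
  perm_eq (flatten closed_words ++ flatten open_words) (flatten op ++ map new news).
Proof.
apply/permP=> q; rewrite !count_cat.
have -> : count q (flatten closed_words) + count q (flatten open_words) =
    \sum_(i <- items t) count q (item_word op i).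
  rewrite -count_cat -flatten_cat -map_cat /items.
  elim: (t.1 ++ t.2) => [|w ws IHws]; first by rewrite big_nil.
  rewrite /= count_cat IHws big_cat /=; congr (_ + _).
  by elim: w => [|i w IHw]; rewrite ?big_nil // big_cons -IHw /word_pts /= count_cat.
rewrite big_items => [|k [] //=]; last exact: count_rev.
congr (_ + _); last by elim: news => [|v s IHs]; rewrite ?big_nil // big_cons IHs /= addn0.
rewrite -all2_size2 -(big_mkord predT (fun k => count q (nth [::] op k))).
rewrite -(big_nth [::] predT (fun w => count q w)).
by elim: (op) => [|w ws IHws]; rewrite ?big_nil // big_cons IHws /= count_cat.
Qed.

Lemma step_mult x y :
  \sum_(c <- closed_words) closed_mult c x y + \sum_(w <- open_words) path_mult w x y =
  \sum_(w <- op) path_mult w x y +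
  \sum_(e <- ftile_edges f t) edge_mult (node_pt e.1) (node_pt e.2) x y.
Proof.
have /and4P[a1 a2 _ _] := t_ok.
have -> : \sum_(w <- op) path_mult w x y =
    \sum_(i <- items t) path_mult (item_word op i) x y.
  rewrite big_items => [|k [] //=]; last exact: path_mult_rev.
  rewrite [X in _ = _ + X]big1 ?addn0; last by move=> v _; rewrite /= path_mult1.
  rewrite -all2_size2 -(big_mkord predT (fun k => path_mult (nth [::] op k) x y)).
  by rewrite -(big_nth [::] predT (fun w => path_mult w x y)).
have := items_in; rewrite /items flatten_cat all_cat big_cat /ftile_edges big_cat /= => /andP[i1 i2].
rewrite addnACA; congr (_ + _).
  rewrite /closed_words; elim: (t.1) a1 i1 => [|w ws IHws] /=; first by rewrite !big_nil.
  case/andP=> nw a1; rewrite all_cat => /andP[iw i1].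
  by rewrite big_cons IHws // word_pts_closed // !big_cat /=; lia.
rewrite /open_words; elim: (t.2) a2 i2 => [|w ws IHws] /=; first by rewrite !big_nil.
case/andP=> fw a2; rewrite all_cat => /andP[iw i2].
rewrite big_cons IHws // !big_cat /=.
by case: w fw iw => // i w _ /word_pts_ends[a [s [-> _ _ _ ->]]]; lia.
Qed.

End Concrete.

(** * Runs of tiles through consecutive layers *)

Definition swap_nodes (e : node * node) := (e.2, e.1).

Definition tile_edges (L : layout) (t : tile) :=
  flatten [seq ftile_edges p.1 p.2 | p <- zip L t].

Definition tile_dst (L : layout) (t : tile) : layout :=
  [seq map (word_strand p.1) p.2.2 | p <- zip L t].

Definition tile_closed (L : layout) (t : tile) : seq (seq nat) :=
  [seq map (word_len p.1) p.2.1 | p <- zip L t].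

(** The check depends on the positions of the ends and not on the lengths of the paths, so it is
    decided by computation even for symbolic lengths. The last condition excludes an edge used
    twice, in either direction or by two factors. *)
Definition tile_ok (allowed : rel node) (news : seq (seq nat)) (L : layout) (t : tile) :=
  [&& size t == size L, size news == size L,
      all (fun p => ftile_ok p.1.1 p.1.2 p.2) (zip (zip L news) t),
      all (fun e => allowed e.1 e.2) (tile_edges L t)
    & uniq (tile_edges L t ++ map swap_nodes (tile_edges L t))].

Section State.
Variable V : eqType.

(* Closed cycles and open paths of each factor. *)
Definition state := seq (seq (seq V) * seq (seq V)).

Definition matches (pos : nat -> V) (L : layout) (st : state) :=
  all2 (fun f s => all2 (strand_ok pos) f s.2) L st.

Definition state_mult (st : state) x y :=
  \sum_(s <- st) (\sum_(c <- s.1) closed_mult c x y + \sum_(w <- s.2) path_mult w x y).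

Definition apply_tile (new : nat -> V) (st : state) (t : tile) : state :=
  [seq (map (word_pts new p.1.2) p.2.1 ++ p.1.1, map (word_pts new p.1.2) p.2.2)
     | p <- zip st t].

Definition tracks (lens : seq (seq nat)) (cov : seq (seq V)) (st : state) :=
  all2 (fun l s => perm_eq (map size s.1) l) lens st &&
  all2 (fun c s => perm_eq (flatten s.1 ++ flatten s.2) c) cov st.

Definition catl T (C D : seq (seq T)) := [seq p.1 ++ p.2 | p <- zip C D].

Lemma apply_tileP old new L st t news lens cov :
  size t = size L -> size news = size L ->
  all (fun p => ftile_ok p.1.1 p.1.2 p.2) (zip (zip L news) t) ->
  matches old L st -> tracks lens cov st ->
  [/\ matches new (tile_dst L t) (apply_tile new st t),
      tracks (catl (tile_closed L t) lens) (catl cov (map (map new) news)) (apply_tile new st t)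
    & forall x y, state_mult (apply_tile new st t) x y = state_mult st x y +
        \sum_(e <- tile_edges L t) edge_mult (node_pt old new e.1) (node_pt old new e.2) x y].
Proof.
rewrite /matches /tracks.
elim: L st t news lens cov => [|f L IHL] [|s st] [|ft t] [|ns news] [|l lens] [|c cov] //=;
  rewrite ?andbF //.
  by move=> _ _ _ _ _; split=> // x y; rewrite /state_mult /tile_edges /= !big_nil.
move=> [szt] [szn] /andP[fok tok] /andP[mf ms] /andP[/andP[pl tl] /andP[pc tc]].
have [|m1 /andP[t1 t2] mm] := IHL st t news lens cov szt szn tok ms; first by rewrite tl.
split=> [||x y].
- by rewrite /= m1 (step_open new mf fok).
- rewrite /= t1 t2 !andbT map_cat -/(closed_words new s.2 ft).
  rewrite (step_sizes new mf fok) perm_cat2l pl /= flatten_cat.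
  have pf : perm_eq (flatten (closed_words new s.2 ft) ++ flatten (open_words new s.2 ft))
      (flatten s.2 ++ map new ns) := step_cover new mf fok.
  apply/permP=> q; move/permP/(_ q): pf; move/permP/(_ q): pc.
  by rewrite !count_cat /open_words => h1 h2; clear -h1 h2; lia.
- rewrite -[tile_edges _ _]/(ftile_edges f ft ++ tile_edges L t) big_cat.
  rewrite -[X in state_mult X]/((closed_words new s.2 ft ++ s.1, open_words new s.2 ft)
    :: apply_tile new st t) /state_mult !big_cons big_cat.
  have h1 := step_mult new mf fok x y; have h2 := mm x y.
  by rewrite /state_mult /= in h1 h2 *; clear -h1 h2; lia.
Qed.

Lemma edge_multP (a b x y : V) :
  reflect ((a = x /\ b = y) \/ (a = y /\ b = x)) (0 < edge_mult a b x y).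
Proof.
rewrite /edge_mult lt0b !xpair_eqE; apply: (iffP orP).
  by case=> /andP[/eqP-> /eqP->]; [left|right].
by case=> -[-> ->]; rewrite !eqxx; [left|right].
Qed.

(** [Q] is an invariant of the edges drawn before. The new edges violate it, and two abstract edges
    have the same image only if they are equal or reversed; so no edge is drawn twice. *)
Lemma add_edges (pt : node -> V) (allowed : rel node) (Q : V -> V -> Prop)
    (M : V -> V -> nat) (E : seq (node * node)) :
  (forall x y, M x y <= 1) -> (forall x y, 0 < M x y -> Q x y) ->
  (forall x y, Q x y -> Q y x) ->
  all (fun e => allowed e.1 e.2) E -> uniq (E ++ map swap_nodes E) ->
  (forall a b a' b', allowed a b -> allowed a' b' -> pt a = pt a' -> pt b = pt b' ->
     (a, b) = (a', b')) ->
  (forall a b a' b', allowed a b -> allowed a' b' -> pt a = pt b' -> pt b = pt a' ->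
     (a, b) = (b', a')) ->
  (forall a b, allowed a b -> ~ Q (pt a) (pt b)) ->
  forall x y, M x y + \sum_(e <- E) edge_mult (pt e.1) (pt e.2) x y <= 1 /\
    (0 < M x y + \sum_(e <- E) edge_mult (pt e.1) (pt e.2) x y -> Q x y \/
      exists a b, allowed a b /\ 0 < edge_mult (pt a) (pt b) x y).
Proof.
move=> M1 MQ Qsym /allP aE uE inj1 inj2 nQ x y.
have [/allP all0|/allPn[e eE e0]] :=
    boolP (all (fun e => edge_mult (pt e.1) (pt e.2) x y == 0) E).
  rewrite big1_seq ?addn0; last by move=> e /= eE; apply/eqP/all0.
  by split=> // /MQ; left.
rewrite -lt0n in e0; have ae := aE e eE; split; last first.
  by move=> _; right; exists e.1, e.2.
have -> : M x y = 0.
  apply/eqP; rewrite -leqn0 leqNgt; apply/negP=> /MQ q; apply: (nQ _ _ ae).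
  by case/edge_multP: e0 => -[-> ->] //; apply: Qsym.
rewrite add0n; apply: (@leq_trans (count_mem e E)); last first.
  by rewrite count_uniq_mem ?leq_b1 //; move: uE; rewrite cat_uniq => /andP[].
rewrite -sum1_count [X in _ <= X]big_mkcond /= big_seq [X in _ <= X]big_seq.
apply: leq_sum => e' e'E; rewrite -[X in _ <= X]/(nat_of_bool (e' == e)).
have [/edge_multP h|] := boolP (0 < edge_mult (pt e'.1) (pt e'.2) x y); last by rewrite lt0n negbK => /eqP->.
have ae' := aE e' e'E.
have [->|es] : e' = e \/ e' = swap_nodes e.
  have same : pt e'.1 = pt e.1 -> pt e'.2 = pt e.2 -> e' = e.
    by move=> h1 h2; have := inj1 _ _ _ _ ae' ae h1 h2; rewrite -!surjective_pairing.
  have sw : pt e'.1 = pt e.2 -> pt e'.2 = pt e.1 -> e' = swap_nodes e.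
    by move=> h1 h2; have := inj2 _ _ _ _ ae' ae h1 h2; rewrite -surjective_pairing.
  by move/edge_multP: e0 => [] [h1 h2]; case: h => -[h3 h4];
    [left; apply: same | right; apply: sw | right; apply: sw | left; apply: same];
    rewrite ?h1 ?h2 ?h3 ?h4.
  by rewrite eqxx /edge_mult leq_b1.
by move: uE; rewrite cat_uniq => /and3P[_ /hasPn/(_ e')]; rewrite es map_f // -es e'E => /(_ isT).
Qed.

End State.

(** Edges inside the old layer are left to the preceding tile. *)
Definition layer_edge (cross inner : rel nat) : rel node := fun a b =>
  match a.1, b.1 with
  | true, true => inner a.2 b.2
  | false, true => cross a.2 b.2
  | true, false => cross b.2 a.2
  | false, false => false
  end.

Lemma catlA (T : Type) (A B C : seq (seq T)) : catl A (catl B C) = catl (catl A B) C.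
Proof. by elim: A B C => [|a A IHA] [|b B] [|c C] //; congr (_ :: _); [apply: catA | apply: IHA]. Qed.

Section Run.
Variables (cross : rel nat) (inner : rel nat) (width : nat).

(** In [run L n C L'], a sequence of [n] tiles leads from [L] to [L'], and [C] lists for each factor
    the lengths of the cycles closed on the way. *)
Inductive run : layout -> nat -> seq (seq nat) -> layout -> Prop :=
| RunNil L : run L 0 (nseq (size L) [::]) L
| RunCons L t n C L' :
    tile_ok (layer_edge cross inner) (nseq (size L) (iota 0 width)) L t ->
    run (tile_dst L t) n C L' -> run L n.+1 (catl C (tile_closed L t)) L'.

Variables (g : nat -> nat) (start : nat * nat -> nat * nat -> Prop).

(* Points are pairs (layer, position); positions in layer 0 are virtual, several
   of them being the same point [(0, g p)]. *)
Definition pos (k : nat) (v : nat) : nat * nat := if k is 0 then (0, g v) else (k, v).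

(** An over-approximation: all edges that the first [k] tiles were allowed to use. This suffices for
    novelty, as the edges of the next tile reach a new layer. *)
Definition drawn (k : nat) (x y : nat * nat) : Prop :=
  start x y \/ exists b n1 n2, [/\ b < k, layer_edge cross inner n1 n2
    & 0 < edge_mult (node_pt (pos b) (pos b.+1) n1) (node_pt (pos b) (pos b.+1) n2) x y].

Definition realized (L : layout) (k : nat) (lens : seq (seq nat))
    (cov : seq (seq (nat * nat))) (st : state (nat * nat)%type) :=
  [/\ matches (pos k) L st, tracks lens cov st,
      forall x y, state_mult st x y <= 1
    & forall x y, 0 < state_mult st x y -> drawn k x y].

Hypothesis start_sym : forall x y, start x y -> start y x.
Hypothesis start0 : forall x y, start x y -> x.1 = 0 /\ y.1 = 0.
Hypothesis g_inj : forall p q v, cross p v -> cross q v -> g p = g q -> p = q.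

Definition layers k n := [seq (b, v) | b <- iota k.+1 n, v <- iota 0 width].

Lemma drawn_sym k x y : drawn k x y -> drawn k y x.
Proof.
case=> [/start_sym|[b [n1 [n2 [bk ok h]]]]]; first by left.
by right; exists b, n1, n2; rewrite edge_mult_sym.
Qed.

Lemma drawn_le k x y : drawn k x y -> x.1 <= k.
Proof.
have le b n : b < k -> (node_pt (pos b) (pos b.+1) n).1 <= k.
  by move=> bk; case: n => [[] v]; rewrite /node_pt /=; case: (b) bk => //= b' /ltnW.
case=> [/start0[-> _] //|[b [n1 [n2 [bk _ /edge_multP h]]]]].
by case: h => -[ex ey]; rewrite -?ex -?ey; apply: le.
Qed.

Lemma pos_layer k v : (pos k v).1 = k.
Proof. by case: k. Qed.

Lemma node_layer k n : (node_pt (pos k) (pos k.+1) n).1 = n.1 + k.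
Proof. by rewrite /node_pt; case: ifP => //= _; rewrite pos_layer. Qed.

Lemma layer_inj k a b a' b' : layer_edge cross inner a b -> layer_edge cross inner a' b' ->
  node_pt (pos k) (pos k.+1) a = node_pt (pos k) (pos k.+1) a' ->
  node_pt (pos k) (pos k.+1) b = node_pt (pos k) (pos k.+1) b' -> (a, b) = (a', b').
Proof.
have same n n' : node_pt (pos k) (pos k.+1) n = node_pt (pos k) (pos k.+1) n' -> n.1 = n'.1.
  by move/(congr1 fst); rewrite !node_layer; case: n n' => [[] v] [[] v'] //=; lia.
move=> c c' ea eb; move: (same _ _ ea) (same _ _ eb).
case: a b a' b' c c' ea eb => [sa a] [sb b] [sa' a'] [sb' b'] /= c c' ea eb ? ?; subst sa' sb'.
move: c c' ea eb; rewrite /layer_edge /node_pt /=; case: sa; case: sb => //= c c'.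
- by move=> [->] [->].
- case: k {same} => [|k] /= [ea] [eb]; subst a'; last by rewrite eb.
  by rewrite (g_inj c c' eb).
- case: k {same} => [|k] /= [ea] [eb]; subst b'; last by rewrite ea.
  by rewrite (g_inj c c' ea).
Qed.

Hypothesis inner_sym : forall v w, inner v w = inner w v.

Lemma layer_edge_sym a b :
  layer_edge cross inner a b = layer_edge cross inner b a.
Proof. by case: a b => [[] a] [[] b]; rewrite /layer_edge //= inner_sym. Qed.

Lemma layer_inj_swap k a b a' b' : layer_edge cross inner a b -> layer_edge cross inner a' b' ->
  node_pt (pos k) (pos k.+1) a = node_pt (pos k) (pos k.+1) b' ->
  node_pt (pos k) (pos k.+1) b = node_pt (pos k) (pos k.+1) a' -> (a, b) = (b', a').
Proof.
by move=> c c' ea eb; apply: layer_inj ea eb => //; rewrite layer_edge_sym.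
Qed.

Lemma layer_new k a b : layer_edge cross inner a b ->
  ~ drawn k (node_pt (pos k) (pos k.+1) a) (node_pt (pos k) (pos k.+1) b).
Proof.
move=> ok d; have := drawn_le d; have := drawn_le (drawn_sym d); rewrite !node_layer.
by case: a b ok {d} => [[] a] [[] b] //=; lia.
Qed.

Lemma run_realized L n C L' : run L n C L' -> forall k lens cov st,
  size lens = size L -> size cov = size L ->
  realized L k lens cov st -> exists st',
  realized L' (k + n) (catl C lens) [seq c ++ layers k n | c <- cov] st'.
Proof.
elim=> {L n C L'} [L|L t n C L' tok _ IH] k lens cov st szl szc [ms tr m1 mQ].
  exists st; rewrite addn0; split=> //.
  have -> : [seq c ++ layers k 0 | c <- cov] = cov.
    by rewrite -[RHS]map_id; apply: eq_map => c; rewrite cats0.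
  have -> // : catl (nseq (size L) [::]) lens = lens.
  by elim: (L) lens szl {ms tr szc} => [|f F IHF] [|l lens] //= [/IHF]; rewrite /catl /= => ->.
have /and5P[/eqP szt /eqP szn fok eok uok] := tok.
have [ms' tr' mm] := apply_tileP (pos k.+1) szt szn fok ms tr.
have [|||st' r'] := IH k.+1 (catl (tile_closed L t) lens)
    (catl cov (map (map (pos k.+1)) (nseq (size L) (iota 0 width)))) (apply_tile (pos k.+1) st t).
- by rewrite /catl /tile_closed /tile_dst !size_map !size_zip !size_map size_zip szt szl !minnn.
- by rewrite /catl /tile_dst !size_map !size_zip !size_map size_nseq szt szc !minnn.
- have key x y := add_edges (pt := node_pt (pos k) (pos k.+1)) (Q := drawn k) m1 mQ
    (@drawn_sym k) eok uok (@layer_inj k) (@layer_inj_swap k) (@layer_new k) x y.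
  split=> // x y; rewrite mm; first by case: (key x y).
  case: (key x y) => _ h /h[[?|[b [n1 [n2 [bk ok e]]]]]|[n1 [n2 [ok e]]]]; first by left.
    by right; exists b, n1, n2; split=> //; apply: ltnW.
  by right; exists k, n1, n2.
exists st'; rewrite addnS -addSn -catlA.
suff <- : [seq c ++ layers k.+1 n | c <- catl cov (map (map (pos k.+1)) (nseq (size L) (iota 0 width)))]
    = [seq c ++ layers k n.+1 | c <- cov] by [].
rewrite map_nseq -szc /layers /= .
elim: (cov) => //= c cs IHc; rewrite -catA; congr (_ :: _); exact: IHc.
Qed.

Variables (crossF innerF : rel nat) (k : nat).
Hypothesis k_gt0 : 0 < k.
Hypothesis crossF_new : forall p v, crossF p v ->
  1 < k \/ forall q w, cross q w -> g q <> v.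
Hypothesis innerF_new : forall v w, innerF v w -> ~ start (0, v) (0, w).

(** The last tile puts its fresh vertices into layer 0 and leaves no path open. It could only repeat
    an edge of the first tile, when there is a single layer, or a start edge; [crossF_new] and
    [innerF_new] exclude both. *)
Lemma fold_realized L lens cov st t news : realized L k lens cov st ->
  tile_ok (layer_edge crossF innerF) news L t -> all (@nilp _) (tile_dst L t) ->
  exists css : seq (seq (seq (nat * nat)%type)),
    [/\ all2 (fun l cs => perm_eq (map size cs) l) (catl (tile_closed L t) lens) css,
        all2 (fun c cs => perm_eq (flatten cs) c) (catl cov (map (map (pair 0)) news)) css,
        forall x y, \sum_(c <- flatten css) closed_mult c x y <= 1
      & forall x y, 0 < \sum_(c <- flatten css) closed_mult c x y -> drawn k x y \/
          exists n1 n2, layer_edge crossF innerF n1 n2 /\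
            0 < edge_mult (node_pt (pair k) (pair 0) n1) (node_pt (pair k) (pair 0) n2) x y].
Proof.
move=> [ms tr m1 mQ] tok nil; have /and5P[/eqP szt /eqP szn fok eok uok] := tok.
have [ms' tr' mm] := apply_tileP (pair 0) szt szn fok ms tr.
have posk : pos k =1 pair k by case: (k) k_gt0.
have inj n n' : node_pt (pos k) (pair 0) n = node_pt (pos k) (pair 0) n' -> n = n'.
  case: n n' => [[] v] [[] v']; rewrite /node_pt /= ?posk => -[].
  - by move=> ->.
  - by move=> k0; move: k_gt0; rewrite -k0.
  - by move=> k0; move: k_gt0; rewrite k0.
  - by move=> ->.
have new n1 n2 : layer_edge crossF innerF n1 n2 ->
    ~ drawn k (node_pt (pos k) (pair 0) n1) (node_pt (pos k) (pair 0) n2).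
  suff H p v : crossF p v -> ~ drawn k (k, p) (0, v).
    case: n1 n2 => [[] v] [[] w]; rewrite /layer_edge /node_pt /= ?posk // => ok.
    - case=> [/innerF_new//|[b [m1' [m2 [bk ok' /edge_multP h]]]]].
      have : (node_pt (pos b) (pos b.+1) m1').1 = 0 /\ (node_pt (pos b) (pos b.+1) m2).1 = 0.
        by case: h => -[-> ->].
      by rewrite !node_layer; case: m1' m2 ok' {h} => [[] x] [[] y] //= _ [].
    - by move/drawn_sym; apply: H.
    - exact: H.
  move=> ok; case=> [/start0[] /= k0|[b [n1' [n2' [bk ok' /edge_multP h]]]]].
    by move: k_gt0; rewrite k0.
  have lay c : (node_pt (pos b) (pos b.+1) c) = (0, v) -> b = 0 /\ c.1 = false.
    by move/(congr1 fst); rewrite node_layer; case: c => [[] x]; case: (b).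
  have layk c : (node_pt (pos b) (pos b.+1) c) = (k, p) -> c.1 + b = k.
    by move/(congr1 fst); rewrite node_layer.
  case: h => -[h1 h2].
    have [b0 c0] := lay _ h2; have := layk _ h1; subst b.
    case: n1' n2' ok' c0 h1 h2 => [[] x] [[] y] //= ok' _ _ [gv] k1.
    by have [|/(_ _ _ ok')] := crossF_new ok; [rewrite -k1 | apply].
  have [b0 c0] := lay _ h1; have := layk _ h2; subst b.
  case: n1' n2' ok' c0 h1 h2 => [[] x] [[] y] //= ok' _ [gv] _ k1.
  by have [|/(_ _ _ ok')] := crossF_new ok; [rewrite -k1 | apply].
have key x y := add_edges (pt := node_pt (pos k) (pair 0)) m1 mQ (@drawn_sym k) eok uok
  (fun a b a' b' _ _ h1 h2 => f_equal2 pair (inj _ _ h1) (inj _ _ h2))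
  (fun a b a' b' _ _ h1 h2 => f_equal2 pair (inj _ _ h1) (inj _ _ h2)) new x y.
set st' := apply_tile _ st t in ms' tr' mm.
exists (map fst st').
have Mst x y : state_mult st' x y = \sum_(c <- flatten (map fst st')) closed_mult c x y.
  rewrite /state_mult big_flatten big_map; apply: eq_big_seq => s /= sst.
  suff -> : s.2 = [::] by rewrite big_nil addn0.
  move: ms' nil sst; rewrite /matches; elim: (tile_dst L t) (st') => [|d D IHD] [|s' S] //=.
  case/andP=> md mD /andP[/nilP d0 nD]; rewrite inE => /orP[/eqP->|]; last exact: IHD.
  by move: md; rewrite d0; case: (s'.2).
have all2map (A B : Type) (r : A -> seq (seq (nat * nat)) -> bool) (S : seq B)
    (h : B -> seq (seq (nat * nat))) l : all2 (fun a s => r a (h s)) l S -> all2 r l (map h S).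
  by elim: l S => [|a l IHl] [|b S] //= /andP[-> /IHl].
have s20 : all (fun s : seq (seq (nat * nat)) * seq (seq (nat * nat)) => nilp s.2) st'.
  move: ms' nil; rewrite /matches; elim: (tile_dst L t) (st') => [|d D IHD] [|s' S] //=.
  case/andP=> md mD /andP[/nilP d0 nD]; rewrite IHD // andbT.
  by move: md; rewrite d0; case: (s'.2).
move: tr' => /andP[tr1 tr2]; split.
- exact: all2map.
- apply: all2map; elim: (catl _ _) (st') tr2 s20 => [|c cv IHc] [|s S] //=.
  by case/andP=> pc tc /andP[/nilP s0 nS]; rewrite IHc // andbT; rewrite s0 cats0 in pc.
- by move=> x y; rewrite -Mst mm; case: (key x y).
- move=> x y; rewrite -Mst mm; case: (key x y) => _ h /h[?|[n1 [n2 [ok e]]]]; first by left.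
  right; exists n1, n2; split=> //.
  have E n : node_pt (pair k) (pair 0) n = node_pt (pos k) (pair 0) n.
    by rewrite /node_pt posk.
  by rewrite !E.
Qed.

End Run.

(** * Three equal 2-factors on the ladder *)

(** Side 0 of layer [j] is the column [j] and side 1 the column [-j]. Opposite sides of consecutive
    layers are columns with sum 1 or -1, and the two sides of one layer have sum 0. *)
Definition lad_cross (p v : nat) := [&& p < 4, v < 4 & p./2 != v./2].
Definition lad_inner (v w : nat) := [&& v < 4, w < 4 & v != w].
Local Notation lrun := (run lad_cross lad_inner 4).

Local Notation F0 := (Fresh 0).
Local Notation F1 := (Fresh 1).
Local Notation F2 := (Fresh 2).
Local Notation F3 := (Fresh 3).
Local Notation F4 := (Fresh 4).
Local Notation F5 := (Fresh 5).
Local Notation P0 := (Strand 0 false).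
Local Notation P1 := (Strand 1 false).
Local Notation Q0 := (Strand 0 true).
Local Notation Q1 := (Strand 1 true).

(* The tiles below were found by a computer search.  [Fv] is the fresh vertex at
   position [v = 2 * side + bit] of the new layer; [Pk] and [Qk] are the [k]-th
   open path of the factor, traversed forwards and backwards. *)
Definition t_4_4 : tile :=
  [:: ([:: [:: F0; F1; F3; F2]], [::]);
      ([:: [:: F2; P0; F3; Q1]], [:: [:: F0]; [:: F1]]);
      ([:: [:: F0; P0; F1; Q1]], [:: [:: F2]; [:: F3]])].
Definition t_4_post : tile :=
  [:: ([:: [:: F0; F2; F1; F3]], [::]);
      ([:: [:: F2; P0; F3; Q1]], [:: [:: F0; F1]]);
      ([:: [:: F0; P0; F1; Q1]], [:: [:: F2; F3]])].
Definition t_base_en : tile :=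
  [:: ([::], [:: [:: F0; F1; F3; F2]]);
      ([::], [:: [:: F1; P1; F0; F2; Q0; F3]]);
      ([::], [:: [:: F1; P1; F0; F3; P0; F2]])].
Definition t_en_en : tile :=
  [:: ([::], [:: [:: F0; F1; Q0; F3; F2]]);
      ([::], [:: [:: F1; F2; F0; Q0; F3]]);
      ([::], [:: [:: F1; F3; F0; Q0; F2]])].
Definition t_en_base : tile :=
  [:: ([:: [:: F1; F0; F3; F2; P0]], [::]);
      ([:: [:: F1; F3; P0]], [:: [:: F0]; [:: F2]]);
      ([:: [:: F0; F2; P0]], [:: [:: F1]; [:: F3]])].
Definition t_base_ef : tile :=
  [:: ([::], [:: [:: F0; F1; F3; F2]]);
      ([::], [:: [:: F1; P1; F0; F2; Q0; F3]]);
      ([::], [:: [:: F0; Q1; F1]; [:: F2; Q0; F3]])].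
Definition t_post_ef : tile :=
  [:: ([::], [:: [:: F0; F3; F1; F2]]);
      ([::], [:: [:: F1; F0; F2; Q0; F3]]);
      ([::], [:: [:: F0; Q0; F1]; [:: F2; F3]])].
Definition t_ef_ef : tile :=
  [:: ([::], [:: [:: F0; F1; Q0; F3; F2]]);
      ([::], [:: [:: F1; F2; P0; F0; F3]]);
      ([::], [:: [:: F0; P1; F1]; [:: F2; P0; F3]])].
Definition t_ef_om : tile :=
  [:: ([::], [:: [:: F0; F1; Q0; F3; F2]]);
      ([::], [:: [:: F1]; [:: F2; P0; F0; F3]]);
      ([:: [:: F1; F3; Q0; F2; F0; P1]], [::])].
Definition t_om_en : tile :=
  [:: ([:: [:: F1; F3; P0]], [:: [:: F0; F2]]);
      ([:: [:: F0; P1]], [:: [:: F1; F2; Q0; F3]]);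
      ([::], [:: [:: F1; F0; F3; F2]])].
Definition t_om_ef : tile :=
  [:: ([:: [:: F1; F3; P0]], [:: [:: F0; F2]]);
      ([:: [:: F0; P1]], [:: [:: F1; F2; Q0; F3]]);
      ([::], [:: [:: F0; F1]; [:: F2; F3]])].
Definition t_post_el : tile :=
  [:: ([::], [:: [:: F0; F2]; [:: F1; F3]]);
      ([::], [:: [:: F0; F1; F2; Q0; F3]]);
      ([::], [:: [:: F1; P0; F0; F3; F2]])].
Definition t_el_el : tile :=
  [:: ([::], [:: [:: F0; Q1; F2]; [:: F1; Q0; F3]]);
      ([::], [:: [:: F0; F1; Q0; F2; F3]]);
      ([::], [:: [:: F1; F3; P0; F0; F2]])].
Definition t_el_base : tile :=
  [:: ([:: [:: F1; F0; Q1; F3; F2; P0]], [::]);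
      ([:: [:: F1; F3; P0]], [:: [:: F0]; [:: F2]]);
      ([:: [:: F0; F2; P0]], [:: [:: F1]; [:: F3]])].
Definition t_base_66_1 : tile :=
  [:: ([::], [:: [:: F0; F1]; [:: F2; F3]]);
      ([:: [:: F0; F2; P0; F3; F1; Q1]], [::]);
      ([:: [:: F0; F3; Q0; F2; F1; Q1]], [::])].
Definition t_base_66_2 : tile :=
  [:: ([::], [:: [:: F0; Q1; F1]; [:: F2; Q0; F3]]);
      ([::], [:: [:: F0; F1; F3; F2]]);
      ([::], [:: [:: F1; F2; F0; F3]])].
Definition t_base_66_3 : tile :=
  [:: ([:: [:: F0; F1; Q1]; [:: F2; F3; Q0]], [::]);
      ([:: [:: F1; F3; P0]], [:: [:: F0]; [:: F2]]);
      ([:: [:: F0; F2; P0]], [:: [:: F1]; [:: F3]])].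
Definition t_base_466_1 : tile :=
  [:: ([:: [:: F0; F1; F3; F2]], [::]);
      ([::], [:: [:: F0; P1; F1]; [:: F2; P0; F3]]);
      ([::], [:: [:: F0; P1; F1]; [:: F2; P0; F3]])].
Definition t_base_466_2 : tile :=
  [:: ([::], [:: [:: F0; F1; F3; F2]]);
      ([:: [:: F0; P1]], [:: [:: F1]; [:: F2; Q0; F3]]);
      ([:: [:: F0; F3; Q0; F2]; [:: F1; P1]], [::])].
Definition t_post_466_1 : tile :=
  [:: ([::], [:: [:: F0; F2]; [:: F1; F3]]);
      ([:: [:: F0; F1; F2; P0; F3]], [::]);
      ([::], [:: [:: F0; P0; F1]; [:: F2; F3]])].
Definition t_post_466_2 : tile :=
  [:: ([:: [:: F1; F3; P0]], [:: [:: F0; Q1; F2]]);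
      ([::], [:: [:: F1]; [:: F2; F0; F3]]);
      ([:: [:: F1; F0; P1]; [:: F3; F2; P0]], [::])].
Definition t_k66_1 : tile :=
  [:: ([::], [:: [:: F0; F1]; [:: F2; F3]]);
      ([:: [:: F1; F3; P0]], [:: [:: F0; F2]]);
      ([:: [:: F1; F2; Q0; F3; F0; Q1]], [::])].
Definition t_k66_2 : tile :=
  [:: ([::], [:: [:: F0; P1; F1]; [:: F2; P0; F3]]);
      ([:: [:: F0; F1; Q0; F3; F2]], [::]);
      ([::], [:: [:: F0; F3; F1; F2]])].
Definition t_k66_3 : tile :=
  [:: ([:: [:: F1; F0; Q1]; [:: F3; F2; Q0]], [::]);
      ([::], [:: [:: F0; F3; F1; F2]]);
      ([:: [:: F0; F2; P0]], [:: [:: F1]; [:: F3]])].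
Definition t_k66end_1 : tile :=
  [:: ([::], [:: [:: F0; F1; F3; F2]]);
      ([:: [:: F0; F2; P0]], [:: [:: F1]; [:: F3]]);
      ([:: [:: F0; F3; Q0; F2; F1; Q1]], [::])].
Definition t_k66end_2 : tile :=
  [:: ([:: [:: F1; F3; P0]], [:: [:: F0; F2]]);
      ([:: [:: F1; F2; Q0; F3; F0; Q1]], [::]);
      ([::], [:: [:: F0; F1]; [:: F2; F3]])].

(** In the states between gadgets the second and third factors are two vertices ahead of the first,
    which receives the two vertices of column 0 only from the closing tile. *)
Definition Lfour : layout := [:: [::]; [:: (0, 0, 1); (1, 1, 1)]; [:: (2, 2, 1); (3, 3, 1)]].
Definition Lbase : layout := [:: [::]; [:: (0, 0, 1); (2, 2, 1)]; [:: (1, 1, 1); (3, 3, 1)]].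
Definition Lpost : layout := [:: [::]; [:: (0, 1, 2)]; [:: (2, 3, 2)]].
(** The arguments are lengths of open paths. In [LEN], [LEF] and [LEL] a tile can be repeated, each
    time adding four vertices to every factor. *)
Definition LEN x y z : layout := [:: [:: (0, 2, x)]; [:: (1, 3, y)]; [:: (1, 2, z)]].
Definition LEF x y z w : layout :=
  [:: [:: (0, 2, x)]; [:: (1, 3, y)]; [:: (0, 1, z); (2, 3, w)]].
Definition LOM x y : layout := [:: [:: (0, 2, x)]; [:: (1, 1, 1); (2, 3, y)]; [::]].
Definition LEL x w y z : layout :=
  [:: [:: (0, 2, x); (1, 3, w)]; [:: (0, 3, y)]; [:: (1, 2, z)]].
(* [LK] is the start for the types with 6-cycles only; all other types start from
   [Lbase], or from [Lfour] when several 4-cycles come first. *)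
Definition LK : layout := [:: [::]; [:: (0, 2, 4)]; [:: (1, 1, 1); (3, 3, 1)]].
Definition LK' : layout := [:: [:: (0, 2, 2)]; [::]; [:: (0, 1, 2); (2, 3, 2)]].

Definition E3 : seq (seq nat) := [:: [::]; [::]; [::]].

Lemma run_cons L t M n C C' L' :
  tile_ok (layer_edge lad_cross lad_inner) (nseq (size L) (iota 0 4)) L t ->
  tile_dst L t = M -> lrun M n C L' -> catl C (tile_closed L t) = C' -> lrun L n.+1 C' L'.
Proof. by move=> tok <- r <-; apply: RunCons. Qed.

Lemma run_one L t M C' :
  tile_ok (layer_edge lad_cross lad_inner) (nseq (size L) (iota 0 4)) L t ->
  tile_dst L t = M -> catl (nseq (size M) [::]) (tile_closed L t) = C' -> lrun L 1 C' M.
Proof. by move=> tok dst cl; apply: run_cons tok dst (RunNil _ _ _ _) cl. Qed.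

Ltac tiles_eq :=
  rewrite ?/Lfour ?/Lbase ?/Lpost ?/LEN ?/LEF ?/LOM ?/LEL;
  rewrite /tile_dst /tile_closed /catl /word_strand /word_len /=;
  repeat (f_equal; try lia).
Ltac one t := apply: (@run_one _ t); [by [] | by tiles_eq | by tiles_eq].

Lemma run_44 : lrun Lfour 1 [:: [:: 4]; [:: 4]; [:: 4]] Lfour.
Proof. one t_4_4. Qed.
Lemma run_4_post : lrun Lfour 1 [:: [:: 4]; [:: 4]; [:: 4]] Lpost.
Proof. one t_4_post. Qed.
Lemma run_base_en : lrun Lbase 1 E3 (LEN 4 6 6).
Proof. one t_base_en. Qed.
Lemma run_en_en x y z : lrun (LEN x y z) 1 E3 (LEN (x + 4) (y + 4) (z + 4)).
Proof. one t_en_en. Qed.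
Lemma run_en_base x y z : lrun (LEN x y z) 1 [:: [:: x + 4]; [:: y + 2]; [:: z + 2]] Lbase.
Proof. one t_en_base. Qed.
Lemma run_base_ef : lrun Lbase 1 E3 (LEF 4 6 3 3).
Proof. one t_base_ef. Qed.
Lemma run_post_ef : lrun Lpost 1 E3 (LEF 4 6 4 2).
Proof. one t_post_ef. Qed.
Lemma run_ef_ef x y z w : lrun (LEF x y z w) 1 E3 (LEF (x + 4) (y + 4) (w + 2) (z + 2)).
Proof. one t_ef_ef. Qed.
Lemma run_ef_om x y z w :
  lrun (LEF x y z w) 1 [:: [::]; [::]; [:: z + w + 4]] (LOM (x + 4) (y + 3)).
Proof. one t_ef_om. Qed.
Lemma run_om_en x y : lrun (LOM x y) 1 [:: [:: x + 2]; [:: y + 1]; [::]] (LEN 2 4 4).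
Proof. one t_om_en. Qed.
Lemma run_om_ef x y : lrun (LOM x y) 1 [:: [:: x + 2]; [:: y + 1]; [::]] (LEF 2 4 2 2).
Proof. one t_om_ef. Qed.
Lemma run_post_el : lrun Lpost 1 E3 (LEL 2 2 6 6).
Proof. one t_post_el. Qed.
Lemma run_el_el x w y z : lrun (LEL x w y z) 1 E3 (LEL (w + 2) (x + 2) (y + 4) (z + 4)).
Proof. one t_el_el. Qed.
Lemma run_el_base x w y z :
  lrun (LEL x w y z) 1 [:: [:: x + w + 4]; [:: y + 2]; [:: z + 2]] Lbase.
Proof. one t_el_base. Qed.

Fixpoint chain_dst L (ts : seq tile) : layout :=
  if ts is t :: ts' then chain_dst (tile_dst L t) ts' else L.

Fixpoint chain_closed L (ts : seq tile) : seq (seq nat) :=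
  if ts is t :: ts' then catl (chain_closed (tile_dst L t) ts') (tile_closed L t)
  else nseq (size L) [::].

Fixpoint chain_ok L (ts : seq tile) : bool :=
  if ts is t :: ts' then
    tile_ok (layer_edge lad_cross lad_inner) (nseq (size L) (iota 0 4)) L t &&
    chain_ok (tile_dst L t) ts'
  else true.

Lemma run_chain L ts : chain_ok L ts -> lrun L (size ts) (chain_closed L ts) (chain_dst L ts).
Proof.
elim: ts L => [|t ts IHts] L /=; first by move=> _; apply: RunNil.
by case/andP=> tok /IHts r; apply: RunCons.
Qed.

Lemma run_66 : lrun Lbase 3 [:: [:: 6; 6]; [:: 6; 6]; [:: 6; 6]] Lbase.
Proof. exact: (@run_chain Lbase [:: t_base_66_1; t_base_66_2; t_base_66_3]). Qed.

Lemma run_base_466 : lrun Lbase 2 [:: [:: 4]; [:: 4]; [:: 6; 4]] (LOM 4 5).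
Proof. exact: (@run_chain Lbase [:: t_base_466_1; t_base_466_2]). Qed.

Lemma run_post_466 : lrun Lpost 2 [:: [:: 4]; [:: 6]; [:: 4; 6]] (LOM 4 3).
Proof. exact: (@run_chain Lpost [:: t_post_466_1; t_post_466_2]). Qed.

Lemma run_k66 : lrun LK 3 [:: [:: 6; 6]; [:: 6; 6]; [:: 6; 6]] LK.
Proof. exact: (@run_chain LK [:: t_k66_1; t_k66_2; t_k66_3]). Qed.

Lemma run_k66_end : lrun LK 2 [:: [:: 6]; [:: 6; 6]; [:: 6]] LK'.
Proof. exact: (@run_chain LK [:: t_k66end_1; t_k66end_2]). Qed.

Lemma size_catl (T : Type) (C D : seq (seq T)) : size (catl C D) = minn (size C) (size D).
Proof. by rewrite size_map size_zip. Qed.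

Lemma run_size L n C L' : lrun L n C L' -> size L' = size L /\ size C = size L.
Proof.
elim=> [M|M t m D M' /and5P[/eqP szt _ _ _ _] _ [sz1 sz2]]; first by rewrite size_nseq.
have szd : size (tile_dst M t) = size M by rewrite size_map size_zip szt minnn.
by rewrite size_catl sz1 sz2 szd size_map size_zip szt !minnn.
Qed.

Lemma run_trans L n C M n' D L' :
  lrun L n C M -> lrun M n' D L' -> lrun L (n + n') (catl D C) L'.
Proof.
move=> r; elim: r n' D => {L n C M} [L|L t n C M tok _ IH] n' D r.
  have [_ szD] := run_size r; suff -> : catl D (nseq (size L) [::]) = D by [].
  by rewrite -szD; elim: (D) => //= d D' IHD; rewrite /catl /= cats0; congr (_ :: _).
by rewrite addSn catlA; apply: RunCons => //; apply: IH.
Qed.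

(** The three factors close cycles of the same lengths, but possibly in different orders, hence
    [perm_eq]. *)
Definition gadget L T L' := exists n C, lrun L n.+1 C L' /\ all (perm_eq T) C.

Lemma run_en_loop x y z i :
  lrun (LEN x y z) i E3 (LEN (x + 4 * i) (y + 4 * i) (z + 4 * i)).
Proof.
elim: i x y z => [|i IHi] x y z; first by rewrite muln0 !addn0; apply: RunNil.
have := run_trans (run_en_en x y z) (IHi _ _ _).
by rewrite mulnS !addnA add1n.
Qed.

Lemma run_ef_loop x y z w i : exists z' w', z' + w' = z + w + 4 * i /\
  lrun (LEF x y z w) i E3 (LEF (x + 4 * i) (y + 4 * i) z' w').
Proof.
elim: i x y z w => [|i IHi] x y z w.
  by exists z, w; rewrite muln0 !addn0; split=> //; apply: RunNil.
have [z' [w' [e r]]] := IHi (x + 4) (y + 4) (w + 2) (z + 2).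
exists z', w'; split; first lia.
by have := run_trans (run_ef_ef x y z w) r; rewrite mulnS !addnA add1n.
Qed.

Lemma run_el_loop x w y z i : exists x' w', x' + w' = x + w + 4 * i /\
  lrun (LEL x w y z) i E3 (LEL x' w' (y + 4 * i) (z + 4 * i)).
Proof.
elim: i x w y z => [|i IHi] x w y z.
  by exists x, w; rewrite muln0 !addn0; split=> //; apply: RunNil.
have [x' [w' [e r]]] := IHi (w + 2) (x + 2) (y + 4) (z + 4).
exists x', w'; split; first lia.
by have := run_trans (run_el_el x w y z) r; rewrite mulnS !addnA add1n.
Qed.

Lemma gadgetI L n C L' T : lrun L n C L' -> 0 < n -> all (perm_eq T) C -> gadget L T L'.
Proof. by case: n => // n r _ c; exists n, C. Qed.

Ltac lens_eq := rewrite /catl /E3 /LOM /=; repeat (f_equal; try lia).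

Lemma gadget_base_8 i : gadget Lbase [:: 8 + 4 * i] Lbase.
Proof.
have r := run_trans run_base_en (run_trans (run_en_loop 4 6 6 i) (run_en_base _ _ _)).
apply: gadgetI (r) _ _ => //; set T := [:: _]; rewrite (_ : catl _ _ = [:: T; T; T]).
  by rewrite /= perm_refl.
by rewrite /T; lens_eq.
Qed.

Lemma gadget_post_8 i : gadget Lpost [:: 8 + 4 * i] Lbase.
Proof.
have [x [w [e r1]]] := run_el_loop 2 2 6 6 i.
have r := run_trans run_post_el (run_trans r1 (run_el_base _ _ _ _)).
apply: gadgetI (r) _ _ => //; set T := [:: _]; rewrite (_ : catl _ _ = [:: T; T; T]).
  by rewrite /= perm_refl.
by rewrite /T; lens_eq.
Qed.

Lemma run_om_base x y j : exists n,
  lrun (LOM x y) n.+1 [:: [:: 6 + 4 * j; x + 2]; [:: 6 + 4 * j; y + 1]; [:: 6 + 4 * j]] Lbase.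
Proof.
have r := run_trans (run_om_en x y) (run_trans (run_en_loop 2 4 4 j) (run_en_base _ _ _)).
exists (j + 1); rewrite -[(j + 1).+1]add1n; congr (lrun _ _ _ _): r; by lens_eq.
Qed.

Lemma run_ef_pair z w i : z + w = 6 -> exists n,
  lrun (LEF 4 6 z w) n.+1 [:: [::]; [::]; [:: 10 + 4 * i]] (LOM (8 + 4 * i) (9 + 4 * i)).
Proof.
move=> zw; have [z' [w' [e r1]]] := run_ef_loop 4 6 z w i.
have r := run_trans r1 (run_ef_om _ _ _ _).
exists i; rewrite -[i.+1]addn1; congr (lrun _ _ _ _): r; by lens_eq.
Qed.

Definition enter (L : layout) := exists z w, z + w = 6 /\ lrun L 1 E3 (LEF 4 6 z w).

Lemma enter_base : enter Lbase. Proof. by exists 3, 3; split=> //; apply: run_base_ef. Qed.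
Lemma enter_post : enter Lpost. Proof. by exists 4, 2; split=> //; apply: run_post_ef. Qed.

(** A layer has four vertices, so lengths congruent to 2 modulo 4 come in pairs. The third factor
    closes its cycle of length [10 + 4 * i] on entering [LOM], the other two close theirs one tile
    later, and the shorter cycles follow through [LEN]. *)
Lemma gadget_pair L i j : enter L -> gadget L [:: 6 + 4 * j; 10 + 4 * i] Lbase.
Proof.
move=> [z [w [zw r0]]]; have [n r1] := run_ef_pair i zw; have [n' r2] := run_om_base (8 + 4 * i) (9 + 4 * i) j.
have r := run_trans r0 (run_trans r1 r2).
apply: gadgetI (r) _ _ => //; set T := [:: _; _]; rewrite (_ : catl _ _ = [:: T; T; T]).
  by rewrite /= perm_refl.
by rewrite /T; lens_eq.
Qed.

Lemma gadget_66 : gadget Lbase [:: 6; 6] Lbase.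
Proof. by apply: gadgetI run_66 _ _. Qed.

Lemma gadget_base_466 : gadget Lbase [:: 4; 6; 6] Lbase.
Proof.
have [n r1] := run_om_base 4 5 0.
by apply: gadgetI (run_trans run_base_466 r1) _ _ => //; rewrite /catl.
Qed.

Lemma gadget_post_466 : gadget Lpost [:: 4; 6; 6] Lbase.
Proof.
have [n r1] := run_om_base 4 3 0.
by apply: gadgetI (run_trans run_post_466 r1) _ _ => //; rewrite /catl.
Qed.

(* The last fold closes, in each factor, the current path into a cycle of
   length [x + 4]. *)
Definition finish L T := exists n C x z w,
  [/\ z + w = x + 2, lrun L n.+1 C (LEF x (x + 2) z w) & all (fun c => perm_eq T (x + 4 :: c)) C].

Lemma finishI L n C x z w T : lrun L n C (LEF x (x + 2) z w) -> 0 < n ->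
  z + w = x + 2 -> all (fun c => perm_eq T (x + 4 :: c)) C -> finish L T.
Proof. by case: n => // n r _ e c; exists n, C, x, z, w. Qed.

Lemma finish_perm L T T' : perm_eq T T' -> finish L T -> finish L T'.
Proof.
move=> p [n [C [x [z [w [e r c]]]]]]; exists n, C, x, z, w; split=> //.
apply: sub_all c => C' pc; rewrite perm_sym in p; exact: perm_trans p pc.
Qed.

Lemma finish_trans L T M T' : gadget L T M -> finish M T' -> finish L (T ++ T').
Proof.
move=> [n [C [r c]]] [n' [D [x [z [w [e r' d]]]]]].
exists (n + n'.+1), (catl D C), x, z, w; split=> //.
  by rewrite -addSn; apply: run_trans r r'.
apply/(all_nthP [::]) => i; rewrite size_catl => iD; rewrite /catl.
have [iD' iC] : i < size D /\ i < size C by move: iD; rewrite leq_min => /andP.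
rewrite (nth_map ([::], [::])) ?size_zip // nth_zip_cond size_zip iD /=.
rewrite -cat_cons perm_sym perm_catC perm_sym perm_cat //.
  by apply: (allP c); apply: mem_nth.
by apply: (allP d); apply: mem_nth.
Qed.

Lemma finish_8 L i : enter L -> finish L [:: 8 + 4 * i].
Proof.
move=> [z [w [zw r0]]]; have [z' [w' [e r1]]] := run_ef_loop 4 6 z w i.
exists i, E3, (4 + 4 * i), z', w'; split; first lia.
  have := run_trans r0 r1; rewrite add1n /catl /=.
  by rewrite (_ : 6 + 4 * i = 4 + 4 * i + 2); last lia.
rewrite (_ : 8 + 4 * i = 4 + 4 * i + 4); last lia.
by rewrite /= perm_refl.
Qed.

Lemma run_om_ef_loop x y j : exists z w, z + w = 2 + 4 * j + 2 /\
  lrun (LOM x y) j.+1 [:: [:: x + 2]; [:: y + 1]; [::]] (LEF (2 + 4 * j) (2 + 4 * j + 2) z w).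
Proof.
have [z [w [e r1]]] := run_ef_loop 2 4 2 2 j; exists z, w; split; first lia.
have := run_trans (run_om_ef x y) r1; rewrite add1n /catl /=.
by rewrite (_ : 4 + 4 * j = 2 + 4 * j + 2); last lia.
Qed.

Lemma finish_pair L i j : enter L -> finish L [:: 6 + 4 * j; 10 + 4 * i].
Proof.
move=> [z [w [zw r0]]]; have [n r1] := run_ef_pair i zw.
have [z' [w' [e r2]]] := run_om_ef_loop (8 + 4 * i) (9 + 4 * i) j.
apply: finishI (run_trans r0 (run_trans r1 r2)) _ e _ => //.
set T := [:: _; _]; rewrite (_ : catl _ _ = [:: [:: 10 + 4 * i]; [:: 10 + 4 * i]; [:: 10 + 4 * i]]).
  by rewrite (_ : 2 + 4 * j + 4 = 6 + 4 * j); [rewrite /= perm_refl|lia].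
by lens_eq.
Qed.

Lemma finish_base_466 : finish Lbase [:: 4; 6; 6].
Proof.
have [z [w [e r]]] := run_om_ef_loop 4 5 0.
by exists 2, [:: [:: 6; 4]; [:: 6; 4]; [:: 6; 4]], 2, z, w; split=> //; apply: run_trans run_base_466 r.
Qed.

Lemma finish_post_466 : finish Lpost [:: 4; 6; 6].
Proof.
have [z [w [e r]]] := run_om_ef_loop 4 3 0.
by exists 2, [:: [:: 6; 4]; [:: 4; 6]; [:: 4; 6]], 2, z, w; split=> //; apply: run_trans run_post_466 r.
Qed.

(** * Arranging the cycle lengths along the ladder *)

Definition good_len (x : nat) := ~~ odd x && (4 <= x).

(** The blocks that have a gadget and a finish from both [Lbase] and [Lpost]; a pair contains a
    length of at least 10. *)
Inductive xblock : seq nat -> Prop :=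
| XSingle i : xblock [:: 8 + 4 * i]
| XPair i j : xblock [:: 6 + 4 * j; 10 + 4 * i].

Lemma lengths_split T : all good_len T -> exists a c X o,
  perm_eq T (nseq a 4 ++ nseq c 6 ++ flatten X ++
    (if o is Some i then [:: 10 + 4 * i] else [::])) /\ forall x, x \in X -> xblock x.
Proof.
elim: T => [|x T IHT]; first by exists 0, 0, [::], None.
case/andP=> /andP[ox x4] /IHT[a [c [X [o [p hX]]]]].
have perm_ins (A B : seq nat) : perm_eq T (A ++ B) -> perm_eq (x :: T) (A ++ x :: B).
  move=> pT; apply: (@perm_trans _ (x :: A ++ B)); first by rewrite perm_cons.
  by rewrite perm_sym -[x :: B]cat1s perm_catCA.
have [x8|x4'] : x %% 4 = 0 \/ x %% 4 = 2 by lia.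
  have [x44|n4] := eqVneq x 4.
    by exists a.+1, c, X, o; split=> //=; rewrite x44 perm_cons.
  exists a, c, ([:: x] :: X), o; split=> //.
    rewrite -[flatten ([:: x] :: X)]/(x :: flatten X) cat_cons catA.
    by apply: perm_ins; rewrite -catA.
  move=> y; rewrite inE => /orP[/eqP->|]; last exact: hX.
  by rewrite (_ : x = 8 + 4 * ((x - 8) %/ 4)); [apply: XSingle | lia].
have [x6|n6] := eqVneq x 6.
  exists a, c.+1, X, o; split=> //=.
  by have := perm_ins (nseq a 4) _ p; rewrite x6.
have xE : x = 10 + 4 * ((x - 10) %/ 4) by lia.
case: o p => [i|] p.
  exists a, c, ([:: x; 10 + 4 * i] :: X), None; split=> //.
    rewrite -[flatten (_ :: X)]/(x :: 10 + 4 * i :: flatten X) cats0 catA.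
    apply: perm_ins; rewrite -catA; apply: perm_trans p _.
    by rewrite !perm_cat2l perm_catC.
  move=> y; rewrite inE => /orP[/eqP->|]; last exact: hX.
  rewrite (_ : x = 6 + 4 * ((x - 10) %/ 4).+1); last lia.
  exact: XPair.
exists a, c, X, (Some ((x - 10) %/ 4)); split=> //.
rewrite -xE !catA -[[:: x]]/(x :: [::]); apply: perm_ins.
by move: p; rewrite !catA.
Qed.

Lemma sumn_xblocks X : (forall x, x \in X -> xblock x) -> 4 %| sumn (flatten X).
Proof.
elim: X => //= x X IHX hX; rewrite sumn_cat dvdn_addr.
  by apply: IHX => y yX; apply: hX; rewrite inE yX orbT.
by case: (hX x (mem_head _ _)) => [i|i j] /=; apply/dvdnP;
  [exists (2 + i) | exists (4 + j + i)]; lia.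
Qed.

Lemma lengths_blocks T : all good_len T -> 4 %| sumn T -> exists a b X,
  perm_eq T (nseq a 4 ++ nseq b.*2 6 ++ flatten X) /\ forall x, x \in X -> xblock x.
Proof.
move=> gT sT; have [a [c [X [o [p hX]]]]] := lengths_split gT.
have := sumn_xblocks hX; move: sT; rewrite (perm_sumn p) !sumn_cat !sumn_nseq => s4 sX.
case: o p s4 => [i|] p /= s4.
  have [b cE] : exists b, c = b.*2.+1.
    case/dvdnP: s4 => k1 s4; case/dvdnP: sX => k2 sX; rewrite sX in s4.
    by exists c./2; lia.
  exists a, b, ([:: 6 + 4 * 0; 10 + 4 * i] :: X); split; last first.
    by move=> x; rewrite inE => /orP[/eqP->|/hX//]; apply: XPair.
  apply: perm_trans p _; rewrite perm_cat2l cE -[b.*2.+1]addn1 nseqD -catA perm_cat2l.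
  by rewrite -[flatten (_ :: X)]/(6 :: 10 + 4 * i :: flatten X) /= perm_cons perm_catC.
exists a, c./2, X; split=> //; rewrite (_ : c./2.*2 = c); last first.
  by case/dvdnP: s4 => k1 s4; case/dvdnP: sX => k2 sX; rewrite sX in s4; lia.
by move: p; rewrite cats0.
Qed.

Definition hub L := L = Lbase \/ L = Lpost.

Lemma gadget_x L x : hub L -> xblock x -> gadget L x Lbase.
Proof.
case=> -> [i|i j].
- exact: gadget_base_8.
- exact: gadget_pair enter_base.
- exact: gadget_post_8.
- exact: gadget_pair enter_post.
Qed.

Lemma finish_x L x : hub L -> xblock x -> finish L x.
Proof.
move=> hL; have eL : enter L by case: hL => ->; [apply: enter_base | apply: enter_post].
by case=> [i|i j]; [apply: finish_8 | apply: finish_pair].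
Qed.

Lemma finish_xs L x X : hub L -> (forall y, y \in x :: X -> xblock y) -> finish L (flatten (x :: X)).
Proof.
elim: X L x => [|y X IHX] L x hL hX.
  by rewrite /= cats0; apply: finish_x (hX _ (mem_head _ _)).
apply: finish_trans (gadget_x hL (hX _ (mem_head _ _))) _.
by apply: IHX => [|z zX]; [left | apply: hX; rewrite inE zX orbT].
Qed.

Lemma finish_66 b T : finish Lbase T -> finish Lbase (nseq b.*2 6 ++ T).
Proof.
move=> fT; elim: b => // b IHb; rewrite doubleS.
exact: finish_trans gadget_66 IHb.
Qed.

Lemma gadget_466 L : hub L -> gadget L [:: 4; 6; 6] Lbase.
Proof. by case=> ->; [apply: gadget_base_466 | apply: gadget_post_466]. Qed.

Lemma finish_466 L : hub L -> finish L [:: 4; 6; 6].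
Proof. by case=> ->; [apply: finish_base_466 | apply: finish_post_466]. Qed.

Lemma finish_4s a T : finish Lpost T -> finish Lfour (nseq a.+1 4 ++ T).
Proof.
move=> fT; elim: a => [|a IHa].
  by apply: finish_trans fT; apply: gadgetI run_4_post _ _.
rewrite -[nseq a.+2 4 ++ T]/([:: 4] ++ (nseq a.+1 4 ++ T)).
by apply: finish_trans IHa; apply: gadgetI run_44 _ _.
Qed.

(** Leading 4-cycles end in [Lpost], where the gadget for two 6-cycles does not start: a block or
    [[:: 4; 6; 6]] has to come between and leads to [Lbase]. Then the pairs of 6-cycles follow. The
    end must again be a block or [[:: 4; 6; 6]], as only these have a finish. Types with 4-cycles
    only or 6-cycles only offer neither and are separate cases. *)
Lemma ladder_types T : all good_len T -> 4 %| sumn T ->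
  [\/ T = nseq (size T) 4, exists b, T = nseq b.*2 6, finish Lbase T | finish Lfour T].
Proof.
move=> gT sT; have [a [b [X [p hX]]]] := lengths_blocks gT sT.
rewrite perm_sym in p.
have fours a' T' : finish Lbase T' -> finish Lpost T' ->
    perm_eq (nseq a' 4 ++ T') T -> finish Lbase T \/ finish Lfour T.
  case: a' => [|a'] f14 f19 pT; first by left; apply: finish_perm pT f14.
  by right; apply: finish_perm pT _; apply: finish_4s.
suff: (X = [::] /\ (a = 0 \/ b = 0)) \/ finish Lbase T \/ finish Lfour T.
  case=> [[X0 ab]|[]]; [|by constructor 3|by constructor 4].
  move: p; rewrite X0 cats0; case: ab => -> /=; last first.
    rewrite cats0 => p; constructor 1; apply/all_pred1P.
    by rewrite -(eq_all_r (perm_mem p)) all_pred1_nseq ?orbT.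
  move=> p; constructor 2; exists b; rewrite -{1}(size_nseq b.*2 6) (perm_size p).
  by apply/all_pred1P; rewrite -(eq_all_r (perm_mem p)) all_pred1_nseq ?orbT.
case: X p hX => [|x X] p hX.
  rewrite /= cats0 in p.
  case: b p => [|b] p; first by left; split=> //; right.
  case: a p => [|a] p; first by left; split=> //; left.
  right; case: b p => [|b] p.
    apply: (fours a [:: 4; 6; 6]); [exact: finish_466 (or_introl erefl) | exact: finish_466 (or_intror erefl)|].
    apply: perm_trans p; apply/permP=> q.
    by rewrite -[nseq a.+1 4]/(4 :: nseq a 4) !count_cat /=; lia.
  case: a p => [|a] p.
    left; apply: finish_perm p _.
    apply: (@finish_perm _ (nseq b.+1.*2 6 ++ [:: 4; 6; 6])).
      by apply/permP=> q; rewrite !doubleS !count_cat /=; lia.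
    by apply: finish_66; apply: finish_466; left.
  apply: (fours a ([:: 4; 6; 6] ++ nseq b.*2 6 ++ [:: 4; 6; 6])).
  - apply: finish_trans (gadget_466 (or_introl erefl)) _.
    by apply: finish_66; apply: finish_466; left.
  - apply: finish_trans (gadget_466 (or_intror erefl)) _.
    by apply: finish_66; apply: finish_466; left.
  - apply: perm_trans p; apply/permP=> q.
    by rewrite !doubleS -[nseq a.+2 4]/(4 :: 4 :: nseq a 4) /= !count_cat /= count_cat /=; lia.
right; case: b p => [|b] p.
  apply: (fours a (flatten (x :: X))) => //; apply: finish_xs => //; [by left | by right].
case: a p => [|a] p.
  by left; apply: finish_perm p _; apply: finish_66; apply: finish_xs => //; left.
apply: (fours a ([:: 4; 6; 6] ++ nseq b.*2 6 ++ flatten (x :: X))).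
- apply: finish_trans (gadget_466 (or_introl erefl)) _.
  by apply: finish_66; apply: finish_xs => //; left.
- apply: finish_trans (gadget_466 (or_intror erefl)) _.
  by apply: finish_66; apply: finish_xs => //; left.
- apply: perm_trans p; apply/permP=> q.
  by rewrite !doubleS -[nseq a.+1 4]/(4 :: nseq a 4) !count_cat /= ?count_cat; lia.
Qed.

(** * The ladder inside the graph on the columns *)

Lemma packs_of_points (V : finType) (pt : eqType) (psi : V -> pt) G Ts
    (css : seq (seq (seq pt))) : injective psi ->
  all2 (fun T cs => perm_eq (map size cs) T) Ts css -> all (all (leq 2)) Ts ->
  all (fun cs => perm_eq (flatten cs) (map psi (enum V))) css ->
  (forall u v, \sum_(c <- flatten css) closed_mult c (psi u) (psi v) <= G u v) ->
  packs G Ts.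
Proof.
move=> psi_inj lens T2 cov le.
have pre (s : seq pt) : {subset s <= map psi (enum V)} -> exists w, map psi w = s.
  elim: s => [|x s IHs] sub; first by exists [::].
  have /mapP[u _ ->] := sub x (mem_head _ _).
  have [|w <-] := IHs; last by exists (u :: w).
  by move=> y ys; apply: sub; rewrite inE ys orbT.
have [Fs eF] : exists Fs, css = map (map (map psi)) Fs.
  elim: css cov {lens le} => [|cs css IHcss] /=; first by exists [::].
  case/andP=> pcs /IHcss[Fs ->].
  have : {subset flatten cs <= map psi (enum V)} by move=> x; rewrite (perm_mem pcs).
  suff H : {subset flatten cs <= map psi (enum V)} -> exists F, cs = map (map psi) F.
    by case/H=> F ->; exists (F :: Fs).
  elim: cs {pcs} => [|c cs IHcs] sub; first by exists [::].
  have [w ew] : exists w, map psi w = c by apply: pre => x xc; apply: sub; rewrite /= mem_cat xc.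
  have [|F ->] := IHcs; last by exists (w :: F); rewrite /= ew.
  by move=> x xc; apply: sub; rewrite /= mem_cat xc orbT.
exists Fs; split; last first.
  move=> u v; apply: leq_trans (le u v); rewrite eF -map_flatten big_map.
  by apply: leq_sum => c _; rewrite closed_mult_map.
move: lens T2 cov; rewrite {}eF {le css}; elim: Ts Fs => [|T Ts IHT] [|F Fs] //=.
case/andP=> pT lens /andP[T2 Ts2] /andP[pc cov]; rewrite IHT // andbT.
have szF : map size (map (map psi) F) = map size F.
  by rewrite -map_comp; apply: eq_map => c; rewrite /= size_map.
rewrite szF in pT; apply/and3P; split=> //.
  by rewrite -map_flatten in pc; apply: perm_map_inj pc.
by rewrite -(all_map size (leq 2)) (eq_all_r (perm_mem pT)).
Qed.

(* Column edges of the complete graph on Z_N and infinity, by the sum of their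
   ends ([infinity] counting as the other end). *)
Definition edge_class (N : nat) (a b : option nat) : nat :=
  match a, b with
  | Some a, Some b => (a + b) %% N
  | Some a, None | None, Some a => (2 * a) %% N
  | None, None => N
  end.

Lemma edge_classC N a b : edge_class N a b = edge_class N b a.
Proof. by case: a b => [a|] [b|] //=; rewrite addnC. Qed.

Definition col (N : nat) (u : option 'I_N * bool) : option nat :=
  omap (@nat_of_ord N) u.1.

Section Ladder.
Variable k : nat.
Hypothesis k_gt0 : 0 < k.
Let N := k.*2.+1.
Notation V := (option 'I_N * bool)%type.

(* Layer [j] carries the columns [j] and [-j]; layer [0] carries the columns
   [0] and infinity. *)
Definition lad_pt (u : V) : nat * nat :=
  match u.1 with
  | None => (0, 4 + u.2)
  | Some c => if c == 0 :> nat then (0, u.2 : nat)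
              else if c <= k then (c : nat, u.2 : nat) else (N - c, 2 + u.2)
  end.

Definition lad_col (x : nat * nat) : option nat :=
  if x.1 == 0 then (if x.2 < 2 then Some 0 else None)
  else Some (if x.2 < 2 then x.1 else N - x.1).

Lemma lad_ptK u : lad_col (lad_pt u) = col u /\ odd (lad_pt u).2 = u.2.
Proof.
case: u => [[c|] b]; rewrite /lad_pt /lad_col /col /=; last by case: b.
have cN := ltn_ord c; have [c0|c0] /= := eqVneq (c : nat) 0; first by rewrite c0; case: b.
have [ck|ck] /= := leqP c k; first by rewrite (negPf c0); case: b.
rewrite (_ : (N - c == 0) = false); last by apply/eqP; lia.
by rewrite (_ : N - (N - c) = c); [case: b | lia].
Qed.

Lemma lad_pt_inj : injective lad_pt.
Proof.
move=> u v e; have [cu bu] := lad_ptK u; have [cv bv] := lad_ptK v.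
rewrite e in cu bu; rewrite {}cu in cv; rewrite {}bu in bv.
case: u v bv cv {e} => [[c|] b] [[d|] b'] //= -> //= [e].
by congr (Some _, _); apply: val_inj.
Qed.

(** Column edges, and the three column matchings with sums 0, 1 and -1. *)
Definition lad_graph (x y : nat * nat) : bool :=
  (x != y) && ((lad_col x == lad_col y) ||
    (edge_class N (lad_col x) (lad_col y) \in [:: 0; 1; N.-1])).

Lemma lad_graphC x y : lad_graph x y = lad_graph y x.
Proof. by rewrite /lad_graph eq_sym (eq_sym (lad_col x)) edge_classC. Qed.

Definition lad_pts : seq (nat * nat) :=
  [:: (0, 0); (0, 1); (0, 4); (0, 5)] ++ layers 4 0 k.

Lemma lad_pts_perm : perm_eq lad_pts (map lad_pt (enum {: V})).
Proof.
rewrite perm_sym; have un : uniq (map lad_pt (enum {: V})).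
  by rewrite map_inj_uniq ?enum_uniq //; apply: lad_pt_inj.
have sub : {subset map lad_pt (enum {: V}) <= lad_pts}.
  move=> _ /mapP[[[c|] b] _ ->]; rewrite /lad_pts mem_cat /lad_pt /=; last by case: b.
  have cN := ltn_ord c; have [c0|c0] := eqVneq (c : nat) 0; first by case: b.
  by have [ck|ck] := leqP c k; apply/orP; right; apply/allpairsP;
    [exists (c : nat, b : nat) | exists (N - c, 2 + b)]; rewrite /= mem_iota; split=> //;
    case: b => //; lia.
have sz : size lad_pts <= size (map lad_pt (enum {: V})).
  rewrite size_map -cardE card_prod card_option card_ord card_bool size_cat /=.
  by rewrite size_allpairs !size_iota /N; lia.
have [_ eqm] := uniq_min_size un sub sz.
by apply: uniq_perm => //; apply: leq_size_uniq un sub sz.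
Qed.

Lemma lad_graph_sub u v : lad_graph (lad_pt u) (lad_pt v) =
  (u != v) && ((u.1 == v.1) || (edge_class N (col u) (col v) \in [:: 0; 1; N.-1])).
Proof.
rewrite /lad_graph (inj_eq lad_pt_inj); have [-> _] := lad_ptK u; have [-> _] := lad_ptK v.
congr (_ && (_ || _)); rewrite /col; case: u v => [[c|] b] [[d|] b'] //=.
Qed.

(** Column 0 lies on both sides of the ladder. The positions 2 and 3 are twisted against 0 and 1, so
    that [Lbase] and [Lfour] both describe the starting paths [lad_st0]. *)
Definition lad_g (p : nat) : nat := nth 0 [:: 0; 1; 1; 0] p.
Definition lad_cov0 : seq (seq (nat * nat)) := [:: [::]; [:: (0, 0); (0, 1)]; [:: (0, 1); (0, 0)]].
Definition lad_st0 : state (nat * nat)%type :=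
  [:: ([::], [::]); ([::], [:: [:: (0, 0)]; [:: (0, 1)]]); ([::], [:: [:: (0, 1)]; [:: (0, 0)]])].
Definition no_edge (x y : nat * nat) := False.

Lemma lad_g_inj p q v : lad_cross p v -> lad_cross q v -> lad_g p = lad_g q -> p = q.
Proof.
by move=> /and3P[p4 v4 pv] /and3P[q4 _ qv]; move: p4 q4 v4 pv qv;
  case: p => [|[|[|[|p]]]] //; case: q => [|[|[|[|q]]]] //; case: v => [|[|[|[|v]]]].
Qed.

Lemma lad_inner_sym v w : lad_inner v w = lad_inner w v.
Proof. by rewrite /lad_inner eq_sym andbCA. Qed.

(** The positions 4 and 5 are infinity. It is joined to the columns [k] and [-k] of the last layer
    because their doubles are -1 and 1 modulo [2 * k + 1], and to column 0 because of the double
    0. *)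
Definition end_cross (p v : nat) := (p < 4) && (4 <= v < 6).
Definition end_inner (v w : nat) := [&& v \in [:: 0; 1; 4; 5], w \in [:: 0; 1; 4; 5] & v != w].

Lemma end_cross_new p v : end_cross p v -> forall q w, lad_cross q w -> lad_g q <> v.
Proof.
move=> /andP[_ /andP[v4 _]] q w /and3P[q4 _ _] gv; move: v4; rewrite -gv.
by case: q q4 {gv} => [|[|[|[|q]]]].
Qed.

Lemma drawn_lad_graph start x y :
  (forall x y, start x y -> lad_graph x y) ->
  drawn lad_cross lad_inner lad_g start k x y -> lad_graph x y.
Proof.
move=> hs [/hs //|[b [n1 [n2 [bk ok /edge_multP h]]]]].
suff H : lad_graph (node_pt (pos lad_g b) (pos lad_g b.+1) n1) (node_pt (pos lad_g b) (pos lad_g b.+1) n2).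
  by case: h => -[<- <-] //; rewrite lad_graphC.
have rail p v : lad_cross p v -> lad_graph (pos lad_g b p) (b.+1, v).
  move=> /and3P[p4 v4 pv]; rewrite /lad_graph; apply/andP; split.
    by apply: contraTneq (leqnn b.+1) => /(congr1 fst); rewrite pos_layer /=; lia.
  have -> : lad_col (pos lad_g b p) = Some (if (p < 2) || (b == 0) then b else N - b).
    case: (b) => [|b'] /=; last by rewrite orbF /lad_col /=; case: ifP.
    by rewrite orbT; case: (p) p4 => [|[|[|[|]]]].
  rewrite /lad_col /= !inE; apply/orP; right.
  have Nb : b.+1 < N by rewrite /N; lia.
  have [v2|v2] := ltnP v 2.
    have p2 : (p < 2) = false by apply/negP; move: p4 v4 pv; case: (p) => [|[|]] //; case: (v) v2 => [|[|]].
    rewrite p2 /=; apply/or3P; constructor 2.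
    case: ifP => /eqP b0; first by rewrite b0 modn_small // /N; lia.
    rewrite (_ : N - b + b.+1 = N + 1); last lia.
    by rewrite modnDl modn_small // /N; lia.
  have p2 : p < 2 by move: p4 v4 pv; case: (p) => [|[|[|[|]]]] //; case: (v) v2 => [|[|[|[|]]]].
  rewrite p2 /=; apply/or3P; constructor 3.
  by rewrite (_ : b + (N - b.+1) = N.-1); [rewrite modn_small // /N; lia | lia].
case: n1 n2 ok {h} => [[] p] [[] v]; rewrite /layer_edge /node_pt //= => ok.
- move: ok => /and3P[p4 v4 pv]; rewrite /lad_graph /lad_col /= xpair_eqE eqxx pv /=.
  have Nb : b.+1 < N by rewrite /N; lia.
  rewrite !inE; case: ifP => _; case: ifP => _; rewrite ?eqxx //; apply/orP; right.
    by rewrite (_ : b.+1 + (N - b.+1) = N); [rewrite modnn | lia].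
  by rewrite (_ : N - b.+1 + b.+1 = N); [rewrite modnn | lia].
- by rewrite lad_graphC; apply: rail.
- exact: rail.
Qed.

Lemma end_lad_graph x y (end_in : rel nat) :
  (forall v w, end_in v w -> end_inner v w) ->
  (exists n1 n2, layer_edge end_cross end_in n1 n2 /\
    0 < edge_mult (node_pt (pair k) (pair 0) n1) (node_pt (pair k) (pair 0) n2) x y) ->
  lad_graph x y.
Proof.
move=> sub [n1 [n2 [ok /edge_multP h]]].
suff H : lad_graph (node_pt (pair k) (pair 0) n1) (node_pt (pair k) (pair 0) n2).
  by case: h => -[<- <-] //; rewrite lad_graphC.
have rail p v : end_cross p v -> lad_graph (k, p) (0, v).
  move=> /andP[p4 /andP[v4 v6]]; rewrite /lad_graph /lad_col /= xpair_eqE (negPf (lt0n_neq0 k_gt0)).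
  rewrite (_ : v < 2 = false) /=; last by apply/negbTE; rewrite -leqNgt; lia.
  rewrite !inE; case: ifP => _; apply/orP; right.
    by rewrite modn_small; rewrite /N; lia.
  rewrite (_ : 2 * (N - k) = N + 1); last by rewrite /N; lia.
  by rewrite modnDl modn_small // /N; lia.
case: n1 n2 ok {h} => [[] p] [[] v]; rewrite /layer_edge /node_pt //= => ok.
- move: (sub _ _ ok) => /and3P[p4 v4 pv]; rewrite /lad_graph /lad_col /= xpair_eqE pv !inE.
  by move: p4 v4; rewrite !inE => /or4P[] /eqP-> /or4P[] /eqP->; rewrite /= ?mod0n ?eqxx ?orbT.
- by rewrite lad_graphC; apply: rail.
- exact: rail.
Qed.

Lemma lad_cover cov0 news (css : seq (seq (seq (nat * nat)%type))) :
  all (perm_eq^~ [:: (0, 0); (0, 1); (0, 4); (0, 5)]) (catl cov0 (map (map (pair 0)) news)) ->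
  all2 (fun c cs => perm_eq (flatten cs) c)
    (catl [seq c ++ layers 4 0 k | c <- cov0] (map (map (pair 0)) news)) css ->
  all (fun cs => perm_eq (flatten cs) lad_pts) css.
Proof.
elim: cov0 news css => [|c cov0 IHc] [|ns news] [|cs css] //= /andP[p ps] /andP[q qs].
rewrite (IHc news) // andbT; apply: perm_trans q _.
rewrite -catA (permPl (permEl (perm_catCA _ _ _))) (permPl (permEl (perm_catC _ _))).
by rewrite perm_cat2r.
Qed.

Lemma lad_packs L start st0 cov0 C L' T t news (end_in : rel nat) :
  (forall x y, start x y -> start y x) ->
  (forall x y, start x y -> x.1 = 0 /\ y.1 = 0) ->
  (forall x y, start x y -> lad_graph x y) ->
  (forall v w, end_in v w -> end_inner v w) ->
  (forall v w, end_in v w -> ~ start (0, v) (0, w)) ->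
  size L = 3 -> size cov0 = 3 ->
  realized lad_cross lad_inner lad_g start L 0 E3 cov0 st0 ->
  lrun L k C L' ->
  tile_ok (layer_edge end_cross end_in) news L' t -> all (@nilp _) (tile_dst L' t) ->
  all (perm_eq^~ [:: (0, 0); (0, 1); (0, 4); (0, 5)]) (catl cov0 (map (map (pair 0)) news)) ->
  all (perm_eq T) (catl (tile_closed L' t) C) -> all (leq 2) T ->
  packs (fun u v : V => lad_graph (lad_pt u) (lad_pt v) : nat) [:: T; T; T].
Proof.
move=> ssym s0 sG esub enew szL szc real r tok nil cov pT T2.
have [szL' szC] := run_size r.
have [||st' real'] := run_realized ssym s0 lad_g_inj lad_inner_sym r _ _ real; rewrite ?szL //.
rewrite add0n in real'.
have [css [lens covs le1 dr]] := fold_realized ssym s0 k_gt0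
  (fun p v h => or_intror (end_cross_new h)) enew real' tok nil.
apply: (packs_of_points (psi := lad_pt) (css := css)); first exact: lad_pt_inj.
- have /and5P[/eqP szt _ _ _ _] := tok.
  move: lens; rewrite catlA; set D := catl (tile_closed L' t) C in pT *.
  have : size D = 3 by rewrite /D size_catl szC szL /tile_closed size_map size_zip szt szL' szL.
  case: D pT => [|d0 [|d1 [|d2 [|]]]] //= /and4P[p0 p1 p2 _] _.
  case: (css) => [|c0 [|c1 [|c2 [|c3 css']]]]; rewrite /catl //= ?andbF // !cats0.
  case/and4P=> q0 q1 q2 _; rewrite perm_sym in p0; rewrite perm_sym in p1; rewrite perm_sym in p2.
  by rewrite (perm_trans q0 p0) (perm_trans q1 p1) (perm_trans q2 p2).
- by rewrite /= T2.
- apply: sub_all (lad_cover cov covs) => cs pcs; apply: perm_trans pcs _.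
  exact: lad_pts_perm.
move=> u v; have := le1 (lad_pt u) (lad_pt v).
case: (ltngtP 0 (\sum_(c <- flatten css) closed_mult c (lad_pt u) (lad_pt v))) => // [pos _|<- //].
suff -> : lad_graph (lad_pt u) (lad_pt v) by [].
by case: (dr _ _ pos) => [|h]; [apply: drawn_lad_graph | apply: end_lad_graph esub h].
Qed.

End Ladder.

(** In the closing tiles [F4] and [F5] are the vertices at infinity, [F0] and [F1] those of column
    0. The second and third factors contain column 0 from the start. *)
Definition end_ef : tile :=
  [:: ([:: [:: P0; F4; F0; F1; F5]], [::]); ([:: [:: P0; F5; F4]], [::]);
      ([:: [:: P0; F5; P1; F4]], [::])].

Definition end_4 : tile :=
  [:: ([:: [:: F0; F4; F1; F5]], [::]); ([:: [:: P0; F4; P1; F5]], [::]);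
      ([:: [:: P0; F4; P1; F5]], [::])].

Definition end_k : tile :=
  [:: ([:: [:: P0; F4; F1; F0; F5]], [::]); ([::], [::]); ([:: [:: P0; F5; P1; F4]], [::])].

Lemma realized_start L : L = Lbase \/ L = Lfour ->
  realized lad_cross lad_inner lad_g no_edge L 0 E3 lad_cov0 lad_st0.
Proof.
move=> hL; have m0 x y : state_mult lad_st0 x y = 0.
  by rewrite /state_mult !big_cons !big_nil !path_mult1.
by split=> [||x y|x y]; rewrite ?m0 //; case: hL => ->.
Qed.

Definition ladder_packs k T := packs (fun u v : option 'I_k.*2.+1 * bool =>
  lad_graph k (lad_pt u) (lad_pt v) : nat) [:: T; T; T].

Lemma packs_sumn (V : finType) (G : V -> V -> nat) T Ts : packs G (T :: Ts) -> sumn T = #|V|.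
Proof.
case=> [[|cs Fs]] [//= /andP[/and3P[p _ pT] _] _].
by rewrite -(perm_sumn pT) -size_flatten (perm_size p) -cardE.
Qed.

Lemma finish_packs L T : L = Lbase \/ L = Lfour -> all (leq 2) T -> finish L T ->
  exists k, 0 < k /\ ladder_packs k T.
Proof.
move=> hL T2 [n [C [x [z [w [e r c]]]]]]; exists n.+1; split=> //.
have szL : size L = 3 by case: hL => ->.
have [_ szC] := run_size r.
apply: (@lad_packs n.+1 _ L no_edge lad_st0 lad_cov0 C (LEF x (x + 2) z w) T end_ef
  [:: [:: 4; 0; 1; 5]; [:: 5; 4]; [:: 5; 4]] end_inner) => //.
- by move=> v w' _ [].
- exact: realized_start.
- have -> : tile_closed (LEF x (x + 2) z w) end_ef = [:: [:: x + 4]; [:: x + 4]; [:: x + 4]].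
    by rewrite /tile_closed /word_len /=; repeat (f_equal; try lia).
  by case: C szC c {r} => [|c0 [|c1 [|c2 [|]]]] //=; rewrite szL.
Qed.

Lemma fours_packs k : 0 < k -> ladder_packs k (nseq k.+1 4).
Proof.
move=> k0; have r : lrun Lfour k [:: nseq k 4; nseq k 4; nseq k 4] Lfour.
  elim: (k) => [|j IHj]; first exact: RunNil.
  by have := run_trans IHj run_44; rewrite addn1.
apply: (@lad_packs k _ Lfour no_edge lad_st0 lad_cov0 _ Lfour _ end_4
  [:: [:: 0; 4; 1; 5]; [:: 4; 5]; [:: 4; 5]] end_inner) r _ _ _ _ _ => //.
- by move=> v w' _ [].
- by apply: realized_start; right.
- by rewrite /catl /= !perm_refl.
- by elim: (k).
Qed.

(** In [LK] the second factor starts with a path through infinity. The closing tile must not use its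
    three edges again, hence the restricted [k_inner]. *)
Definition k_start (x y : nat * nat) : Prop :=
  0 < path_mult [:: (0, 0); (0, 4); (0, 5); (0, 1)] x y.

Definition k_inner (v w : nat) : bool :=
  (v, w) \in [:: (4, 1); (1, 4); (1, 0); (0, 1); (0, 5); (5, 0)].

Lemma sixes_packs b : exists k, 0 < k /\ ladder_packs k (nseq b.+1.*2 6).
Proof.
pose st0 : state (nat * nat)%type := [:: ([::], [::]);
  ([::], [:: [:: (0, 0); (0, 4); (0, 5); (0, 1)]]); ([::], [:: [:: (0, 1)]; [:: (0, 0)]])].
pose cov0 : seq (seq (nat * nat)) := [:: [::]; [:: (0, 0); (0, 4); (0, 5); (0, 1)]; [:: (0, 1); (0, 0)]].
have r : lrun LK (3 * b) [:: nseq b.*2 6; nseq b.*2 6; nseq b.*2 6] LK.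
  elim: (b) => [|j IHj]; first exact: RunNil.
  by have := run_trans IHj run_k66; rewrite mulnS addnC doubleS.
have {}r := run_trans r run_k66_end.
(* The [12 * b.+1] vertices fill [3 * b + 2] layers of four, besides the four vertices in layer
   0. *)
exists (3 * b + 2); split; first lia.
have m0 x y : state_mult st0 x y = path_mult [:: (0, 0); (0, 4); (0, 5); (0, 1)] x y.
  by rewrite /state_mult !big_cons !big_nil /= !path_mult1 !addn0.
have pE x y : path_mult [:: (0, 0); (0, 4); (0, 5); (0, 1)] x y =
    edge_mult (0, 0) (0, 4) x y + edge_mult (0, 4) (0, 5) x y + edge_mult (0, 5) (0, 1) x y.
  by rewrite !path_mult_cons path_mult1 addn0 addnA.
have sP x y : k_start x y -> exists e, [/\ e \in [:: (0, 4); (4, 5); (5, 1)] &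
    (x, y) = ((0, e.1), (0, e.2)) \/ (y, x) = ((0, e.1), (0, e.2))].
  rewrite /k_start pE -/(is_true _) !addn_gt0 => /orP[/orP[]|] /edge_multP h;
  [exists (0, 4) | exists (4, 5) | exists (5, 1)]; split=> //;
  by case: h => -[<- <-]; [left | right].
refine (@lad_packs (3 * b + 2) _ LK k_start st0 cov0 _ LK' _ end_k
  [:: [:: 4; 1; 0; 5]; [::]; [:: 5; 4]] k_inner _ _ _ _ _ _ _ _ r _ _ _ _ _) => //.
- by rewrite addn2.
- by move=> x y; rewrite /k_start !pE !(edge_mult_sym _ _ x y).
- by move=> x y /sP[[e1 e2] [_ [[-> ->]|[-> ->]]]].
- move=> x y /sP[e [ein h]].
  suff H : lad_graph (3 * b + 2) (0, e.1) (0, e.2).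
    by case: h => -[-> ->] //; rewrite lad_graphC.
  by move: ein; rewrite !inE => /or3P[] /eqP->; rewrite /lad_graph /lad_col /= ?inE ?muln0 ?mod0n.
- by move=> v w; rewrite /k_inner !inE => /or4P[/eqP[-> ->]|/eqP[-> ->]|/eqP[-> ->]|/or3P[] /eqP[-> ->]].
- by move=> v w; rewrite /k_inner !inE /k_start => /or4P[/eqP[-> ->]|/eqP[-> ->]|/eqP[-> ->]|/or3P[] /eqP[-> ->]];
  rewrite pE.
- split=> // x y; rewrite m0; last by left.
  rewrite pE /edge_mult; case: x y => [x1 x2] [y1 y2].
  have [/orP[]/eqP[<- <- <- <-] //|_] := boolP ((_ == _) || _).
  have [/orP[]/eqP[<- <- <- <-] //|_] := boolP ((_ == _) || _).
  exact: leq_b1.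
- rewrite doubleS; set l := nseq _ _; change (all (perm_eq l) [:: l; l; l]).
  by apply/allP=> l'; rewrite !inE => /or3P[] /eqP->; apply: perm_refl.
- by elim: (b) => //= j IHj; rewrite doubleS.
Qed.

Lemma lad_triple k T : 0 < k -> all good_len T -> sumn T = 4 * k.+1 -> ladder_packs k T.
Proof.
move=> k0 gT sT.
have T2 : all (leq 2) T by apply: sub_all gT => x /andP[_]; apply: leq_trans.
(* The number of layers produced by the gadgets is determined by the number of vertices. *)
have fin k' T' : 0 < k' -> sumn T' = 4 * k.+1 -> ladder_packs k' T' -> ladder_packs k T'.
  move=> k'0 sT' p; have := packs_sumn p.
  rewrite sT' card_prod card_option card_ord card_bool => e.
  by have <- : k' = k by lia.
have d4 : 4 %| sumn T by rewrite sT dvdn_mulr.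
case: (ladder_types gT d4) => [Te|[[|b] Te]|f|f].
- have sz : size T = k.+1 by have := congr1 sumn Te; rewrite sT sumn_nseq; lia.
  by rewrite Te sz; apply: fours_packs.
- by move: sT; rewrite Te.
- by have [k' [k'0 p]] := sixes_packs b; apply: (fin k') => //; rewrite Te.
- by have [|k' [k'0 p]] := finish_packs _ T2 f; [left | apply: (fin k')].
- by have [|k' [k'0 p]] := finish_packs _ T2 f; [right | apply: (fin k')].
Qed.

(** * Pairs of 2-factors on a blown-up Hamilton cycle *)

Definition hag_cross (p v : nat) := (p < 2) && (v < 2).
Definition no_inner (v w : nat) := false.
Local Notation hrun := (run hag_cross no_inner 2).

Definition HA : layout := [:: [:: (1, 1, 1)]; [:: (0, 0, 1)]].
Definition HB x : layout := [:: [:: (0, 1, x)]; [:: (0, 1, x)]].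

(** Each factor takes two of the four edges between consecutive columns. From [HB], traversing the
    path backwards in the second factor selects the complementary two. *)
Definition hag_ext : tile :=
  [:: ([::], [:: [:: Fresh 0; Strand 0 false; Fresh 1]]);
      ([::], [:: [:: Fresh 0; Strand 0 true; Fresh 1]])].
Definition hag_close : tile :=
  [:: ([:: [:: Strand 0 false; Fresh 0]], [:: [:: Fresh 1]]);
      ([:: [:: Strand 0 false; Fresh 1]], [:: [:: Fresh 0]])].
Definition hag_end : tile :=
  [:: ([:: [:: Strand 0 false; Fresh 0]], [::]); ([:: [:: Strand 0 false; Fresh 1]], [::])].

Lemma hag_ext_run x j n C L : hrun (HB (x + j.*2)) n C L -> hrun (HB x) (j + n) (catl C [:: [::]; [::]]) L.
Proof.
have catl0 (D : seq (seq nat)) M m M' : hrun M m D M' -> size M = 2 -> catl D [:: [::]; [::]] = D.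
  move=> r sM; have : size D = 2.
    elim: r sM => {M m D M'} [M|M t m D M' /and5P[/eqP szt _ _ _ _] _ IH] sM.
      by rewrite size_nseq.
    by rewrite size_catl IH // size_map size_zip szt sM.
  by case: D {r} => [|a [|b [|]]] //; rewrite /catl /= !cats0.
elim: j x => [|j IHj] x r; first by rewrite addn0 in r; rewrite (catl0 _ _ _ _ r).
rewrite addSn; apply: (@RunCons _ _ _ _ hag_ext) => //.
have -> : tile_dst (HB x) hag_ext = HB (x + 2).
  by rewrite /tile_dst /word_strand /word_len /HB /=; repeat (f_equal; try lia).
have {}r : hrun (HB (x + 2 + j.*2)) n C L by congr (hrun _ _ _ _) : r; f_equal; lia.
have := IHj _ r.
by rewrite (catl0 _ _ _ _ r).
Qed.

(** A cycle starts with one vertex, every extension adds two and the closing tile the last one. The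
    cycle of length [x] is left open with one vertex missing, which will be the second vertex at
    infinity. *)
Lemma hag_runs T x : all good_len T -> good_len x -> exists n C, [/\ size C = 2,
  hrun HA n C (HB x.-1), all (perm_eq T) C & 2 * n.+1 = sumn T + x].
Proof.
have first_ext y n C L : good_len y -> hrun (HB y.-1) n C L -> size C = 2 ->
    hrun HA (y./2.-1 + n) C L.
  move=> /andP[oy y4] r szC.
  have catl0 (D : seq (seq nat)) : size D = 2 -> catl D [:: [::]; [::]] = D.
    by case: D => [|a [|b [|]]] //; rewrite /catl /= !cats0.
  rewrite (_ : y./2.-1 + n = (y./2.-2 + n).+1); last lia.
  rewrite -(catl0 C) //; apply: (@RunCons _ _ _ _ hag_ext) => //.
  have -> : tile_dst HA hag_ext = HB 3 by [].
  rewrite -(catl0 C) //; apply: hag_ext_run.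
  by congr (hrun _ _ _ _) : r; f_equal; lia.
elim: T => [|y T IHT] gT gx.
  exists (x./2.-1 + 0), [:: [::]; [::]]; split=> //.
    by apply: first_ext => //; apply: RunNil.
  by move: gx => /andP[ox x4] /=; lia.
case/andP: gT => gy /IHT/(_ gx)[n [C [szC r pC e]]].
have y4 : 4 <= y by case/andP: gy.
exists (y./2.-1 + n.+1), (catl C [:: [:: y]; [:: y]]); split.
- by rewrite size_catl szC.
- apply: first_ext; rewrite ?size_catl ?szC //.
  have <- : tile_closed (HB y.-1) hag_close = [:: [:: y]; [:: y]].
    by rewrite /tile_closed /word_len /=; repeat (f_equal; try lia).
  exact: RunCons.
- case: C szC pC {r} => [|a [|b [|]]] //= _ /and3P[pa pb _].
  rewrite /catl /= andbT; apply/andP; split; rewrite perm_sym perm_catC /= perm_cons perm_sym //.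
- by move: gy => /andP[oy _] /=; lia.
Qed.

(** * Zigzag Hamilton cycles through the columns *)

Section Zigzag.
Variables (N i : nat).
Hypothesis N_gt1 : 1 < N.
Hypothesis iN : 2 * i + 1 < N.
Notation V := (option 'I_N * bool)%type.

(* The Hamilton cycle infinity, i, i + 1, i - 1, i + 2, ...: consecutive columns
   have sums 2i and 2i + 1. *)
Definition zig (j : nat) : nat := if odd j then j./2.+1 else (N - j./2) %% N.
Definition zag (d : nat) : nat := if (0 < d) && (d <= N./2) then d.*2.-1 else ((N - d) %% N).*2.

Lemma zigK d : d < N -> zig (zag d) = d /\ zag d < N.
Proof.
move=> dN; rewrite /zag /zig; have [/andP[d0 dN2]|] := boolP ((0 < d) && (d <= N./2)).
  case: d dN d0 dN2 => // d dN _ dN2; rewrite doubleS /= odd_double uphalf_double /=.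
  by split; lia.
have [->|d0] := posnP d; first by rewrite subn0 modnn /= subn0 modnn; split; lia.
move=> dN2; have {}dN2 : N./2 < d by rewrite ltnNge.
rewrite odd_double doubleK (modn_small (_ : N - d < N)); last lia.
by rewrite (_ : N - (N - d) = d) ?modn_small //; lia.
Qed.

(** The layer of a column is its place on the Hamilton cycle, with infinity in layer 0; adding
    [N - i] undoes the shift by [i]. *)
Definition hag_pt (u : V) : nat * nat :=
  if u.1 is Some c then ((zag ((c + (N - i)) %% N)).+1, u.2 : nat) else (0, u.2 : nat).

Definition hag_col (x : nat * nat) : option nat :=
  if x.1 is j.+1 then Some ((zig j + i) %% N) else None.

Lemma hag_ptK u : hag_col (hag_pt u) = col u /\ odd (hag_pt u).2 = u.2.
Proof.
case: u => [[c|] b]; rewrite /hag_pt /hag_col /col /=; last by case: b.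
have cN := ltn_ord c; have N0 : 0 < N by lia.
have [-> _] := zigK (ltn_pmod (c + (N - i)) N0).
by rewrite modnDml -addnA subnK ?modnDr ?modn_small //; [case: b | lia].
Qed.

Lemma hag_pt_inj : injective hag_pt.
Proof.
move=> u v e; have [cu bu] := hag_ptK u; have [cv bv] := hag_ptK v.
rewrite e in cu bu; rewrite {}cu in cv; rewrite {}bu in bv.
case: u v bv cv {e} => [[c|] b] [[d|] b'] //= -> //= [e].
by congr (Some _, _); apply: val_inj.
Qed.

Definition hag_graph (x y : nat * nat) : bool :=
  (hag_col x != hag_col y) && ((edge_class N (hag_col x) (hag_col y))./2 == i).

Lemma hag_graphC x y : hag_graph x y = hag_graph y x.
Proof. by rewrite /hag_graph eq_sym edge_classC. Qed.

Definition hag_pts : seq (nat * nat) := [:: (0, 0); (0, 1)] ++ layers 2 0 N.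

Lemma hag_pts_perm : perm_eq hag_pts (map hag_pt (enum {: V})).
Proof.
rewrite perm_sym; have un : uniq (map hag_pt (enum {: V})).
  by rewrite map_inj_uniq ?enum_uniq //; apply: hag_pt_inj.
have sub : {subset map hag_pt (enum {: V}) <= hag_pts}.
  move=> _ /mapP[[[c|] b] _ ->]; rewrite /hag_pts mem_cat /hag_pt; last by case: b.
  have N0 : 0 < N by lia.
  have [_ zN] := zigK (ltn_pmod (c + (N - i)) N0).
  apply/orP; right; apply/allpairsP; exists ((zag ((c + (N - i)) %% N)).+1, b : nat).
  by rewrite mem_iota /=; split=> //; case: b.
have sz : size hag_pts <= size (map hag_pt (enum {: V})).
  rewrite size_map -cardE card_prod card_option card_ord card_bool size_cat /=.
  by rewrite size_allpairs !size_iota; lia.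
have [_ eqm] := uniq_min_size un sub sz.
by apply: uniq_perm => //; apply: leq_size_uniq un sub sz.
Qed.

(** The entry at an even place [j] is [- j./2] modulo [N]; the equation avoids the subtraction. *)
Lemma zig_mod j : j < N -> exists t, zig j + (if odd j then 0 else j./2) = (if odd j then j./2.+1 else 0) + N * t.
Proof.
move=> jN; rewrite /zig; case: ifP => _; first by exists 0; rewrite muln0.
have [->|j0] := posnP j./2; first by exists 0; rewrite subn0 modnn muln0.
by exists 1; rewrite modn_small ?muln1; lia.
Qed.

Lemma zig_class j : j.+1 < N ->
  ((zig j + i) %% N + (zig j.+1 + i) %% N) %% N = 2 * i + ~~ odd j.
Proof.
move=> jN; rewrite modnDm.
have [t et] := zig_mod (ltnW jN); have [t' et'] := zig_mod jN.
have e : zig j + i + (zig j.+1 + i) = 2 * i + ~~ odd j + N * (t + t').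
  by move: et et'; rewrite /= (mulnDr N) uphalf_half; case: (odd j) => /=; lia.
by rewrite e addnC mulnC modnMDl modn_small //; case: (odd j); lia.
Qed.

(** The edge that returns to infinity falls into one of the classes [2 * i] and [2 * i + 1] as well;
    the parity of [N] decides into which. *)
Lemma zig_last : (2 * ((zig N.-1 + i) %% N)) %% N = 2 * i + odd N.
Proof.
rewrite modnMmr.
have [|t et] := @zig_mod N.-1; first lia.
have oN : odd N.-1 = ~~ odd N by case: (N) N_gt1 => //= n _; rewrite negbK.
rewrite oN in et.
have e : 2 * (zig N.-1 + i) + N * (odd N) = 2 * i + odd N + N * (2 * t + ~~ odd N).
  move: et; rewrite (mulnDr N) (mulnCA N 2); have := odd_double_half N.-1; rewrite oN.
  by case: (odd N) => /=; lia.
have := congr1 (modn^~ N) e; rewrite /= -modnDmr modnMr addn0 => ->.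
by rewrite addnC mulnC modnMDl modn_small //; case: (odd N); lia.
Qed.

Lemma zig_first : zig 0 = 0. Proof. by rewrite /zig /= subn0 modnn. Qed.

Lemma drawn_hag_graph x y : drawn hag_cross no_inner id no_edge N x y -> hag_graph x y.
Proof.
move=> [[]|[b [n1 [n2 [bk ok /edge_multP h]]]]].
suff H : hag_graph (node_pt (pos id b) (pos id b.+1) n1) (node_pt (pos id b) (pos id b.+1) n2).
  by case: h => -[<- <-] //; rewrite hag_graphC.
have half c : (2 * i + nat_of_bool c)./2 = i by case: c; lia.
have rail p v : hag_graph (pos id b p) (b.+1, v).
  case: b bk {ok h} => [|b] bN; rewrite /hag_graph /hag_col /=.
    rewrite zig_first add0n (modn_small (_ : i < N)); last lia.
    by rewrite modn_small ?half //; [rewrite -[2 * i]addn0 (half false) | lia].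
  rewrite zig_class // half eqxx andbT; apply/eqP=> -[/eqP].
  have zN j : j < N -> zig j < N.
    by rewrite /zig => jN; case: ifP => oj; [move: oj; lia | rewrite ltn_pmod //; lia].
  rewrite eqn_modDr !modn_small ?zN ?(ltnW bN) // /zig /=.
  have [ob|eb] /= := boolP (odd b); first by rewrite modn_small; lia.
  have [b0|b0] := posnP b./2; first by rewrite b0 subn0 modnn; lia.
  by rewrite modn_small; lia.
case: n1 n2 ok {h} => [[] p] [[] v]; rewrite /layer_edge /node_pt //= => ok.
by rewrite hag_graphC; apply: rail.
Qed.

Lemma end_hag_graph x y :
  (exists n1 n2, layer_edge hag_cross no_inner n1 n2 /\
    0 < edge_mult (node_pt (pair N) (pair 0) n1) (node_pt (pair N) (pair 0) n2) x y) ->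
  hag_graph x y.
Proof.
move=> [n1 [n2 [ok /edge_multP h]]].
suff H : hag_graph (node_pt (pair N) (pair 0) n1) (node_pt (pair N) (pair 0) n2).
  by case: h => -[<- <-] //; rewrite hag_graphC.
have rail p v : hag_graph (N, p) (0, v).
  rewrite /hag_graph /hag_col /=; have := zig_last; case: (N) N_gt1 => //= n _ ->.
  by case: (~~ odd n); lia.
case: n1 n2 ok {h} => [[] p] [[] v]; rewrite /layer_edge /node_pt //= => ok.
by rewrite hag_graphC; apply: rail.
Qed.

Definition hag_st0 : state (nat * nat)%type := [:: ([::], [:: [:: (0, 1)]]); ([::], [:: [:: (0, 0)]])].
Definition hag_cov0 : seq (seq (nat * nat)) := [:: [:: (0, 1)]; [:: (0, 0)]].

Lemma hag_packs T x C : hrun HA N C (HB x) -> all (perm_eq T) (catl [:: [:: x.+1]; [:: x.+1]] C) ->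
  size C = 2 -> all (leq 2) T ->
  packs (fun u v : V => hag_graph (hag_pt u) (hag_pt v) : nat) [:: T; T].
Proof.
move=> r pT szC T2.
have g_inj p q v : hag_cross p v -> hag_cross q v -> id p = id q -> p = q by [].
have no_sym x' y' : no_edge x' y' -> no_edge y' x' by [].
have no0 x' y' : no_edge x' y' -> x'.1 = 0 /\ y'.1 = 0 by [].
have isym v w : no_inner v w = no_inner w v by [].
have real0 : realized hag_cross no_inner id no_edge HA 0 [:: [::]; [::]] hag_cov0 hag_st0.
  have m0 x' y' : state_mult hag_st0 x' y' = 0 by rewrite /state_mult !big_cons !big_nil !path_mult1.
  by split=> [||x' y'|x' y'] //; rewrite m0.
have [||st' real'] := run_realized no_sym no0 g_inj isym r _ _ real0 => //.
rewrite add0n in real'.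
have N0 : 0 < N by lia.
have crossN p v : hag_cross p v -> 1 < N \/ forall q w, hag_cross q w -> q <> v by left.
have tok : tile_ok (layer_edge hag_cross no_inner) [:: [:: 0]; [:: 1]] (HB x) hag_end by [].
have innerN v w : no_inner v w -> ~ no_edge (0, v) (0, w) by [].
have [css [lens covs le1 dr]] := fold_realized no_sym no0 N0 crossN innerN real' tok isT.
apply: (packs_of_points (psi := hag_pt) (css := css)); first exact: hag_pt_inj.
- move: lens; rewrite catlA.
  have -> : tile_closed (HB x) hag_end = [:: [:: x.+1]; [:: x.+1]].
    by rewrite /tile_closed /word_len /=; repeat (f_equal; try lia).
  case: C szC pT {r real'} => [|d0 [|d1 [|]]] //= _; rewrite andbT => /andP[p0 p1].
  case: (css) => [|c0 [|c1 [|c2 css']]]; rewrite /catl //= ?andbF // !cats0.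
  rewrite andbT => /andP[q0 q1]; rewrite perm_sym in p0; rewrite perm_sym in p1.
  by rewrite (perm_trans q0 p0) (perm_trans q1 p1).
- by rewrite /= T2.
- have hp : forall cs, perm_eq cs hag_pts -> perm_eq cs (map hag_pt (enum {: V})).
    by move=> cs p; apply: perm_trans p hag_pts_perm.
  move: covs; rewrite /hag_cov0 /catl /=; case: (css) => [|c0 [|c1 [|c2 css']]] //=; rewrite ?andbF // !andbT.
  case/andP=> q0 q1; apply/andP; split; apply: hp; [apply: perm_trans q0 _ | apply: perm_trans q1 _];
  by apply/permP=> q; rewrite /hag_pts -cat1s !count_cat /= ?addn0; lia.
move=> u v; have := le1 (hag_pt u) (hag_pt v).
case: (ltngtP 0 (\sum_(c <- flatten css) closed_mult c (hag_pt u) (hag_pt v))) => // [pos _|<- //].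
suff -> : hag_graph (hag_pt u) (hag_pt v) by [].
by case: (dr _ _ pos) => [|h]; [apply: drawn_hag_graph | apply: end_hag_graph h].
Qed.

Lemma hag_pair T : all good_len T -> sumn T = 2 * N.+1 ->
  packs (fun u v : V => (u.1 != v.1) && ((edge_class N (col u) (col v))./2 == i) : nat) [:: T; T].
Proof.
move=> gT sT.
have [T' [x [eT gT' gx]]] : exists T' x, [/\ T = rcons T' x, all good_len T' & good_len x].
  case/lastP: T gT sT => [//|T x]; rewrite all_rcons => /andP[gx gT] _.
  by exists T, x.
have [n [C [szC r pC e]]] := hag_runs gT' gx.
have nN : n = N by move: sT; rewrite eT sumn_rcons; lia.
rewrite {}nN in r.
have [|||Fs [fcs le]] := @hag_packs T x.-1 C r => //.
- have x0 : x.-1.+1 = x by case/andP: gx; lia.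
  rewrite x0; case: C szC pC {r} => [|d0 [|d1 [|]]] //= _; rewrite !andbT => /andP[p0 p1].
  have key d : perm_eq T' d -> perm_eq T (x :: d).
    by rewrite eT (permPl (permEl (perm_rcons _ _))) perm_cons.
  by rewrite !key.
- by apply: sub_all gT => y /andP[_]; apply: leq_trans.
- exists Fs; split=> // u v; apply: leq_trans (le u v) _; rewrite /hag_graph.
  have [-> _] := hag_ptK u; have [-> _] := hag_ptK v.
  suff -> : (col u != col v) = (u.1 != v.1) by [].
  by rewrite /col; case: u v => [[c|] b] [[d|] b'].
Qed.

End Zigzag.

(** * Packing mu K_n *)

Lemma packs_nil (V : finType) (G : V -> V -> nat) : packs G [::].
Proof. by exists [::]; split=> // u v; rewrite big_nil. Qed.

Lemma packs_mono (V : finType) (G H : V -> V -> nat) Ts :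
  (forall u v, G u v <= H u v) -> packs G Ts -> packs H Ts.
Proof. by move=> GH [Fs [fcs le]]; exists Fs; split=> // u v; apply: leq_trans (GH u v). Qed.

Lemma all2_cat2 (A B : Type) (r : A -> B -> bool) s1 s2 t1 t2 :
  all2 r s1 t1 -> all2 r s2 t2 -> all2 r (s1 ++ s2) (t1 ++ t2).
Proof. by elim: s1 t1 => [|a s1 IH] [|b t1] //= /andP[-> h] /(IH _ h). Qed.

Lemma packs_cat (V : finType) (G H : V -> V -> nat) Ts Ts' :
  packs G Ts -> packs H Ts' -> packs (fun u v => G u v + H u v) (Ts ++ Ts').
Proof.
move=> [Fs [fcs le]] [Fs' [fcs' le']]; exists (Fs ++ Fs'); split; first exact: all2_cat2.
by move=> u v; rewrite flatten_cat big_cat leq_add.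
Qed.

Lemma all2_map (I : eqType) (A B : Type) (r : A -> B -> bool) (f : I -> A) (g : I -> B) s :
  (forall i, i \in s -> r (f i) (g i)) -> all2 r (map f s) (map g s).
Proof.
elim: s => //= i s IHs h; rewrite h ?mem_head // IHs // => j js.
by apply: h; rewrite inE js orbT.
Qed.

Lemma packs_perm (V : finType) (G : V -> V -> nat) (Ts Ts' : seq (seq nat)) :
  perm_eq Ts Ts' -> packs G Ts -> packs G Ts'.
Proof.
rewrite perm_sym => /(perm_iotaP [::])[Is pI ->] [Fs [fcs le]].
have szF : size Fs = size Ts by move: fcs; rewrite all2E => /andP[/eqP].
exists [seq nth [::] Fs i | i <- Is]; split.
  apply: all2_map => i iI; have iT : i < size Ts by rewrite (perm_mem pI) mem_iota in iI.
  move: fcs; rewrite all2E => /andP[_] /(all_nthP ([::], [::]))/(_ i).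
  by rewrite size_zip szF minnn nth_zip //= => /(_ iT).
move=> u v; apply: leq_trans (le u v); rewrite !big_flatten big_map (perm_big _ pI) /=.
by rewrite -szF [X in _ <= X](big_nth [::]) /index_iota subn0.
Qed.

Lemma packs_bij (V V' : finType) (G : V -> V -> nat) (f : V -> V') (g : V' -> V) Ts :
  cancel f g -> cancel g f -> packs G Ts -> packs (fun u v => G (g u) (g v)) Ts.
Proof.
move=> fK gK [Fs [fcs le]]; exists (map (map (map f)) Fs); split; last first.
  move=> u v; apply: leq_trans (le (g u) (g v)); rewrite -map_flatten big_map.
  apply: leq_sum => c _; rewrite -{1}(gK u) -{1}(gK v) closed_mult_map //.
  exact: can_inj fK.
elim: Ts Fs fcs {le} => [|T Ts IHT] [|cs Fs] //= /andP[/and3P[p c2 pT] /IHT->]; rewrite andbT.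
apply/and3P; split.
- rewrite -map_flatten; apply: uniq_perm; rewrite ?enum_uniq //.
    by rewrite map_inj_uniq ?(perm_uniq p) ?enum_uniq //; apply: can_inj fK.
  by move=> v; rewrite mem_enum -[v]gK mem_map ?(perm_mem p) ?mem_enum //; apply: can_inj fK.
- by rewrite all_map; apply: sub_all c2 => c; rewrite /= size_map.
- by rewrite -map_comp (eq_map (_ : _ =1 size)) // => c; rewrite /= size_map.
Qed.

Lemma closed_mult_diag (V : eqType) (c : seq V) v : uniq c -> 2 <= size c -> closed_mult c v v = 0.
Proof.
have edge0 (a b : V) : a != b -> edge_mult a b v v = 0.
  rewrite /edge_mult !xpair_eqE orbb => ab; case: eqP => // av; case: eqP => // bv.
  by rewrite av bv eqxx in ab.
case: c => [|a [|b w]] // uc _; rewrite closed_multE edge0; last first.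
  by apply: contraTneq uc => /= <-; rewrite mem_last.
rewrite addn0; elim: w a b uc => [|d w IHw] a b uc.
  by rewrite path_mult_cons path_mult1 edge0 //; move: uc; rewrite /= inE => /andP[].
rewrite path_mult_cons IHw; last by case/andP: uc.
by rewrite edge0 //; apply: contraTneq uc => ->; rewrite /= mem_head.
Qed.

(** * Perfect matchings and the combination of copies *)

Definition matching (V : Type) (tau : V -> V) := involutive tau /\ forall v, tau v <> v.

Lemma matching_of (V : finType) (R : V -> V -> nat) :
  (forall u v, R u v = R v u) -> (forall v, R v v = 0) -> (forall v, \sum_u R v u = 1) ->
  exists tau, matching tau /\ forall u v, R u v = (tau u == v).
Proof.
move=> Rsym R0 R1.
have ex v : exists u, forall w, R v w = (u == w).
  have : 0 < \sum_u R v u by rewrite R1.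
  rewrite lt0n sum_nat_eq0 negb_forall => /existsP[u ru]; exists u => w.
  have := R1 v; rewrite (bigD1 u) //=.
  have [<-|uw] := eqVneq u w; first by move: ru; rewrite implyTb; lia.
  by rewrite (bigD1 w) 1?eq_sym //=; move: ru; rewrite implyTb; lia.
have [tau tP] := fin_all_exists ex; exists tau; split=> //; split=> [v|v tv].
  by apply/eqP; have := Rsym v (tau v); rewrite !tP eqxx; case: eqP.
by have := R0 v; rewrite tP tv eqxx.
Qed.

Lemma matching_enum (V : finType) (tau : V -> V) (x0 : V) : matching tau ->
  exists s, perm_eq s (enum V) /\
    forall j, j.*2.+1 < size s -> tau (nth x0 s j.*2) = nth x0 s j.*2.+1.
Proof.
move=> [tK tn].
suff H d (A : {set V}) : #|A| <= d -> (forall v, v \in A -> tau v \in A) ->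
    exists s, perm_eq s (enum A) /\
      forall j, j.*2.+1 < size s -> tau (nth x0 s j.*2) = nth x0 s j.*2.+1.
  have [|s [p h]] := H #|V| setT (max_card _); first by move=> v; rewrite !inE.
  by exists s; split=> //; apply: perm_trans p _; rewrite enum_setT -enumT.
elim: d A => [|d IHd] A.
  by rewrite leqn0 cards_eq0 => /eqP-> _; exists [::]; rewrite enum_set0.
have [->|[v vA]] := set_0Vmem A; first by move=> _ _; exists [::]; rewrite enum_set0.
move=> leA clA; have tA := clA v vA; have /eqP tv := tn v.
have [||s [p h]] := IHd (A :\ v :\ tau v).
- by move: leA; rewrite (cardsD1 v) vA (cardsD1 (tau v)) !inE tv tA; lia.
- move=> w; rewrite !inE => /and3P[wt wv wA]; rewrite clA // andbT.
  by rewrite (inj_eq (inv_inj tK)) wv /=; apply: contraNneq wt => <-; rewrite tK.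
exists [:: v, tau v & s]; split.
  apply: uniq_perm; rewrite ?enum_uniq //=.
    rewrite !inE !(perm_mem p) !mem_enum !inE !eqxx /= andbF orbF eq_sym tv.
    by rewrite (perm_uniq p) enum_uniq.
  move=> w; rewrite !inE (perm_mem p) !mem_enum !inE.
  by case: eqP => [->|_]; [rewrite vA | case: eqP => [->|_]; rewrite ?tA].
by case=> [|j] //=; rewrite doubleS !ltnS => jl; apply: h.
Qed.

(** Both sets are enumerated with matched vertices at the positions [2j] and [2j + 1]; sending each
    position to the same position conjugates the matchings. *)
Lemma matching_conj (V V' : finType) (tau : V -> V) (tau' : V' -> V') :
  #|V| = #|V'| -> ~~ odd #|V| -> matching tau -> matching tau' ->
  exists (f : V -> V') (g : V' -> V), [/\ cancel f g, cancel g f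
    & forall v, f (tau v) = tau' (f v)].
Proof.
move=> cV oV mt mt'; have [V0|/card_gt0P[x0 _]] := posnP #|V|.
  have F (v : V) : False by have := fintype0 v; rewrite V0.
  have G (v : V') : False by have := fintype0 v; rewrite -cV V0.
  by exists (fun v => False_rect _ (F v)), (fun v => False_rect _ (G v)); split=> v; case: (F v) || case: (G v).
have /card_gt0P[y0 _] : 0 < #|V'| by rewrite -cV; apply/card_gt0P; exists x0.
have [s [ps hs]] := matching_enum x0 mt; have [t [pt ht]] := matching_enum y0 mt'.
have sz : size s = #|V| by rewrite (perm_size ps) -cardE.
have szt : size t = #|V| by rewrite (perm_size pt) -cardE.
have us : uniq s by rewrite (perm_uniq ps) enum_uniq.
have ut : uniq t by rewrite (perm_uniq pt) enum_uniq.
have ins v : v \in s by rewrite (perm_mem ps) mem_enum.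
have int v : v \in t by rewrite (perm_mem pt) mem_enum.
have idx v : index v s < size t by rewrite szt -sz index_mem.
have idxt v : index v t < size s by rewrite sz -szt index_mem.
exists (fun v => nth y0 t (index v s)), (fun v => nth x0 s (index v t)); split=> v.
- by rewrite index_uniq // nth_index.
- by rewrite index_uniq // nth_index.
rewrite -{1}(nth_index x0 (ins v)); set j := index v s.
have js : j < size s by rewrite index_mem.
have [oj|ej] := boolP (odd j).
  have jE : j = j./2.*2.+1 by lia.
  have js2 : j./2.*2.+1 < size s by rewrite -jE.
  rewrite {1}jE -hs // (proj1 mt) index_uniq //; last by lia.
  by rewrite {2}jE -ht ?(proj1 mt') // szt -sz.
have jE : j = j./2.*2 by lia.
have js2 : j./2.*2.+1 < size s by rewrite -jE; move: oV js; rewrite -sz; lia.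
rewrite {1}jE hs // index_uniq // -ht; last by rewrite szt -sz.
by rewrite -jE.
Qed.

(** By degrees the packing misses exactly a perfect matching, and a conjugating bijection carries it
    to the prescribed [tau]. *)
Lemma leave_relabel (V : finType) n Ts (tau : 'I_n -> 'I_n) :
  #|V| = n -> ~~ odd n -> (2 * size Ts).+2 = n ->
  packs (fun u v : V => (u != v) : nat) Ts -> matching tau ->
  packs (fun u v : 'I_n => ((u != v) && (tau u != v)) : nat) Ts.
Proof.
move=> cV on sTs [Fs [fcs le]] mt.
pose S (u v : V) := \sum_(c <- flatten Fs) closed_mult c u v.
pose R (u v : V) := (u != v) - S u v.
have [||v|tauV [mV RV]] := @matching_of V R.
- move=> u v; rewrite /R eq_sym; congr (_ - _); apply: eq_bigr => c _; exact: closed_mult_sym.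
- by move=> v; rewrite /R eqxx.
- have : \sum_u (R v u + S v u) = n.-1.
    rewrite (eq_bigr (fun u => (u != v) : nat)) => [|u _]; last first.
      by rewrite /R eq_sym subnK // eq_sym; apply: le.
    rewrite -cV -(cardC1 v) -sum1_card [RHS]big_mkcond; apply: eq_bigr => u _.
    by rewrite !inE; case: eqP.
  by rewrite big_split /= /S (degree_factors v fcs) -sTs /=; lia.
have [||f [g [fK gK fg]]] := matching_conj _ _ mV mt; rewrite ?cV ?card_ord //.
have p : packs (fun u v : V => ((u != v) && (tauV u != v)) : nat) Ts.
  exists Fs; split=> // u v; have := RV u v; have := le u v; rewrite /R -/(S u v).
  by case: (u != v) => /=; case: (tauV u == v) => /=; lia.
apply: packs_mono (packs_bij fK gK p) => u v.
rewrite (inj_eq (can_inj gK)) -(inj_eq (can_inj fK) (tauV _)) fg !gK.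
exact: leqnn.
Qed.

Definition partner (j : nat) := if odd j then j.-1 else j.+1.

Lemma partner_lt n (j : 'I_n) : ~~ odd n -> partner j < n.
Proof. by move=> on; rewrite /partner; have := ltn_ord j; case: ifP => oj; lia. Qed.

Lemma path_mult_consecutive (V : eqType) (s t : seq V) a b :
  0 < path_mult (s ++ a :: b :: t) a b.
Proof.
case: s => [|c s]; first by rewrite path_mult_cons /edge_mult eqxx.
by rewrite path_mult_cat path_mult_cons /edge_mult eqxx; lia.
Qed.

Lemma path_mult_closed (V : eqType) (w : seq V) a b : path_mult w a b <= closed_mult w a b.
Proof.
by case: w => [|c w]; [rewrite /path_mult big_nil | rewrite closed_multE leq_addr].
Qed.

Lemma reshape_iota_mult T s j : all good_len T -> ~~ odd s -> ~~ odd j ->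
  s <= j < s + sumn T ->
  0 < \sum_(c <- reshape T (iota s (sumn T))) closed_mult c j j.+1.
Proof.
elim: T s => [|x T IHT] s /=; first by rewrite addn0 => _ _ _; lia.
move=> /andP[/andP[ox x4] gT] os oj /andP[sj jT].
rewrite iotaD take_size_cat ?size_iota // drop_size_cat ?size_iota // big_cons addn_gt0.
have [jx|xj] := ltnP j (s + x); last by rewrite orbC IHT //; lia.
apply/orP; left.
have xE : x = (j - s) + (s + x - j.+2).+2 by lia.
rewrite {1}xE iotaD subnKC //=.
apply: leq_trans (path_mult_consecutive (iota s (j - s)) (iota j.+2 (s + x - j.+2)) j j.+1) _.
exact: path_mult_closed.
Qed.

(** The cycles are laid out on consecutive integers. As all lengths are even, each cycle starts at
    an even number, so joining [2j] to [2j + 1] takes every other edge of it. The remaining edges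
    have degree one and give [tau2]. *)
Lemma single_packs n T : all good_len T -> sumn T = n -> exists tau1 tau2 : 'I_n -> 'I_n,
  [/\ matching tau1, matching tau2
    & packs (fun u v => (tau1 u == v) + (tau2 u == v)) [:: T]].
Proof.
move=> gT sT.
have on : ~~ odd n.
  rewrite -sT; elim: (T) gT => //= x s IHs /andP[/andP[ox _] /IHs].
  by rewrite oddD (negPf ox).
pose tau1 (u : 'I_n) : 'I_n := Ordinal (partner_lt u on).
have m1 : matching tau1.
  split=> [u|u /(congr1 val)] /=; last by rewrite /partner; case: ifP; lia.
  by apply: val_inj; rewrite /= /partner; case: (boolP (odd u)) => ou /=; [case: ifP; lia|rewrite ou].
pose cs := reshape T (enum 'I_n).
have szT : sumn T = size (enum 'I_n) by rewrite size_enum_ord.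
have fcs : factor_cycles T cs.
  apply/and3P; split; first by rewrite reshapeKr // szT.
    rewrite -(all_map size (leq 2)) -/(shape cs) reshapeKl ?szT //.
    by apply: sub_all gT => x /andP[_]; apply: leq_trans.
  by rewrite -/(shape cs) reshapeKl ?szT.
pose f u v := \sum_(c <- cs) closed_mult c u v.
have f1 u v : (tau1 u == v) <= f u v.
  have key (a b : 'I_n) : ~~ odd a -> b = a.+1 :> nat -> 0 < f a b.
    move=> oa ba; rewrite /f.
    rewrite (eq_bigr (fun c => closed_mult (map val c) (val a) (val b))) => [|c _]; last first.
      by rewrite closed_mult_map //; apply: val_inj.
    rewrite -(big_map (map val) predT (fun c => closed_mult c (val a) (val b))) map_reshape val_enum_ord
      (ba : val b = (val a).+1).
    rewrite (_ : iota 0 n = iota 0 (sumn T)); last by rewrite sT.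
    by apply: reshape_iota_mult => //; rewrite add0n sT ltn_ord.
  case: eqP => // <-; have [ou|eu] := boolP (odd u).
    rewrite /f (eq_bigr (fun c => closed_mult c (tau1 u) u)) => [|c _]; last exact: closed_mult_sym.
    by apply: key; rewrite /= /partner ou; lia.
  by apply: key => //=; rewrite /partner (negPf eu).
pose R u v := f u v - (tau1 u == v).
have fsym u v : f u v = f v u by apply: eq_bigr => c _; apply: closed_mult_sym.
have [|v|v|tau2 [m2 R2]] := @matching_of _ R.
- move=> u v; rewrite /R fsym; congr (_ - nat_of_bool _).
  by rewrite -(inj_eq (inv_inj (proj1 m1))) (proj1 m1) eq_sym.
- have : uniq (flatten cs) by rewrite reshapeKr ?szT // enum_uniq.
  case/and3P: fcs => _ c2 _; rewrite /R /f => ucs.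
  rewrite big1_seq ?sub0n // => c /= cin; apply: closed_mult_diag; last exact: (allP c2).
  elim: (cs) ucs cin => //= d ds IHd; rewrite cat_uniq inE => /and3P[ud _ uds].
  by case/orP=> [/eqP->|/IHd->].
- have : \sum_u (R v u + (tau1 v == u)) = 2.
    by rewrite -(degree_factor v fcs); apply: eq_bigr => u _; rewrite subnK.
  rewrite big_split /= (bigD1 (tau1 v) (F := fun u => (tau1 v == u) : nat)) //= eqxx.
  rewrite [X in _ + (_ + X)]big1 => [|u]; first by lia.
  by rewrite eq_sym => /negPf->.
exists tau1, tau2; split=> //; exists [:: cs]; split; first by rewrite /= fcs.
by move=> u v; rewrite /= cats0 -/(f u v) -R2 subnKC.
Qed.

Lemma pair_packs n T Ts1 Ts2 (V : finType) : #|V| = n -> all good_len T -> sumn T = n ->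
  (2 * size Ts1).+2 = n -> (2 * size Ts2).+2 = n ->
  packs (fun u v : V => (u != v) : nat) Ts1 -> packs (fun u v : V => (u != v) : nat) Ts2 ->
  packs (fun u v : 'I_n => (u != v) * 2) (T :: Ts1 ++ Ts2).
Proof.
move=> cV gT sT sz1 sz2 p1 p2; have [t1 [t2 [m1 m2 pT]]] := single_packs gT sT.
have on : ~~ odd n by lia.
have q1 := leave_relabel cV on sz1 p1 m1; have q2 := leave_relabel cV on sz2 p2 m2.
apply: packs_mono (packs_cat pT (packs_cat q1 q2)) => u v.
have [<-|_] := eqVneq u v; last by case: (t1 u == v); case: (t2 u == v).
by case: eqP => [/(proj2 m1)//|_]; case: eqP => [/(proj2 m2)//|_].
Qed.

(* Each pair of copies absorbs one further 2-factor of [Ss]. *)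
Lemma copies_packs n (V : finType) mu (Cs : seq (seq (seq nat))) Ss : #|V| = n ->
  size Cs = mu -> size Ss = mu./2 ->
  (forall C, C \in Cs -> (2 * size C).+2 = n /\ packs (fun u v : V => (u != v) : nat) C) ->
  (forall T, T \in Ss -> all good_len T /\ sumn T = n) ->
  packs (fun u v : 'I_n => (u != v) * mu) (Ss ++ flatten Cs).
Proof.
move=> cV; elim: mu {-2}mu (leqnn mu) Cs Ss => [|m IHm] mu lem Cs Ss.
  move: lem; rewrite leqn0 => /eqP-> /size0nil-> /size0nil-> _ _; exact: packs_nil.
case: mu lem => [|[|mu]] lem; first by move=> /size0nil-> /size0nil-> _ _; exact: packs_nil.
  case: Cs => [|C [|]] //= _ /size0nil-> hC _; rewrite cats0 /=.
  have [_ pC] := hC C (mem_head _ _).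
  pose f (v : V) : 'I_n := cast_ord cV (enum_rank v).
  pose g (u : 'I_n) : V := enum_val (cast_ord (esym cV) u).
  have fK : cancel f g by move=> v; rewrite /f /g cast_ordK enum_rankK.
  have gK : cancel g f by move=> u; rewrite /f /g enum_valK cast_ordKV.
  apply: packs_mono (packs_bij fK gK pC) => u v.
  by rewrite (inj_eq (can_inj gK)) muln1.
case: Cs => [|C1 [|C2 Cs]] //= [szC]; case: Ss => [|T Ss] //= [szS] hC hS.
have [sz1 p1] := hC C1 (mem_head _ _).
have [sz2 p2] : (2 * size C2).+2 = n /\ packs (fun u v : V => (u != v) : nat) C2.
  by apply: hC; rewrite !inE eqxx orbT.
have [gT sT] := hS T (mem_head _ _).
have pp := pair_packs cV gT sT sz1 sz2 p1 p2.
have IH : packs (fun u v : 'I_n => (u != v) * mu) (Ss ++ flatten Cs).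
  apply: IHm => //; [lia | move=> C CC | move=> T' TS].
    by apply: hC; rewrite !inE CC !orbT.
  by apply: hS; rewrite inE TS orbT.
apply: packs_perm (packs_mono _ (packs_cat pp IH)) => [|u v].
  by apply/permP=> q; rewrite /= !count_cat /= ?count_cat; lia.
by rewrite -mulnDr.
Qed.

(** * Packing one copy of the complete graph *)

Lemma hag_range N lo (Ts : seq (seq nat)) : 1 < N -> 2 * (lo + size Ts) <= N ->
  (forall T, T \in Ts -> all good_len T /\ sumn T = 2 * N.+1) ->
  packs (fun u v : option 'I_N * bool => (u.1 != v.1) &&
    (lo <= (edge_class N (col u) (col v))./2 < lo + size Ts) : nat) (Ts ++ Ts).
Proof.
move=> N1; elim: Ts lo => [|T Ts IHT] lo /= loN hT; first exact: packs_nil.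
have [gT sT] := hT T (mem_head _ _).
have iN : 2 * lo + 1 < N by lia.
have p1 := hag_pair N1 iN gT sT.
have p2 : packs (fun u v : option 'I_N * bool => (u.1 != v.1) &&
    (lo.+1 <= (edge_class N (col u) (col v))./2 < lo.+1 + size Ts) : nat) (Ts ++ Ts).
  apply: IHT => [|T' T'in]; first lia.
  by apply: hT; rewrite inE T'in orbT.
apply: packs_perm (packs_mono _ (packs_cat p1 p2)) => [|u v].
  by apply/permP=> q; rewrite /= !count_cat /=; lia.
by case: (u.1 != v.1) => //=; lia.
Qed.

Lemma copy_even k (Ts : seq (seq nat)) : 0 < k -> size Ts = k ->
  (forall T, T \in Ts -> all good_len T /\ sumn T = 2 * k.*2.+1) ->
  packs (fun u v : option 'I_k.*2 * bool => (u != v) : nat) (Ts ++ Ts).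
Proof.
move=> k0 szT hT; apply: packs_mono (@hag_range k.*2 0 Ts _ _ hT) => [u v||]; try lia.
by have [->|_] := eqVneq u v; rewrite ?eqxx ?leq_b1.
Qed.

Lemma copy_odd k T0 (Ts : seq (seq nat)) : 0 < k -> size Ts = k.-1 ->
  (forall T, T \in T0 :: Ts -> all good_len T /\ sumn T = 2 * k.*2.+2) ->
  packs (fun u v : option 'I_k.*2.+1 * bool => (u != v) : nat)
    ([:: T0; T0; T0] ++ (Ts ++ Ts)).
Proof.
move=> k0 szT hT; have [gT0 sT0] := hT T0 (mem_head _ _).
(* Starting at class pair 1, the [k - 1] zigzag cycles use the classes [2, ..., N - 2]; the classes
   0, 1 and [N - 1] belong to the ladder. *)
have [||T TT|Fs pFs] := @hag_range k.*2.+1 1 Ts; try lia.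
  by apply: hT; rewrite inE TT orbT.
have p1 : ladder_packs k T0 by apply: lad_triple => //; rewrite sT0; lia.
apply: packs_mono (packs_cat p1 (ex_intro _ Fs pFs)) => u v.
rewrite lad_graph_sub //; have [->|_] := eqVneq u v; first by rewrite eqxx.
case: eqP => [_|_] //=; rewrite ?addn0 // szT !inE.
by move: (edge_class _ _ _) => c; lia.
Qed.

(** * Triples, pairs and singles from the refinement *)

Lemma flatten_dup (A : eqType) (cs : seq (seq A)) :
  perm_eq (flatten [seq c ++ c | c <- cs]) (flatten cs ++ flatten cs).
Proof.
by apply/permP=> q; elim: cs => //= c cs IH; move: IH; rewrite !count_cat; lia.
Qed.

Lemma flatten_triples (A : eqType) (R : seq A) (cs : seq (seq A)) : size R = size cs ->
  perm_eq (flatten [seq [:: p.1; p.1; p.1] ++ (p.2 ++ p.2) | p <- zip R cs])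
    ((R ++ R ++ R) ++ flatten cs ++ flatten cs).
Proof.
move=> sz; apply/permP=> q; elim: R cs sz => [|r R IHR] [|c cs] //= [/IHR].
by rewrite !count_cat /= ?count_cat /= ?count_cat; lia.
Qed.

(* Enough pairs [E], [E] are split to make exactly [h] single 2-factors. *)
Lemma split_singles (A : eqType) (O E : seq A) h d : size O <= h ->
  size O + 2 * size E = 2 * d + h -> exists S D,
  [/\ perm_eq (O ++ E ++ E) (S ++ D ++ D), size S = h & size D = d].
Proof.
move=> Oh e; pose j := (h - size O)./2.
exists (O ++ take j E ++ take j E), (drop j E); split.
- apply/permP=> q; rewrite -{1 2}(cat_take_drop j E) !count_cat; lia.
- by rewrite !size_cat size_take_min /j; lia.
- by rewrite size_drop /j; lia.
Qed.

Lemma subset_card (J : finType) (A : {set J}) b : b <= #|A| -> exists B : {set J}, B \subset A /\ #|B| = b.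
Proof.
move=> bA; exists [set j in take b (enum A)]; split.
  by apply/subsetP=> j; rewrite inE => /mem_take; rewrite mem_enum.
rewrite cardsE (card_uniqP _) ?take_uniq ?enum_uniq // size_take_min -cardE.
exact/minn_idPl.
Qed.

Lemma count_parts (J : finType) (A : eqType) (f : J -> nat) (X : J -> A) q :
  count q (flatten [seq nseq (f j) (X j) | j <- enum J]) = \sum_j f j * q (X j).
Proof.
rewrite count_flatten -map_comp sumnE big_map big_enum /=; apply: eq_bigr => j _.
by rewrite /= count_nseq mulnC.
Qed.

(** A part in [B] gives a triple and pairs, which takes one pair away from its half; any other odd
    part gives a single and pairs, an even part only pairs. *)
Lemma parts_split (J : finType) (A : eqType) (a : J -> nat) (X : J -> A) (B : {set J})
    (R := [seq X j | j <- enum B]) (O := [seq X j | j <- enum ([set j | odd (a j)] :\: B)])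
    (E := flatten [seq nseq ((a j)./2 - (j \in B)) (X j) | j <- enum J]) :
  B \subset [set j | odd (a j) && (3 <= a j)] ->
  perm_eq (flatten [seq nseq (a j) (X j) | j <- enum J]) ((R ++ R ++ R) ++ (O ++ E ++ E)).
Proof.
move/subsetP=> BA; apply/permP=> q.
have cs (C : {set J}) : count q [seq X j | j <- enum C] = \sum_j (j \in C) * q (X j).
  rewrite count_map -sum1_count big_enum_cond /= [LHS]big_mkcond; apply: eq_bigr => j _ /=.
  by case: (j \in C); case: (q _).
rewrite !count_cat count_parts !cs !count_parts -!big_split /=; apply: eq_bigr => j _.
rewrite !inE; have := BA j; rewrite inE -!mulnDl; case: (j \in B) => /= [/(_ isT)/andP[oj a3]|_];
  congr (_ * _); rewrite ?andbT; lia.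
Qed.

Definition good_type n (T : seq nat) := all good_len T /\ sumn T = n.

Lemma mem_chunk (A : eqType) mu d (D : seq A) C T : C \in reshape (nseq mu d) D -> T \in C -> T \in D.
Proof.
elim: mu D => //= mu IHmu D; rewrite inE => /orP[/eqP->|CD TC].
  exact: mem_take.
by have := IHmu _ CD TC; apply: mem_drop.
Qed.

Lemma size_chunk (A : eqType) mu d (D : seq A) C : size D = mu * d ->
  C \in reshape (nseq mu d) D -> size C = d.
Proof.
move=> sD CD; have : size C \in shape (reshape (nseq mu d) D) by apply: map_f.
by rewrite reshapeKl ?sumn_nseq ?sD 1?mulnC // => /nseqP[].
Qed.

Lemma flatten_chunk (A : eqType) mu d (D : seq A) : size D = mu * d ->
  flatten (reshape (nseq mu d) D) = D.
Proof. by move=> sD; rewrite reshapeKr // sumn_nseq sD mulnC. Qed.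

Lemma half_degree mu k : (mu * (2 * k.*2.+2).-1)./2 = 2 * (mu * k) + mu + mu./2.
Proof.
rewrite (_ : (2 * k.*2.+2).-1 = 4 * k + 3); last lia.
by rewrite mulnDr mulnCA; move: (mu * k) => x; lia.
Qed.

(** There are [2 * k + 1] columns. Each of the [mu] copies takes [k] pairs, and every two copies
    absorb one single. *)
Lemma packs_2mod4 n k mu (O E : seq (seq nat)) : n = 2 * k.*2.+1 -> 0 < k -> size O <= mu./2 ->
  size O + 2 * size E = 2 * (mu * k) + mu./2 ->
  (forall T, T \in O ++ E -> good_type n T) ->
  packs (fun u v : 'I_n => (u != v) * mu) (O ++ E ++ E).
Proof.
move=> nE k0 Omu sz good; have [S [D [p sS sD]]] := split_singles Omu sz.
have goodSD T : T \in S ++ D -> good_type n T.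
  move=> TS; apply: good; have : T \in S ++ D ++ D by move: TS; rewrite !mem_cat => /orP[]->; rewrite ?orbT.
  by rewrite -(perm_mem p) !mem_cat orbb.
pose Cs := [seq C ++ C | C <- reshape (nseq mu k) D].
have pC : perm_eq (S ++ flatten Cs) (O ++ E ++ E).
  rewrite perm_sym; apply: perm_trans p _; rewrite perm_cat2l perm_sym.
  by apply: perm_trans (flatten_dup _) _; rewrite flatten_chunk.
apply: packs_perm pC _.
apply: (@copies_packs n (option 'I_k.*2 * bool)%type) => //.
- by rewrite card_prod card_option card_ord card_bool nE mulnC.
- by rewrite size_map size_reshape size_nseq.
- move=> _ /mapP[C CD ->]; have szC := size_chunk sD CD; split.
    by rewrite size_cat szC nE; lia.
  by apply: copy_even => // T TC; rewrite -nE; apply: goodSD; rewrite mem_cat (mem_chunk CD TC) orbT.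
by move=> T TS; apply: goodSD; rewrite mem_cat TS.
Qed.

(** There are [2 * k + 2] columns. Each copy takes one triple and [k - 1] pairs, and every two
    copies absorb one single. *)
Lemma packs_0mod4 n k mu (R O E : seq (seq nat)) : n = 2 * k.*2.+2 -> 0 < k -> size R = mu ->
  size O <= mu./2 -> size O + 2 * size E = 2 * (mu * k.-1) + mu./2 ->
  (forall T, T \in R ++ O ++ E -> good_type n T) ->
  packs (fun u v : 'I_n => (u != v) * mu) ((R ++ R ++ R) ++ (O ++ E ++ E)).
Proof.
move=> nE k0 sR Omu sz good; have [S [D [p sS sD]]] := split_singles Omu sz.
have goodSD T : T \in S ++ D -> good_type n T.
  move=> TS; apply: good; rewrite mem_cat; apply/orP; right.
  have : T \in S ++ D ++ D by move: TS; rewrite !mem_cat => /orP[]->; rewrite ?orbT.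
  by rewrite -(perm_mem p) !mem_cat orbb.
have szch : size (reshape (nseq mu k.-1) D) = mu by rewrite size_reshape size_nseq.
pose Cs := [seq [:: q.1; q.1; q.1] ++ (q.2 ++ q.2) | q <- zip R (reshape (nseq mu k.-1) D)].
have pC : perm_eq (S ++ flatten Cs) ((R ++ R ++ R) ++ (O ++ E ++ E)).
  rewrite perm_sym; apply: perm_trans (_ : perm_eq ((R ++ R ++ R) ++ S ++ D ++ D) _).
    by rewrite perm_cat2l.
  rewrite perm_catCA perm_cat2l perm_sym.
  by apply: perm_trans (flatten_triples _) _; rewrite ?szch // flatten_chunk.
apply: packs_perm pC _.
apply: (@copies_packs n (option 'I_k.*2.+1 * bool)%type) => //.
- by rewrite card_prod card_option card_ord card_bool nE mulnC.
- by rewrite size_map size_zip szch sR minnn.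
- move=> _ /mapP[[T0 C] TC ->]; have [T0R CD] : T0 \in R /\ C \in reshape (nseq mu k.-1) D.
    have := map_f fst TC; have := map_f snd TC.
    by rewrite -/(unzip1 _) -/(unzip2 _) unzip1_zip ?unzip2_zip ?szch ?sR.
  have szC := size_chunk sD CD; split; first by rewrite !size_cat szC nE /=; lia.
  apply: copy_odd => // T; rewrite -nE inE => /orP[/eqP->|TC'].
    by apply: good; rewrite mem_cat T0R.
  by apply: goodSD; rewrite mem_cat (mem_chunk CD TC') orbT.
by move=> T TS; apply: goodSD; rewrite mem_cat TS.
Qed.

Lemma refinement_index s k (alpha : 'I_k -> nat) (beta : 'I_s -> nat) :
  refinement alpha beta -> exists idx : 'I_k -> 'I_s,
    forall i, beta i = \sum_(j | idx j == i) alpha j.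
Proof.
case=> _ _ [P [Pinj /and3P[/eqP cov /trivIsetP triv _] sumP]].
have ex j : exists i, j \in P i.
  have : j \in cover [set P i | i : 'I_s] by rewrite cov inE.
  by case/bigcupP=> _ /imsetP[i _ ->] ji; exists i.
have [idx idxP] := fin_all_exists ex; exists idx => i; rewrite -sumP.
apply: eq_bigl => j; apply/idP/eqP => [jP|<- //].
apply: contraTeq (idxP j) => ne; apply/negP => jP'.
(* Injectivity of [P] makes the blocks of different indices different, and different blocks of a
   partition are disjoint. *)
have dj : [disjoint P (idx j) & P i].
  by apply: triv; rewrite ?imset_f // (inj_eq Pinj).
by rewrite (disjointFr dj jP') in jP.
Qed.

Lemma parts_perm s k (alpha : 'I_k -> nat) (beta : 'I_s -> nat) (T : 'I_s -> seq nat)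
    (idx : 'I_k -> 'I_s) : (forall i, beta i = \sum_(j | idx j == i) alpha j) ->
  perm_eq (type_with_mult T beta) (flatten [seq nseq (alpha j) (T (idx j)) | j <- enum 'I_k]).
Proof.
move=> hb; apply/permP=> q; rewrite /type_with_mult !count_parts.
rewrite [RHS](partition_big idx predT) //=; apply: eq_bigr => i _.
by rewrite hb big_distrl /=; apply: eq_bigr => j /eqP<-.
Qed.

Lemma map_type_with_mult s (T : 'I_s -> seq nat) beta m :
  [seq scale_type m t | t <- type_with_mult T beta] =
  type_with_mult (fun i => scale_type m (T i)) beta.
Proof.
rewrite /type_with_mult map_flatten -map_comp; congr flatten.
by apply: eq_map => i; rewrite /= map_nseq.
Qed.

Theorem theorem10p1 (n lam m s : nat) (T : 'I_s -> factor_type)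
    (beta : 'I_s -> nat)
    (n_gt0 : 0 < n) (n_even : ~~ odd n) (lam_gt0 : 0 < lam) (m_gt0 : 0 < m)
    (adm : admissible_factorization (lam * m) n (type_with_mult T beta))
    (bip : bipartite_factorization (type_with_mult T beta))
    (T_adm : forall i, admissible_factor 1 n (T i))
    (T_bip : forall i, bipartite_factor (T i))
    (href : exists (k : nat) (alpha : 'I_k -> nat),
       refinement alpha beta /\
       ((n = 2 %[mod 4] /\
         #|[set i | odd (alpha i)]| <= (lam * m)./2)
        \/
        [/\ n = 0 %[mod 4],
            #|[set i | odd (alpha i)]| <= lam * m + (lam * m)./2
          & lam * m <= #|[set i | odd (alpha i) && (3 <= alpha i)]|])) :
  has_two_factorization (complete_multipartite lam n m)
    (type_with_mult (fun i => scale_type m (T i)) beta).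
Proof.
have /andP[/eqP szTT _] := adm; set mu := lam * m in adm href szTT.
suff pk : packs (fun u v : 'I_n => (u != v) * mu) (type_with_mult T beta).
  apply: (packs_two_factorization (r := lam * m * n.-1)).
  - exact: complete_multipartite_regular.
  - by rewrite -map_type_with_mult size_map.
  - rewrite -map_type_with_mult; apply: packs_mono (blow_up m_gt0 pk) => u v /=.
    by case: eqP; rewrite ?mul0n ?mul1n.
have mu0 : 0 < mu by rewrite muln_gt0 lam_gt0.
clearbody mu; have goodT i : good_type n (T i).
  have := T_adm i; rewrite /admissible_factor eqxx => /andP[T3 /eqP sT]; split=> //.
  apply/allP=> x xT; have := allP T3 x xT; have := allP (T_bip i) x xT.
  by rewrite /good_len; lia.
have [k [alpha [ref cases]]] := href; have [idx hb] := refinement_index ref.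
have pTT := parts_perm T hb; rewrite perm_sym in pTT; apply: (packs_perm pTT).
rewrite -(perm_size pTT) in szTT.
set A3 := [set i | odd (alpha i) && (3 <= alpha i)] in cases.
set A1 := [set i | odd (alpha i)] in cases.
have goodX (S : seq 'I_k) (f : 'I_k -> nat) t : t \in flatten [seq nseq (f j) (T (idx j)) | j <- S] -> good_type n t.
  by case/flatten_mapP=> j _ /nseqP[-> _].
have goodY (S : seq 'I_k) t : t \in [seq T (idx j) | j <- S] -> good_type n t.
  by case/mapP=> j _ ->.
have split_parts B := @parts_split _ _ alpha (fun j => T (idx j)) B.
case: cases => [[n2 le1]|[n0 le1 le3]].
  have p := split_parts set0 (sub0set _); rewrite enum_set0 in p.
  set O := [seq T (idx j) | j <- enum _] in p; set E := flatten [seq nseq (_ - _) _ | j <- _] in p.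
  have szO : size O <= mu./2 by rewrite /O size_map -cardE setD0.
  rewrite perm_sym in p; apply: (packs_perm p).
  have good t : t \in O ++ E -> good_type n t.
    by rewrite mem_cat => /orP[/goodY|/goodX].
  have n4 : n %% 4 = 2 by rewrite n2.
  have nE : n = 2 * (n %/ 4).*2.+1 by lia.
  (* For [n = 2] no type has all lengths at least 4, so there is nothing to pack. *)
  have [k0|k0] := posnP (n %/ 4).
    rewrite k0 in nE.
    have no t : t \notin O ++ E.
      apply/negP=> /good[]; rewrite nE; case: t => [|x t] //= /andP[/andP[_ x4] _]; lia.
    case: (O) (E) no => [|t O'] [|t' E'] no; first exact: packs_nil.
    - by have := no t'; rewrite mem_head.
    - by have := no t; rewrite mem_head.
    - by have := no t; rewrite mem_head.
  apply: (packs_2mod4 nE k0 szO _ good).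
  move: szTT; rewrite -(perm_size p) !size_cat /=; nia.
(* Exactly [mu] odd parts of size at least 3 supply the triples, which leaves at most [mu./2] odd
   parts to supply singles. *)
have [B [BA cB]] := subset_card le3.
have p := split_parts B BA.
set R := [seq T (idx j) | j <- enum B] in p; set O := [seq T (idx j) | j <- enum _] in p.
set E := flatten [seq nseq (_ - _) _ | j <- _] in p.
have szR : size R = mu by rewrite /R size_map -cardE.
have szO : size O <= mu./2.
  rewrite /O size_map -cardE cardsD (setIidPr _); first by rewrite cB leq_subLR.
  by apply: subset_trans BA _; apply/subsetP=> j; rewrite !inE => /andP[].
rewrite perm_sym in p; apply: (packs_perm p).
have good t : t \in R ++ O ++ E -> good_type n t.
  by rewrite !mem_cat => /or3P[/goodY|/goodY|/goodX].
have n4 : n %% 4 = 0 by rewrite n0.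
have nE : n = 2 * (n %/ 4).-1.*2.+2 by lia.
have szE : 3 * mu + size O + 2 * size E = (mu * n.-1)./2.
  by rewrite -szTT -(perm_size p) !size_cat szR !mulSn !mul0n !addn0 !addnA.
(* For [n = 4] the triples alone would be [3 * mu] factors, more than the [(3 * mu)./2]
   available. *)
have k0 : 0 < (n %/ 4).-1.
  have [e|//] := posnP (n %/ 4).-1.
  by move: szE; rewrite nE e /=; lia.
apply: (packs_0mod4 nE k0 szR szO _ good).
move: szE; rewrite [in n.-1]nE half_degree; case: (_.-1) k0 => // K _.
by rewrite mulnS /=; move: (size O) (size E) (mu * K) (mu./2) => *; lia.
Qed.
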